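(* Let $\alpha\in\{2,3,4\}$ and let $M_t$, $t\in[0,T)$, be a family of smooth closed strictly convex surfaces in $\mathbb{R}^3$ flowing according to $\frac{d}{dt}X=-(\operatorname{tr}A^{\alpha+2})\nu$. Then $$\max_{M_t}\frac{(\lambda_1^\alpha+\lambda_2^\alpha)(\lambda_1+\lambda_2)(\lambda_1-\lambda_2)^2}{\lambda_1\lambda_2}$$ is non-increasing in time.
   Context: A closed surface is a compact connected embedded surface without boundary. $X=X(x,t)$ is the (smooth) embedding vector of $M_t$ into $\mathbb{R}^3$, $\frac{d}{dt}X$ its total time derivative, and $\nu$ the outer unit normal to $M_t$. The principal curvatures $\lambda_1,\lambda_2$ are the eigenvalues of the second fundamental form with respect to the induced metric, with sign such that round spheres have positive principal curvatures. A surface is strictly convex if all its principal curvatures are strictly positive. $\operatorname{tr}A^{k}=\lambda_1^{k}+\lambda_2^{k}$. *)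

(* Defs.v *)
From HB Require Import structures.
From mathcomp Require Import all_boot all_order all_algebra.
From mathcomp Require Import all_classical all_reals all_analysis.

Set Implicit Arguments.
Unset Strict Implicit.
Unset Printing Implicit Defensive.

Import Order.TTheory GRing.Theory Num.Theory.
Import numFieldNormedType.Exports.

Local Open Scope classical_set_scope.
Local Open Scope ring_scope.

(* The library norm on row vectors is the maximum norm; Euclidean lengths and
   angles go through [dot]. *)
Definition dot (R : realType) (n : nat) (u v : 'rV[R]_n) : R :=
  \sum_(i < n) u 0 i * v 0 i.

Fixpoint Ck (R : realType) (V W : normedModType R) (k : nat) (U : set V)
    (f : V -> W) : Prop :=
  match k with
  | 0%N => forall x, U x -> {for x, continuous f}
  | k'.+1 => (forall x, U x -> differentiable f x) /\
             forall v : V, Ck k' U (fun x => 'D_v f x)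
  end.

(* Smoothness of the restriction of f to an arbitrary set A: locally, f agrees
   on A with a C^oo function defined on an open set of the ambient space. For A
   a surface or a surface times a half-open interval, this is the usual notion
   on manifolds (with boundary). *)
Definition smooth_on (R : realType) (V W : normedModType R) (A : set V)
    (f : V -> W) : Prop :=
  forall x, A x -> exists (N : set V) (F : V -> W),
    [/\ open N, N x, (forall k, Ck k N F) &
        forall y, A y -> N y -> f y = F y].

Definition diffeomorphism (R : realType) (V W : normedModType R)
    (A : set V) (B : set W) (f : V -> W) : Prop :=
  [/\ set_bij A B f, smooth_on A f &
      exists g : W -> V, smooth_on B g /\ forall x, A x -> g (f x) = x].

Definition embedding (R : realType) (V W : normedModType R) (A : set V)
    (f : V -> W) : Prop :=
  diffeomorphism A (f @` A) f.

Definition local_parametrization (R : realType) (M : set 'rV[R]_3)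
    (U : set 'rV[R]_2) (phi : 'rV[R]_2 -> 'rV[R]_3) : Prop :=
  open U /\
  exists N : set 'rV[R]_3, open N /\ diffeomorphism U (M `&` N) phi.

Definition closed_surface (R : realType) (M : set 'rV[R]_3) : Prop :=
  [/\ M !=set0, compact M, connected M &
      forall p, M p -> exists U phi,
        local_parametrization M U phi /\ (phi @` U) p].

Definition tangent_space (R : realType) (M : set 'rV[R]_3) (p : 'rV[R]_3) :
    set 'rV[R]_3 :=
  [set w | exists U phi a v,
     [/\ local_parametrization M U phi, U a, phi a = p & w = 'D_v phi a]].

Definition exterior (R : realType) (M : set 'rV[R]_3) : set 'rV[R]_3 :=
  [set x | ~ M x /\ ~ bounded_set (connected_component (~` M) x)].

Definition outer_unit_normal (R : realType) (M : set 'rV[R]_3)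
    (p n : 'rV[R]_3) : Prop :=
  [/\ dot n n = 1,
      (forall w, tangent_space M p w -> dot n w = 0) &
      \forall s \near (0 : R)^'+, exterior M (p + s *: n)].

Definition metric (R : realType) (phi : 'rV[R]_2 -> 'rV[R]_3)
    (a : 'rV[R]_2) : 'M[R]_2 :=
  \matrix_(i, j) dot ('D_(delta_mx 0 i) phi a) ('D_(delta_mx 0 j) phi a).

(* The minus sign makes round spheres positively curved for the outer normal. *)
Definition second_fundamental_form (R : realType)
    (phi : 'rV[R]_2 -> 'rV[R]_3) (a : 'rV[R]_2) (n : 'rV[R]_3) : 'M[R]_2 :=
  \matrix_(i, j)
    - dot ('D_(delta_mx 0 i) (fun b => 'D_(delta_mx 0 j) phi b) a) n.

(* l1 and l2 are the eigenvalues, with multiplicity, of the second fundamental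
   form of M at p (for the normal n) with respect to the induced metric. Being
   independent of the parametrization, this may be required in all of them. *)
Definition principal_curvatures (R : realType) (M : set 'rV[R]_3)
    (p n : 'rV[R]_3) (l1 l2 : R) : Prop :=
  forall U phi a, local_parametrization M U phi -> U a -> phi a = p ->
    char_poly (second_fundamental_form phi a n *m invmx (metric phi a)) =
      ('X - l1%:P) * ('X - l2%:P).

Definition time_interval (R : realType) (T : \bar R) : set R :=
  [set t | 0 <= t /\ (t%:E < T)%E].

(* Derivative along I, hence one-sided at an endpoint belonging to I. *)
Definition has_derivative_within (R : realType) (V : normedModType R)
    (I : set R) (f : R -> V) (t : R) (v : V) : Prop :=
  h^-1 *: (f (t + h) - f t) @[h --> within [set h | I (t + h)] 0^'] --> v.

Definition is_maximum (R : realType) (E : set R) (m : R) : Prop :=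
  E m /\ ubound E m.

(* Main.v *)
Require Import Defs.
From HB Require Import structures.
From mathcomp Require Import all_boot all_order all_algebra.
From mathcomp Require Import all_classical all_reals all_analysis.
From mathcomp Require Import ring lra.

(** Let w be the quantity in question and F the speed. By strict convexity w is
    nonnegative, and it is continuous on S x [0, T), because it is a continuous
    function of the mean and Gauss curvatures. Let w - eps (t - t1) attain its maximum
    over the compact set S x [t1, t2] at (x0, t0). If t0 > t1 then w(x0, t0) > 0, so
    x0 is not umbilic; x0 maximizes w over S at time t0, and the time derivative of w
    there is at least eps. This is contradicted by showing that it is negative. Hence
    t0 = t1, and letting eps tend to 0 gives the theorem.

    Near a point that is not umbilic the principal curvatures a, b and principal
    unit directions E1, E2 are smooth. With p and q the connection coefficients of
    this frame, the following identities hold: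
      Codazzi, E2 a = p (a - b) and E1 b = q (a - b);
      Gauss, E1 q - E2 p = - a b - p^2 - q^2;
      evolution, d/dt a = E1 E1 F - p E2 F + F a^2 and
                 d/dt b = E2 E2 F + q E1 F + F b^2.
    They are proved by differential algebra over the ring of smooth functions, in
    frame_codazzi, frame_gauss and frame_evolution; principal_frame_exists constructs
    the frame. The derivatives of the Codazzi equations and the Gauss equation
    give Simons' identity for E1 E1 b - E2 E2 a.

    With subscripts for the partial derivatives of w and F in a and b, insert this in
    d/dt w = w_a d/dt a + w_b d/dt b. The second derivatives form
    F_a E1 E1 w + F_b E2 E2 w, which is nonpositive at the maximum, up to a multiple of
    the difference that Simons' identity evaluates. As E1 w = E2 w = 0, the
    derivatives of a and b along one direction are determined by one number, and
    so is q or p by the Codazzi equations. What remains is a negative semidefinite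
    quadratic form in these two numbers plus a term without derivatives, which is
    negative. For alpha = 2, 3, 4 these signs hold for a transparent reason: in
    terms of the smaller curvature and the difference of the two, all coefficients of
    the polynomials involved have the required sign (gradient_form_le0,
    zero_order_lt0, combined in evolution_lt0).

    It remains to read the geometry in charts. The flow is a smooth map Z of two
    spatial parameters and time (flow_chart_exists). Its principal curvatures and
    its normal are prescribed pointwise only; the normal is smooth because its
    sign is that of the mean curvature computed from the normal field
    D_1 Z x D_2 Z (unit_normalE, patch_decreases). *)

Set Implicit Arguments.
Unset Strict Implicit.
Unset Printing Implicit Defensive.

Import Order.TTheory GRing.Theory Num.Theory.
Import numFieldNormedType.Exports.
Local Open Scope classical_set_scope.
Local Open Scope ring_scope.

(** * Calculus of iterated directional derivatives *)

Section CkBasics.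
Context {R : realType} {V W : normedModType R}.
Implicit Types (f g : V -> W) (U : set V).

Lemma near_open U (P : V -> Prop) x :
  open U -> U x -> (forall y, U y -> P y) -> \forall y \near x, P y.
Proof. by move=> oU Ux UP; apply: filterS (open_nbhs_nbhs (conj oU Ux)). Qed.

Lemma derive_eq_on U f g v x : open U -> U x -> (forall y, U y -> f y = g y) ->
  'D_v f x = 'D_v g x.
Proof. by move=> oU Ux fg; apply/near_eq_derive/(near_open oU Ux). Qed.

Lemma near_eq_differentiable f g x : (\near x, f x = g x) ->
  differentiable f x -> differentiable g x.
Proof.
move=> fg df; have [cdf dfE] := (diff_locallyP x f).1 df.
have gE : g \o shift x = cst (g x) + 'd f x +o_ (0 : V) id.
  apply/eqaddoP => e e0; have := (eqaddoP _ _ _ _).1 dfE e e0.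
  have fgx : f x = g x by exact: (nbhs_singleton fg).
  have : \forall y \near (0 : V), f (y + x) = g (y + x).
    by have := fg; rewrite (near_shift 0 x) /= ; apply: filterS => y; rewrite subr0.
  move=> fg0; apply: filterS2 fg0 => y fgy; rewrite !fctE /= /shift/= fgy fgx.
  by [].
by apply/diff_locallyP; rewrite (diff_unique cdf gE).
Qed.

Lemma Ck_eq_on k U f g : open U -> (forall y, U y -> f y = g y) ->
  Ck k U f -> Ck k U g.
Proof.
move=> oU; elim: k f g => [|k IH] f g fg /=.
  move=> cf x Ux; have nfg := near_open oU Ux fg.
  rewrite /prop_for /continuous_at -(fg _ Ux).
  by apply: cvg_trans (cf x Ux); apply: near_eq_cvg; apply: filterS nfg.
move=> [df Cf]; split=> [x Ux|v].
  exact: near_eq_differentiable (near_open oU Ux fg) (df x Ux).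
by apply: IH (Cf v) => y Uy; apply: derive_eq_on oU Uy fg.
Qed.

Lemma Ck_subset k U U' f : U' `<=` U -> Ck k U f -> Ck k U' f.
Proof.
move=> sU; elim: k f => [|k IH] f /=; first by move=> cf x /sU; apply: cf.
by move=> [df Cf]; split=> [x /sU /df|v] //; apply: IH.
Qed.

Lemma Ck_pred k U f : Ck k.+1 U f -> Ck k U f.
Proof.
elim: k f => [|k IH] f; first by move=> [df _] x /df /differentiable_continuous.
by move=> [df Cf]; split=> // v; apply: IH.
Qed.

Lemma Ck_cst k U (c : W) : Ck k U (fun _ : V => c).
Proof.
elim: k c => [|k IH] c /=; first by move=> x _; apply: cst_continuous.
split=> [x _|v]; first exact: differentiable_cst.
suff -> : (fun x => 'D_v (fun _ : V => c) x) = fun _ => 0 by [].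
by apply: funext => x; exact: derive_cst.
Qed.

Lemma CkD k U f g : open U -> Ck k U f -> Ck k U g -> Ck k U (fun x => f x + g x).
Proof.
move=> oU; elim: k f g => [|k IH] f g /=.
  by move=> cf cg x Ux; apply: continuousD; [exact: cf|exact: cg].
move=> [df Cf] [dg Cg]; split=> [x Ux|v]; first by apply: differentiableD; auto.
apply: Ck_eq_on (IH _ _ (Cf v) (Cg v)) => // x Ux.
by rewrite deriveD //; apply: diff_derivable; auto.
Qed.

Lemma Ck_sum k U n (F : 'I_n -> V -> W) : open U ->
  (forall i, Ck k U (F i)) -> Ck k U (fun x => \sum_i F i x).
Proof.
move=> oU CF; elim: n F CF => [|n IH] F CF.
  by under eq_fun do rewrite big_ord0; apply: Ck_cst.
under eq_fun do rewrite big_ord_recr /=.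
by apply: CkD => //; apply: IH.
Qed.

End CkBasics.

Section CkLinear.
Context {R : realType} {V W Z : normedModType R}.

Lemma Ck_linear_comp k (U : set V) (f : V -> W) (L : {linear W -> Z}) :
  open U -> continuous L -> Ck k U f -> Ck k U (L \o f).
Proof.
move=> oU cL; elim: k f => [|k IH] f /=.
  by move=> cf x Ux; apply: continuous_comp; [exact: cf|exact: cL].
have dL y : differentiable L y by exact: linear_differentiable.
move=> [df Cf]; split=> [x Ux|v]; first by apply: differentiable_comp; auto.
apply: Ck_eq_on (IH _ (Cf v)) => // x Ux /=.
rewrite (deriveE _ (df x Ux)) (deriveE _ (differentiable_comp (df x Ux) (dL _))).
by rewrite (diff_comp (df x Ux) (dL _)) /= (diff_lin _ cL).
Qed.

Lemma Ck_comp_linear k (U : set W) (f : W -> Z) (L : {linear V -> W}) :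
  open U -> continuous L -> Ck k U f -> Ck k (L @^-1` U) (f \o L).
Proof.
move=> oU cL.
have oLU : open (L @^-1` U) by apply: open_comp => // ? ?; exact: cL.
elim: k f => [|k IH] f /=.
  by move=> cf x Ux; apply: continuous_comp; [exact: cL|exact: cf].
have dL y : differentiable L y by exact: linear_differentiable.
move=> [df Cf]; split=> [x Ux|v]; first by apply: differentiable_comp; auto.
apply: Ck_eq_on (IH _ (Cf (L v))) => // x Ux /=.
rewrite (deriveE _ (df _ Ux)) (deriveE _ (differentiable_comp (dL _) (df _ Ux))).
by rewrite (diff_comp (dL _) (df _ Ux)) /= (diff_lin _ cL).
Qed.

Lemma Ck_linear k (U : set V) (L : {linear V -> Z}) :
  continuous L -> Ck k U L.
Proof.
move=> cL; case: k => [|k] /=; first by move=> x _; apply: cL.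
have dL y : differentiable L y by exact: linear_differentiable.
split=> [x _|v]; first exact: dL.
suff -> : (fun x => 'D_v L x) = fun _ => L v by exact: Ck_cst.
by apply: funext => x; rewrite deriveE // diff_lin.
Qed.

End CkLinear.

Section CkScalar.
Context {R : realType} {V : normedModType R}.
Implicit Types (f g : V -> R^o) (U : set V).

Lemma CkM k U f g : open U -> Ck k U f -> Ck k U g ->
  Ck k U (fun x => f x * g x : R^o).
Proof.
move=> oU; elim: k f g => [|k IH] f g.
  by move=> cf cg x Ux; apply: (@continuousM R V); [exact: cf|exact: cg].
move=> Cf Cg; have [df dCf] := Cf; have [dg dCg] := Cg.
split=> [x Ux|v].
  exact: (@differentiableM R V f g x (df x Ux) (dg x Ux)).
apply: (Ck_eq_on (f := fun x => f x * 'D_v g x + g x * 'D_v f x : R^o)) => //.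
  move=> x Ux; rewrite (@deriveM R V f g) //; apply: diff_derivable; auto.
apply: CkD => //; apply: IH; [exact: Ck_pred|exact: dCg|exact: Ck_pred|exact: dCf].
Qed.

Lemma CkN k U f : open U -> Ck k U f -> Ck k U (fun x => - f x : R^o).
Proof.
move=> oU Cf; have := CkM oU (Ck_cst k U (-1 : R^o)) Cf.
by apply: Ck_eq_on => // x _; rewrite mulN1r.
Qed.

Lemma CkV k U f : open U -> (forall x, U x -> f x != 0) -> Ck k U f ->
  Ck k U (fun x => (f x)^-1 : R^o).
Proof.
move=> oU f0; elim: k => [|k IH].
  by move=> cf x Ux; apply: (@continuousV R V); [exact: f0|exact: cf].
move=> Cf; have [df dCf] := Cf.
have CV : Ck k U (fun x => (f x)^-1 : R^o) by apply: IH; apply: Ck_pred.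
split=> [x Ux|v]; first exact: (@differentiableV R V f x (df x Ux) (f0 x Ux)).
apply: (Ck_eq_on (f := fun x => - ((f x)^-1 * (f x)^-1 * 'D_v f x) : R^o)) => //.
  move=> x Ux; rewrite (@deriveV R V f) ?f0 //; last by apply: diff_derivable; auto.
  by rewrite /GRing.scale /= mulNr expr2 invfM.
by apply: CkN => //; apply: CkM => //; [apply: CkM|exact: dCf].
Qed.

Lemma Ck_sqrt k U f : open U -> (forall x, U x -> 0 < f x) -> Ck k U f ->
  Ck k U (fun x => Num.sqrt (f x) : R^o).
Proof.
move=> oU f0; elim: k => [|k IH].
  move=> cf x Ux; apply: (@continuous_comp V R R f Num.sqrt); first exact: cf.
  exact: sqrt_continuous.
move=> Cf; have [df dCf] := Cf.
have CS : Ck k U (fun x => Num.sqrt (f x) : R^o) by apply: IH; apply: Ck_pred.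
have dS x : U x -> differentiable (Num.sqrt : R -> R) (f x).
  by move=> Ux; apply/derivable1_diffP; have [] := is_derive1_sqrt (f0 x Ux).
split=> [x Ux|v]; first exact: (@differentiable_comp R V R R _ _ _ (df x Ux) (dS x Ux)).
apply: (Ck_eq_on (f := fun x => (2 * Num.sqrt (f x))^-1 * 'D_v f x : R^o)) => //.
  move=> x Ux; pose g y : R := Num.sqrt (f y).
  have dg : derivable (g : V -> R^o) x v.
    exact/diff_derivable/(@differentiable_comp R V R R _ _ _ (df x Ux) (dS x Ux)).
  (* The derivative of g = sqrt f is found by differentiating g * g = f. *)
  have -> : 'D_v f x = g x * 'D_v g x + g x * 'D_v g x.
    rewrite -(@deriveM R V g g) //; apply: (derive_eq_on _ oU Ux) => y Uy.
    by rewrite -[RHS]/(g y * g y) -expr2 sqr_sqrtr // ltW // f0.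
  have g0 : g x != 0 by rewrite gt_eqF // sqrtr_gt0 f0.
  rewrite -/(g x) -[_ x v]/('D_v g x); move: ('D_v g x) => d.
  by field.
apply: CkM => //; last exact: dCf.
apply: CkV => //.
  by move=> x Ux; rewrite mulf_neq0 // gt_eqF // sqrtr_gt0 f0.
by apply: CkM => //; apply: Ck_cst.
Qed.

End CkScalar.

Section Coordinates.
Context {R : realType}.

(** A finite coordinate system is all that the chain rule for iterated
    directional derivatives needs: it turns the derivative of F along the moving
    direction 'D_v G x into a fixed combination of partial derivatives of F. *)
Definition has_coords (W : normedModType R) : Prop :=
  exists n (b : 'I_n -> W) (c : 'I_n -> {linear W -> R^o}),
    (forall i, continuous (c i)) /\ forall w, w = \sum_i c i w *: b i.

Lemma coord_linear n i : linear ((fun w => w 0 i) : 'rV[R]_n -> R^o).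
Proof. by move=> k u v; rewrite !mxE. Qed.

Definition coord n i : {linear 'rV[R]_n -> R^o} := HB.pack
  ((fun w => w 0 i) : 'rV[R]_n -> R^o) (GRing.isLinear.Build _ _ _ _ _ (@coord_linear n i)).

Lemma coord_sum n (w : 'rV[R]_n) : w = \sum_i coord i w *: delta_mx 0 i.
Proof. exact: row_sum_delta. Qed.

Lemma has_coords_rV n : has_coords 'rV[R]_n.
Proof.
exists n, (fun i => delta_mx 0 i), (@coord n); split=> [i|w].
  exact: coord_continuous.
exact: coord_sum.
Qed.

Lemma has_coords_scalar : has_coords (R^o).
Proof.
exists 1%N, (fun _ => 1), (fun _ => idfun); split=> [_ x|w]; first exact: cvg_id.
by rewrite big_ord1 /= /GRing.scale /= mulr1.
Qed.

Lemma fst_continuous (V W : normedModType R) : continuous (fst : V * W -> V).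
Proof. by move=> x; apply: cvg_fst. Qed.

Lemma snd_continuous (V W : normedModType R) : continuous (snd : V * W -> W).
Proof. by move=> x; apply: cvg_snd. Qed.

Lemma has_coords_prod (V W : normedModType R) :
  has_coords V -> has_coords W -> has_coords (V * W)%type.
Proof.
move=> [n [b [c [cc cE]]]] [m [b' [c' [cc' cE']]]].
pose B (i : 'I_(n + m)) : (V * W)%type :=
  match fintype.split i with inl j => (b j, 0) | inr j => (0, b' j) end.
pose C (i : 'I_(n + m)) : {linear (V * W)%type -> R^o} :=
  match fintype.split i with inl j => c j \o fst | inr j => c' j \o snd end.
exists (n + m)%N, B, C; split=> [i|w].
  rewrite /C; case: (fintype.split i) => j /= x.
    by apply: continuous_comp; [exact: fst_continuous|exact: cc].
  by apply: continuous_comp; [exact: snd_continuous|exact: cc'].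
rewrite big_split_ord /=.
have E1 (j : 'I_n) : C (lshift m j) w *: B (lshift m j) = (c j w.1 *: b j, 0).
  rewrite /C /B (unsplitK (inl j : 'I_n + 'I_m)) /=.
  by congr pair; rewrite /= scaler0.
have E2 (j : 'I_m) : C (rshift n j) w *: B (rshift n j) = (0, c' j w.2 *: b' j).
  rewrite /C /B (unsplitK (inr j : 'I_n + 'I_m)) /=.
  by congr pair; rewrite /= scaler0.
under eq_bigr do rewrite E1.
under [X in _ + X]eq_bigr do rewrite E2.
rewrite [LHS]surjective_pairing [in LHS](cE w.1) [in LHS](cE' w.2).
have S1 : \sum_(i < n) (c i w.1 *: b i, 0 : W) = (\sum_(i < n) c i w.1 *: b i, 0).
  by elim/big_rec2: _ => // i y z _ ->; congr pair; rewrite /= ?addr0.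
have S2 : \sum_(i < m) (0 : V, c' i w.2 *: b' i) = (0, \sum_(i < m) c' i w.2 *: b' i).
  by elim/big_rec2: _ => // i y z _ ->; congr pair; rewrite /= ?addr0.
by rewrite S1 S2; congr pair; rewrite /= ?addr0 ?add0r.
Qed.

Lemma scale_linear (W : normedModType R) (b : W) :
  linear ((fun k => k *: b) : R^o -> W).
Proof. by move=> k u v; rewrite scalerDl scalerA. Qed.

Lemma Ck_coords (V W : normedModType R) k (O : set V) (f : V -> W) n
    (b : 'I_n -> W) (c : 'I_n -> {linear W -> R^o}) :
  open O -> (forall w, w = \sum_i c i w *: b i) ->
  (forall i, Ck k O (c i \o f)) -> Ck k O f.
Proof.
move=> oO cE Cc.
apply: (@Ck_eq_on _ _ _ _ _ (fun x => \sum_i c i (f x) *: b i)) => //.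
apply: Ck_sum => // i.
pose L : {linear R^o -> W} := HB.pack ((fun k => k *: b i) : R^o -> W)
  (GRing.isLinear.Build _ _ _ _ _ (scale_linear (b i))).
apply: (@Ck_linear_comp _ _ _ _ _ _ (c i \o f) L) => //.
by move=> x; apply: scalel_continuous.
Qed.

Lemma Ck_row (V : normedModType R) n k (O : set V) (f : V -> 'rV[R]_n) : open O ->
  (forall i, Ck k O (fun y => f y 0 i : R^o)) -> Ck k O f.
Proof. by move=> oO Cf; apply: (Ck_coords oO (@coord_sum n)) => i; exact: Cf. Qed.

Lemma Ck_coord (V : normedModType R) n k (O : set V) (f : V -> 'rV[R]_n) i : open O ->
  Ck k O f -> Ck k O (fun y => f y 0 i : R^o).
Proof.
by move=> oO Cf; apply: (@Ck_linear_comp _ _ _ _ _ _ f (coord i)) => // ?;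
   exact: coord_continuous.
Qed.

Lemma Ck_comp_scalar (V W : normedModType R) k (N : set W) (O : set V)
    (F : W -> R^o) (G : V -> W) :
  has_coords W -> open N -> open O -> (forall x, O x -> N (G x)) ->
  Ck k N F -> Ck k O G -> Ck k O (F \o G).
Proof.
move=> [n [b [c [cc cE]]]] oN oO GN; elim: k F => [|k IH] F.
  move=> cF cG x Ox; apply: continuous_comp; first exact: cG.
  by apply: cF; exact: GN.
move=> CF CG; have [dF dCF] := CF; have [dG dCG] := CG.
split=> [x Ox|v]; first by apply: differentiable_comp; auto.
apply: (Ck_eq_on (f := fun x =>
    \sum_i c i ('D_v G x) * ('D_(b i) F \o G) x : R^o)) => //.
  move=> x Ox; have dFx := dF _ (GN _ Ox); have dGx := dG _ Ox.
  rewrite (deriveE _ dGx) (deriveE _ (differentiable_comp dGx dFx)).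
  rewrite (diff_comp dGx dFx) /= [X in _ = 'd F _ X]cE linear_sum.
  by apply: eq_bigr => i _; rewrite linearZ (deriveE _ dFx).
apply: Ck_sum => // i; apply: CkM => //.
  by apply: (@Ck_linear_comp _ _ _ _ _ _ ('D_v G) (c i)) => //; exact: dCG.
by apply: IH => //; [exact: dCF|exact: Ck_pred].
Qed.

Lemma Ck_comp (V W Z : normedModType R) k (N : set W) (O : set V)
    (F : W -> Z) (G : V -> W) :
  has_coords W -> has_coords Z -> open N -> open O ->
  (forall x, O x -> N (G x)) -> Ck k N F -> Ck k O G -> Ck k O (F \o G).
Proof.
move=> cW [n [b [c [cc cE]]]] oN oO GN CF CG.
apply: (Ck_coords oO cE) => i.
apply: (@Ck_comp_scalar _ _ _ N _ (c i \o F)) => //.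
exact: Ck_linear_comp.
Qed.

Lemma Ck0_preimage_open (V W : normedModType R) (O : set V) (N : set W) (f : V -> W) :
  open O -> open N -> (forall x, O x -> {for x, continuous f}) ->
  open (O `&` f @^-1` N).
Proof.
move=> oO oN cf; rewrite openE => x [Ox Nfx].
apply: filterI; first exact: (open_nbhs_nbhs (conj oO Ox)).
by apply: (cf x Ox); exact: (open_nbhs_nbhs (conj oN Nfx)).
Qed.

Lemma smooth_on_comp (V W Z : normedModType R) (A : set V) (B : set W)
    (f : V -> W) (g : W -> Z) :
  has_coords W -> has_coords Z -> (forall x, A x -> B (f x)) ->
  smooth_on A f -> smooth_on B g -> smooth_on A (g \o f).
Proof.
move=> cW cZ AB sf sg x Ax.
have [N [F [oN Nx CF fF]]] := sf x Ax.
have [M [G [oM Mfx CG gG]]] := sg _ (AB x Ax).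
exists (N `&` F @^-1` M), (G \o F); split=> [|||y Ay [Ny My]] /=.
- exact: (Ck0_preimage_open oN oM (CF 0%N)).
- by split=> //; rewrite /= -fF.
- move=> k; apply: (@Ck_comp _ _ _ _ M) => //.
  + exact: (Ck0_preimage_open oN oM (CF 0%N)).
  + by move=> y [].
  + by apply: Ck_subset (CF k) => y [].
- by rewrite fF // gG // -?fF //; exact: AB.
Qed.

Lemma smooth_on_subset (V W : normedModType R) (A A' : set V) (f : V -> W) :
  A' `<=` A -> smooth_on A f -> smooth_on A' f.
Proof.
move=> sA sf x /sA Ax; have [N [F [oN Nx CF fF]]] := sf x Ax.
by exists N, F; split=> // y /sA; apply: fF.
Qed.

(** On an open set the local extensions can be shrunk into the set, where they
    coincide with f. *)
Lemma smooth_on_open (V W : normedModType R) (U : set V) (f : V -> W) k :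
  open U -> smooth_on U f -> Ck k U f.
Proof.
move=> oU sf.
have loc x : U x -> exists N, [/\ open N, N x & Ck k N f].
  move=> Ux; have [N [F [oN Nx CF fF]]] := sf x Ux.
  exists (U `&` N); split=> //; first exact: openI.
  apply: (Ck_eq_on (f := F)); first exact: openI.
    by move=> y [Uy Ny]; rewrite fF.
  by apply: Ck_subset (CF k) => y [].
elim: k f loc {sf} => [|k IH] f loc.
  by move=> x Ux; have [N [oN Nx]] := loc x Ux; apply.
split=> [x Ux|v]; first by have [N [oN Nx [df _]]] := loc x Ux; apply: df.
by apply: IH => x Ux; have [N [oN Nx [_ Cf]]] := loc x Ux; exists N; split=> //; exact: Cf.
Qed.

End Coordinates.

(** * Symmetry of second derivatives *)

Section MixedPartials.
Context {R : realType} {V : normedModType R}.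
Implicit Types (f : V -> R^o) (O : set V).

Lemma is_derive_along_line f (y u : V) (s : R) : derivable f (s *: u + y) u ->
  is_derive s 1 (fun s : R => f (s *: u + y) : R^o) ('D_u f (s *: u + y)).
Proof.
have E : (fun h : R => h^-1 *: ((f \o shift (s *: u + y)) (h *: u) -
            f (s *: u + y))) =
         (fun h : R => h^-1 *: (((fun s : R => f (s *: u + y) : R^o) \o shift s)
            (h *: 1) - (f (s *: u + y) : R^o))).
  apply/funext => h /=; congr (_ *: (f _ - _)).
  by rewrite /shift /= scalerDl addrA /GRing.scale /= mulr1.
move=> df; apply: DeriveDef.
  by move: df; rewrite /derivable E.
by rewrite /derive -E.
Qed.

Lemma small_parallelogram (x u v : V) (r : R) : 0 < r ->
  exists h : R, 0 < h /\ forall s t : R, 0 <= s <= h -> 0 <= t <= h ->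
    ball x r (s *: u + (t *: v + x)).
Proof.
move=> r0; have c0 : 0 < `|u| + `|v| + 1 by rewrite ltr_wpDl // addr_ge0.
exists (r / (`|u| + `|v| + 1)); split=> [|s t /andP[s0 sh] /andP[t0 th]].
  by rewrite divr_gt0.
rewrite -ball_normE /= distrC addrA addrK.
apply: le_lt_trans (ler_normD _ _) _; rewrite !normrZ !ger0_norm //.
set h := r / _ in sh th *.
have h0 : 0 < h by rewrite divr_gt0.
have -> : r = h * `|u| + h * `|v| + h.
  rewrite /h; move: (`|u|) (`|v|) c0 => a b c0; field; exact: lt0r_neq0.
by rewrite ltr_pwDr // lerD // ler_wpM2r.
Qed.

(** The mean value theorem is used twice: along u for the difference of f at two
    points a distance h v apart, then along v for 'D_u f. *)
Lemma second_difference_mean_value O f (x u v : V) (h : R) :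
  open O -> Ck 2 O f -> 0 < h ->
  (forall s t : R, 0 <= s <= h -> 0 <= t <= h -> O (s *: u + (t *: v + x))) ->
  exists s t : R, [/\ 0 <= s <= h, 0 <= t <= h &
    (f (h *: u + (h *: v + x)) : R) - f (h *: u + x) - (f (h *: v + x) - f x) =
    ('D_v ('D_u f) (s *: u + (t *: v + x)) : R) * h ^+ 2].
Proof.
move=> oO Cf h0 hO; have [df Cdf] := Cf; have [dduf _] := Cdf u.
pose phi (s : R) : R := f (s *: u + (h *: v + x)) - f (s *: u + x).
have Ox s : 0 <= s <= h -> O (s *: u + x).
  by move=> hs; have := hO s 0 hs; rewrite scale0r add0r lexx ltW //; apply.
have hh : 0 <= h <= h by rewrite lexx ltW.
have der s : 0 <= s <= h -> is_derive s 1 (phi : R -> R^o)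
    ('D_u f (s *: u + (h *: v + x)) - 'D_u f (s *: u + x)).
  by move=> hs; apply: is_deriveB; apply: is_derive_along_line;
     apply: diff_derivable; apply: df; [exact: hO|exact: Ox].
have cts (g : R -> R) (dg : R -> R) : (forall s, 0 <= s <= h -> is_derive s 1 (g : R -> R^o) (dg s)) ->
    exists2 s, 0 <= s <= h & g h - g 0 = dg s * h.
  move=> dgs.
  have d_in s : s \in `]0, h[ -> is_derive s 1 (g : R -> R^o) (dg s).
    by rewrite in_itv /= => /andP[s0 sh]; apply: dgs; rewrite !ltW.
  have c_in : {within `[0, h], continuous g}.
    apply: derivable_within_continuous => s; rewrite in_itv /= => hs.
    by have [] := dgs s hs.
  have [s] := MVT_segment (ltW h0) d_in c_in.
  by rewrite in_itv /= subr0 => hs E; exists s.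
have [s hs Es] := cts _ _ der.
pose psi (t : R) : R := 'D_u f (t *: v + (s *: u + x)).
have derpsi t : 0 <= t <= h -> is_derive t 1 (psi : R -> R^o)
    ('D_v ('D_u f) (t *: v + (s *: u + x))).
  move=> ht; apply: is_derive_along_line; apply: diff_derivable; apply: dduf.
  by rewrite addrCA; exact: hO.
have [t ht Et] := cts _ _ derpsi.
exists s, t; split=> //.
have -> : f (h *: v + x) - f x = phi 0 by rewrite /phi !scale0r !add0r.
have -> : f (h *: u + (h *: v + x)) - f (h *: u + x) = phi h by [].
rewrite Es; have -> : 'D_u f (s *: u + (h *: v + x)) - 'D_u f (s *: u + x) = psi h - psi 0.
  by rewrite /psi scale0r add0r (addrCA (h *: v)).
rewrite Et [in RHS](addrCA (s *: u)).
by move: ('D_v _ _ : R) => d; rewrite expr2 mulrA.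
Qed.

(** F and G stand for the two mixed derivatives of f. Both are mean values of the
    same second difference, over parallelograms that shrink to x. *)
Lemma second_difference_limit_unique O f (F G : V -> R^o) (u v : V) (x : V) :
  open O -> O x -> {for x, continuous F} -> {for x, continuous G} ->
  (forall h : R, 0 < h ->
    (forall s t : R, 0 <= s <= h -> 0 <= t <= h -> O (s *: u + (t *: v + x))) ->
    exists s t : R, [/\ 0 <= s <= h, 0 <= t <= h &
      (f (h *: u + (h *: v + x)) : R) - f (h *: u + x) - (f (h *: v + x) - f x) =
      (G (s *: u + (t *: v + x)) : R) * h ^+ 2]) ->
  (forall h : R, 0 < h ->
    (forall s t : R, 0 <= s <= h -> 0 <= t <= h -> O (s *: v + (t *: u + x))) ->
    exists s t : R, [/\ 0 <= s <= h, 0 <= t <= h &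
      (f (h *: v + (h *: u + x)) : R) - f (h *: v + x) - (f (h *: u + x) - f x) =
      (F (s *: v + (t *: u + x)) : R) * h ^+ 2]) ->
  F x = G x.
Proof.
move=> oO Ox cF cG mvG mvF.
suff FG : forall e : R, 0 < e -> `|(F x : R) - G x| <= e.
  apply/eqP; rewrite -subr_eq0 -normr_le0; apply/ler_addgt0Pr => e e0.
  by rewrite add0r; exact: FG.
move=> e e0; have e20 : 0 < e / 2 by rewrite divr_gt0.
have nn : nbhs x (fun y => O y /\ `|(F x : R) - F y| < e / 2 /\
                             `|(G x : R) - G y| < e / 2).
  apply: filterI; first exact: open_nbhs_nbhs (conj oO Ox).
  apply: filterI; first by move/cvgrPdist_lt : cF => /(_ _ e20).
  by move/cvgrPdist_lt : cG => /(_ _ e20).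
have [r /= r0 rP] := (nbhs_ballP _ _).1 nn.
have [h [h0 hP]] := small_parallelogram x u v r0.
have [s [t [hs ht E1]]] := mvG h h0 (fun s t hs ht => (rP _ (hP s t hs ht)).1).
have hO' (s' t' : R) : 0 <= s' <= h -> 0 <= t' <= h -> ball x r (s' *: v + (t' *: u + x)).
  by move=> hs' ht'; rewrite addrCA; exact: hP.
have [s' [t' [hs' ht' E2]]] := mvF h h0 (fun s t hs ht => (rP _ (hO' s t hs ht)).1).
have [_ [_ BG]] := rP _ (hP s t hs ht).
have [_ [BF _]] := rP _ (hO' s' t' hs' ht').
have h2 : h ^+ 2 != 0 by rewrite expf_neq0 // gt_eqF.
move: BF BG E1 E2; rewrite (addrCA (h *: v)).
move: (F x : R) (G x : R) => a b; move: (F _ : R) (G _ : R) => c d.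
move: (f _ : R) (f _ : R) (f _ : R) (f _ : R) => p q p' q' BF BG E1 E2.
have {E1 E2} dc : d = c by apply: (mulIf h2); lra.
move: BF BG; rewrite dc !ltr_norml ler_norml => /andP[? ?] /andP[? ?].
by apply/andP; split; lra.
Qed.

Lemma derive_comm O f (u v : V) (x : V) : open O -> Ck 2 O f -> O x ->
  'D_u ('D_v f) x = 'D_v ('D_u f) x.
Proof.
move=> oO Cf Ox; have [_ Cdf] := Cf.
have [_ Cuv] := Cdf v; have [_ Cvu] := Cdf u.
apply: (second_difference_limit_unique oO Ox (Cuv u x Ox) (Cvu v x Ox)) => h h0.
  exact: second_difference_mean_value.
exact: second_difference_mean_value.
Qed.

End MixedPartials.

(** * The ring of smooth functions on an open set *)

Section SmoothFunctionRing.
Context {R : realType} {V : normedModType R}.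

Record domain := Domain {
  dom_set :> V -> Prop; dom_open : open (dom_set : set V) }.

Variable O : domain.

(** Smooth functions on O are represented by their extension by 0, so that
    two of them that agree on O are equal and smooth functions on O form a
    commutative ring. Geometry on O is then algebra over this ring. *)
Record smooth_fun := SmoothFun {
  smf_val :> V -> R;
  smf_smooth : forall k, Ck k (dom_set O) (smf_val : V -> R^o);
  smf_off : forall x, ~ O x -> smf_val x = 0 }.

Lemma smf_eq (f g : smooth_fun) : (forall x, O x -> f x = g x) -> f = g.
Proof.
case: f g => f sf zf [g sg zg] /= fg.
have E : f = g.
  apply/funext => x; have [Ox|nOx] := pselect (O x); first exact: fg.
  by rewrite zf ?zg.
by move: sg zg; rewrite -E => sg zg; congr SmoothFun; exact: Prop_irrelevance.
Qed.

Definition cut (f : V -> R) (x : V) : R := if pselect (O x) then f x else 0.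

Lemma cut_on f x : O x -> cut f x = f x.
Proof. by rewrite /cut; case: pselect. Qed.

Lemma cut_off f x : ~ O x -> cut f x = 0.
Proof. by rewrite /cut; case: pselect. Qed.

Lemma cut_smooth (f : V -> R) : (forall k, Ck k (dom_set O) (f : V -> R^o)) ->
  forall k, Ck k (dom_set O) (cut f : V -> R^o).
Proof.
move=> sf k; apply: (Ck_eq_on (f := f : V -> R^o)); first exact: dom_open.
  by move=> x Ox; rewrite cut_on.
exact: sf.
Qed.

Definition smf_of (f : V -> R) (sf : forall k, Ck k (dom_set O) (f : V -> R^o)) :=
  SmoothFun (cut_smooth sf) (cut_off f).

Let oO := dom_open O.

Definition smf_cst (c : R) := smf_of (fun k => Ck_cst k (dom_set O) (c : R^o)).
Definition smf_add (f g : smooth_fun) :=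
  smf_of (fun k => CkD oO (smf_smooth f k) (smf_smooth g k)).
Definition smf_opp (f : smooth_fun) := smf_of (fun k => CkN oO (smf_smooth f k)).
Definition smf_mul (f g : smooth_fun) :=
  smf_of (fun k => CkM oO (smf_smooth f k) (smf_smooth g k)).

Lemma smf_addA : associative smf_add.
Proof. by move=> f g h; apply: smf_eq => x Ox; rewrite /= !cut_on // addrA. Qed.
Lemma smf_addC : commutative smf_add.
Proof. by move=> f g; apply: smf_eq => x Ox; rewrite /= !cut_on // addrC. Qed.
Lemma smf_add0 : left_id (smf_cst 0) smf_add.
Proof. by move=> f; apply: smf_eq => x Ox; rewrite /= !cut_on // add0r. Qed.
Lemma smf_addN : left_inverse (smf_cst 0) smf_opp smf_add.
Proof. by move=> f; apply: smf_eq => x Ox; rewrite /= !cut_on // addNr. Qed.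
Lemma smf_mulA : associative smf_mul.
Proof. by move=> f g h; apply: smf_eq => x Ox; rewrite /= !cut_on // mulrA. Qed.
Lemma smf_mulC : commutative smf_mul.
Proof. by move=> f g; apply: smf_eq => x Ox; rewrite /= !cut_on // mulrC. Qed.
Lemma smf_mul1 : left_id (smf_cst 1) smf_mul.
Proof. by move=> f; apply: smf_eq => x Ox; rewrite /= !cut_on // mul1r. Qed.
Lemma smf_mulDl : left_distributive smf_mul smf_add.
Proof. by move=> f g h; apply: smf_eq => x Ox; rewrite /= !cut_on // mulrDl. Qed.

HB.instance Definition _ := gen_eqMixin smooth_fun.
HB.instance Definition _ := gen_choiceMixin smooth_fun.
HB.instance Definition _ := GRing.isZmodule.Build smooth_fun
  smf_addA smf_addC smf_add0 smf_addN.
HB.instance Definition _ := GRing.Zmodule_isComPzRing.Build smooth_fun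
  smf_mulA smf_mulC smf_mul1 smf_mulDl.

Implicit Types (f g : smooth_fun).

Lemma smfD f g x : O x -> (f + g) x = f x + g x.
Proof. by move=> Ox; rewrite [LHS]cut_on. Qed.
Lemma smfN f x : O x -> (- f) x = - f x.
Proof. by move=> Ox; rewrite [LHS]cut_on. Qed.
Lemma smfM f g x : O x -> (f * g) x = f x * g x.
Proof. by move=> Ox; rewrite [LHS]cut_on. Qed.
Lemma smf1 x : O x -> (1 : smooth_fun) x = 1.
Proof. by move=> Ox; rewrite [LHS]cut_on. Qed.
Lemma smf0 x : (0 : smooth_fun) x = 0.
Proof.
have [Ox|nOx] := pselect (O x); first by rewrite [LHS]cut_on.
by rewrite smf_off.
Qed.
Lemma smf_cstE c x : O x -> smf_cst c x = c.
Proof. by move=> Ox; rewrite [LHS]cut_on. Qed.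
Lemma smf_ofE h sh x : O x -> @smf_of h sh x = h x.
Proof. by move=> Ox; rewrite [LHS]cut_on. Qed.
Lemma smfX f n x : O x -> (f ^+ n) x = f x ^+ n.
Proof.
by move=> Ox; elim: n => [|n IH]; rewrite ?expr0 ?smf1 // !exprS smfM // IH.
Qed.
(** Stands for the division by 2 in computations over a general commutative ring. *)
Lemma smf_half_regular f : f + f = 0 -> f = 0.
Proof.
move=> ff; apply: smf_eq => x Ox; rewrite smf0.
have : (f + f) x = 0 by rewrite ff smf0.
by rewrite smfD // => ?; lra.
Qed.

(** A derivative is specified by its values on O, and is only used through them:
    what matters afterwards is that it is a derivation and that two derivatives
    commute. *)
Fact partial_spec (v : V) : {P : smooth_fun -> smooth_fun |
  forall f x, O x -> P f x = 'D_v (f : V -> R^o) x}.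
Proof.
exists (fun f => @smf_of ('D_v (f : V -> R^o)) (fun k => (smf_smooth f k.+1).2 v)).
by move=> f x Ox; rewrite [LHS]cut_on.
Qed.

Definition partial (v : V) : smooth_fun -> smooth_fun := sval (partial_spec v).

Lemma partialE v f x : O x -> partial v f x = 'D_v (f : V -> R^o) x.
Proof. exact: svalP (partial_spec v) f x. Qed.

Lemma smf_derivable f v x : O x -> derivable (f : V -> R^o) x v.
Proof. by move=> Ox; apply/diff_derivable/(smf_smooth f 1).1. Qed.

Lemma partialD v f g : partial v (f + g) = partial v f + partial v g.
Proof.
apply: smf_eq => x Ox; rewrite smfD // !partialE //.
rewrite -deriveD; [|exact: smf_derivable..].
by apply: (derive_eq_on _ oO Ox) => y Oy; rewrite smfD.
Qed.

Lemma partialM v f g : partial v (f * g) = partial v f * g + f * partial v g.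
Proof.
apply: smf_eq => x Ox; rewrite smfD // !smfM // !partialE //.
have -> : 'D_v (smf_val (f * g) : V -> R^o) x =
          'D_v ((smf_val f : V -> R^o) * (smf_val g : V -> R^o)) x.
  by apply: (derive_eq_on _ oO Ox) => y Oy; rewrite smfM.
rewrite (deriveM (@smf_derivable f v x Ox) (@smf_derivable g v x Ox)).
by rewrite addrC; congr (_ + _); rewrite /GRing.scale /= mulrC.
Qed.

Lemma partial_comm u v f : partial u (partial v f) = partial v (partial u f).
Proof.
have E w z x (Ox : O x) : partial w (partial z f) x = 'D_w ('D_z (f : V -> R^o)) x.
  exact: etrans (partialE w (partial z f) Ox)
    (derive_eq_on w oO Ox (fun y Oy => partialE z f Oy)).
apply: smf_eq => x Ox.
exact: etrans (E u v x Ox)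
  (etrans (derive_comm u v oO (smf_smooth f 2) Ox) (esym (E v u x Ox))).
Qed.

Lemma smf_inverse f : (forall x, O x -> f x != 0) ->
  exists g, f * g = 1 /\ forall x, O x -> g x = (f x)^-1.
Proof.
move=> f0; exists (smf_of (fun k => CkV oO f0 (smf_smooth f k))).
split=> [|x Ox]; last by rewrite smf_ofE.
by apply: smf_eq => x Ox; rewrite smfM // smf_ofE // smf1 // mulfV // f0.
Qed.

Lemma smf_square_root f : (forall x, O x -> 0 < f x) ->
  exists g, g * g = f /\ forall x, O x -> g x = Num.sqrt (f x).
Proof.
move=> f0; exists (smf_of (fun k => Ck_sqrt oO f0 (smf_smooth f k))).
split=> [|x Ox]; last by rewrite smf_ofE.
apply: smf_eq => x Ox; rewrite smfM // smf_ofE // -expr2 sqr_sqrtr //.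
by rewrite ltW // f0.
Qed.

End SmoothFunctionRing.
Arguments partial {R V O} v f.
Arguments smf_of {R V O} f sf.
Arguments smf_cst {R V} O c.

(** * Moving frames on an evolving surface *)

Section VectorFields.
Variable A : comPzRingType.
Implicit Types (u v w : 'rV[A]_3) (D : A -> A).

Definition derivation D : Prop :=
  (forall x y, D (x + y) = D x + D y) /\ (forall x y, D (x * y) = D x * y + x * D y).

Definition dotr u v : A := \sum_i u 0 i * v 0 i.

Lemma dotr_mx u v : (u *m v^T) 0 0 = dotr u v.
Proof. by rewrite mxE; apply: eq_bigr => i _; rewrite mxE. Qed.

Lemma dotrC u v : dotr u v = dotr v u.
Proof. by apply: eq_bigr => i _; rewrite mulrC. Qed.

Lemma dotrDl u v w : dotr (u + v) w = dotr u w + dotr v w.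
Proof. by rewrite -big_split; apply: eq_bigr => i _; rewrite mxE mulrDl. Qed.

Lemma dotrZl a u v : dotr (a *: u) v = a * dotr u v.
Proof. by rewrite mulr_sumr; apply: eq_bigr => i _; rewrite mxE mulrA. Qed.

Lemma dotrNl u v : dotr (- u) v = - dotr u v.
Proof. by rewrite -scaleN1r dotrZl mulN1r. Qed.

Lemma derivation0 D : derivation D -> D 0 = 0.
Proof. by case=> DD _; apply: (addrI (D 0)); rewrite -DD !addr0. Qed.

Lemma derivation1 D : derivation D -> D 1 = 0.
Proof.
by move=> [_ DM]; apply: (addrI (D 1)); rewrite addr0 -{3}[1]mulr1 DM mul1r mulr1.
Qed.

Lemma derivationN D x : derivation D -> D (- x) = - D x.
Proof.
move=> dD; apply: (addrI (D x)); rewrite -dD.1 !subrr; exact: derivation0.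
Qed.

Lemma derivation_sum D n (F : 'I_n -> A) : derivation D ->
  D (\sum_i F i) = \sum_i D (F i).
Proof.
by move=> dD; apply: big_morph => [x y|]; [exact: dD.1|exact: derivation0].
Qed.

Lemma derivation_dotr D u v : derivation D ->
  D (dotr u v) = dotr (map_mx D u) v + dotr u (map_mx D v).
Proof.
move=> dD; rewrite derivation_sum // -big_split; apply: eq_bigr => i _.
by rewrite dD.2 !mxE.
Qed.

Lemma map_derivationZ D a u : derivation D ->
  map_mx D (a *: u) = D a *: u + a *: map_mx D u.
Proof. by move=> dD; apply/rowP => i; rewrite !mxE dD.2. Qed.

Lemma map_derivationN D u : derivation D -> map_mx D (- u) = - map_mx D u.
Proof. by move=> dD; apply/rowP => i; rewrite !mxE derivationN. Qed.

(** Three orthonormal vectors form an orthogonal matrix M, and M M^T = 1 implies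
    M^T M = 1 over any commutative ring. *)
Lemma parseval (e1 e2 e3 u v : 'rV[A]_3) :
  dotr e1 e1 = 1 -> dotr e2 e2 = 1 -> dotr e3 e3 = 1 ->
  dotr e1 e2 = 0 -> dotr e1 e3 = 0 -> dotr e2 e3 = 0 ->
  dotr u v = dotr u e1 * dotr v e1 + dotr u e2 * dotr v e2 + dotr u e3 * dotr v e3.
Proof.
move=> e11 e22 e33 e12 e13 e23.
pose e (i : 'I_3) := nth 0 [:: e1; e2; e3] i.
pose M : 'M[A]_3 := \matrix_(i, j) e i 0 j.
have eE i j : dotr (e i) (e j) = (i == j)%:R.
  by case: i => [[|[|[|i]]] ?] //; case: j => [[|[|[|j]]] ?] //;
     rewrite /e /= ?e11 ?e22 ?e33 ?e12 ?e13 ?e23 // dotrC ?e12 ?e13 ?e23.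
have MMT : M *m M^T = 1%:M.
  apply/matrixP => i j; rewrite !mxE -eE.
  by apply: eq_bigr => k _; rewrite !mxE.
have cE w i : (w *m M^T) 0 i = dotr w (e i).
  by rewrite mxE; apply: eq_bigr => k _; rewrite !mxE.
have -> : dotr u v = ((u *m M^T) *m (v *m M^T)^T) 0 0.
  rewrite trmx_mul trmxK mulmxA -(mulmxA u) (mulmx1C MMT) mulmx1.
  by rewrite dotr_mx.
rewrite mxE (eq_bigr (fun i => dotr u (e i) * dotr v (e i))) => [|i _].
  by rewrite !big_ord_recr big_ord0 /= add0r.
by rewrite [X in _ * X]mxE !cE.
Qed.

End VectorFields.

(** X and nu are the position and the unit normal of an evolving surface, with
    coordinates in a ring A of functions of space and time. E1 and E2 are the
    derivations along an orthonormal frame of principal directions, T is the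
    derivation in time at fixed parameters, and F is the normal speed. With the
    outer normal, a and b are the principal curvatures; p and q are the
    coefficients of the Levi-Civita connection in the frame. The hypotheses on
    the brackets say that E1 and E2 are spatial derivations and that T commutes
    with the coordinate ones. *)
Section MovingFrame.
Variables (A : comPzRingType) (E1 E2 T : A -> A).
Implicit Types (D : A -> A) (u v : 'rV[A]_3) (f c : A).
Hypotheses (dE1 : derivation E1) (dE2 : derivation E2) (dT : derivation T).
Hypothesis two_regular : forall x : A, x + x = 0 -> x = 0.
Variables (X nu : 'rV[A]_3) (F : A).
Let e1 := map_mx E1 X.
Let e2 := map_mx E2 X.
Hypotheses (e11 : dotr e1 e1 = 1) (e22 : dotr e2 e2 = 1) (nn : dotr nu nu = 1).
Hypotheses (e12 : dotr e1 e2 = 0) (e1n : dotr e1 nu = 0) (e2n : dotr e2 nu = 0).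
Hypothesis principal : dotr (map_mx E1 nu) e2 = 0.
Hypothesis bracket12 :
  exists al be, forall f, E1 (E2 f) - E2 (E1 f) = al * E1 f + be * E2 f.
Hypothesis bracketT1 :
  exists al be, forall f, T (E1 f) - E1 (T f) = al * E1 f + be * E2 f.
Hypothesis bracketT2 :
  exists al be, forall f, T (E2 f) - E2 (T f) = al * E1 f + be * E2 f.
Hypothesis flow : map_mx T X = - (F *: nu).

Let a := dotr (map_mx E1 nu) e1.
Let b := dotr (map_mx E2 nu) e2.
Let p := dotr (map_mx E1 e1) e2.
Let q := dotr (map_mx E2 e1) e2.

Let frame u v := parseval u v e11 e22 nn e12 e1n e2n.

Let skew D u v c : derivation D -> dotr u v = c -> D c = 0 ->
  dotr (map_mx D v) u = - dotr (map_mx D u) v.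
Proof.
move=> dD uv Dc; have := derivation_dotr u v dD; rewrite uv Dc => /esym/eqP.
by rewrite [dotr u _]dotrC addrC addr_eq0 => /eqP.
Qed.

Let unit_orth D u : derivation D -> dotr u u = 1 -> dotr (map_mx D u) u = 0.
Proof.
move=> dD uu; apply: two_regular.
by rewrite {1}(skew dD uu (derivation1 dD)) addNr.
Qed.

Let skew0 D u v : derivation D -> dotr u v = 0 ->
  dotr (map_mx D v) u = - dotr (map_mx D u) v.
Proof. by move=> dD uv; exact: skew dD uv (derivation0 dD). Qed.

Let bracket_vec D1 D2 al be u :
  (forall f, D1 (D2 f) - D2 (D1 f) = al * E1 f + be * E2 f) ->
  map_mx D1 (map_mx D2 u) =
  map_mx D2 (map_mx D1 u) + (al *: map_mx E1 u + be *: map_mx E2 u).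
Proof.
by move=> br; apply/rowP => i; rewrite !mxE -br addrC subrK.
Qed.

(** The connection is torsion free: the bracket is found by applying it to X and
    taking the components along e1 and e2. *)
Lemma frame_bracket f : E1 (E2 f) - E2 (E1 f) = - p * E1 f - q * E2 f.
Proof.
have [al [be br]] := bracket12; have V := bracket_vec X br.
rewrite -/e1 -/e2 in V.
have E : forall w, dotr (map_mx E1 e2) w =
    dotr (map_mx E2 e1) w + (al * dotr e1 w + be * dotr e2 w).
  by move=> w; rewrite V !dotrDl !dotrZl.
have := E e1; rewrite (unit_orth dE2 e11) e11 (dotrC e2) e12 (skew0 dE1 e12) -/p.
have := E e2; rewrite (unit_orth dE1 e22) e22 e12 -/q.
rewrite br => Eb Ea; have -> : al = - p by rewrite Ea; ring.
suff -> : be = - q by ring.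
by apply/eqP; rewrite -addr_eq0 addrC; apply/eqP; rewrite Eb; ring.
Qed.

Let V12 : map_mx E1 e2 = map_mx E2 e1 + (- p *: e1 + - q *: e2).
Proof. by apply: bracket_vec => f; rewrite frame_bracket; ring. Qed.

(* dnu is self-adjoint, hence principal holds for the exchanged indices too *)
Lemma frame_principal_sym : dotr (map_mx E2 nu) e1 = 0.
Proof.
have : dotr (map_mx E1 e2) nu = 0.
  by rewrite (skew0 dE1 (etrans (dotrC nu e2) e2n)) principal oppr0.
rewrite V12 !dotrDl !dotrZl e1n e2n !mulr0 !addr0 => E.
by rewrite (skew0 dE2 e1n) E oppr0.
Qed.

Let E1e1n : dotr (map_mx E1 e1) nu = - a.
Proof. by rewrite (skew0 dE1 (etrans (dotrC nu e1) e1n)). Qed.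
Let E2e1n : dotr (map_mx E2 e1) nu = 0.
Proof. by rewrite (skew0 dE2 (etrans (dotrC nu e1) e1n)) frame_principal_sym oppr0. Qed.
Let E2e2n : dotr (map_mx E2 e2) nu = - b.
Proof. by rewrite (skew0 dE2 (etrans (dotrC nu e2) e2n)). Qed.

(** The component along e1 of the bracket of E1 and E2 applied to nu. *)
Lemma frame_codazzi : E2 a = p * (a - b).
Proof.
rewrite /a (derivation_dotr _ _ dE2) (frame (map_mx E1 nu)) -/a principal.
rewrite (unit_orth dE1 nn) (unit_orth dE2 e11).
have -> : map_mx E2 (map_mx E1 nu) =
    map_mx E1 (map_mx E2 nu) + (p *: map_mx E1 nu + q *: map_mx E2 nu).
  by apply: bracket_vec => f; rewrite -opprB frame_bracket; ring.
rewrite !dotrDl !dotrZl frame_principal_sym -/a.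
have : E1 (dotr (map_mx E2 nu) e1) = 0 by rewrite frame_principal_sym derivation0.
rewrite (derivation_dotr _ _ dE1) (frame (map_mx E2 nu)) frame_principal_sym -/b -/p.
rewrite (unit_orth dE2 nn) => /eqP; rewrite addrC addr_eq0 => /eqP E.
have -> : dotr (map_mx E1 (map_mx E2 nu)) e1 = - (b * p).
  by rewrite -[LHS]opprK -E; ring.
ring.
Qed.

(** The component along e2 of the bracket of E1 and E2 applied to e1; the normal
    components of the derivatives of the frame produce the product a b. *)
Lemma frame_gauss : E1 q - E2 p = - (a * b) - p ^+ 2 - q ^+ 2.
Proof.
rewrite /q /p (derivation_dotr _ _ dE1) (derivation_dotr _ _ dE2).
rewrite (frame (map_mx E2 e1)) (frame (map_mx E1 e1)).
rewrite -/e2 -/e1 -/p -/q E2e1n E1e1n E2e2n.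
rewrite (unit_orth dE1 e22) (unit_orth dE2 e22) (unit_orth dE2 e11) (unit_orth dE1 e11).
have -> : map_mx E1 (map_mx E2 e1) =
    map_mx E2 (map_mx E1 e1) + (- p *: map_mx E1 e1 + - q *: map_mx E2 e1).
  by apply: bracket_vec => f; rewrite frame_bracket; ring.
by rewrite !dotrDl !dotrZl -/p -/q; ring.
Qed.

Lemma frame_connection_sym : dotr (map_mx E2 e2) e1 = - q.
Proof. exact: skew0 dE2 e12. Qed.

(** The brackets of T with E1 and E2 applied to X show that the tangential vector
    T nu is the gradient of F; a is then differentiated by exchanging T and E1 on
    nu. *)
Lemma frame_evolution : T a = E1 (E1 F) - p * E2 F + F * a ^+ 2.
Proof.
have [al [be br]] := bracketT1; have V := bracket_vec X br.
rewrite -/e1 -/e2 flow (map_derivationN _ dE1) (map_derivationZ _ _ dE1) in V.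
have unE D : derivation D -> dotr (map_mx D nu) nu = 0 by move=> dD; exact: unit_orth.
have alE : al = F * a.
  have := unit_orth dT e11; rewrite V !dotrDl dotrNl !dotrDl !dotrZl.
  rewrite -/a e11 (dotrC nu) e1n (dotrC e2) e12 => E.
  by apply/eqP; rewrite -subr_eq0 -[X in _ == X]E; apply/eqP; ring.
have Tn1 : dotr (map_mx T nu) e1 = E1 F.
  rewrite (skew0 dT e1n) V !dotrDl dotrNl !dotrDl !dotrZl unE // nn e1n e2n; ring.
have Tn2 : dotr (map_mx T nu) e2 = E2 F.
  have [ga [de br2]] := bracketT2; have V2 := bracket_vec X br2.
  rewrite -/e1 -/e2 flow (map_derivationN _ dE2) (map_derivationZ _ _ dE2) in V2.
  rewrite (skew0 dT e2n) V2 !dotrDl dotrNl !dotrDl !dotrZl unE // nn e1n e2n; ring.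
have E11 : E1 (E1 F) = dotr (map_mx E1 (map_mx T nu)) e1 + E2 F * p.
  rewrite -{1}Tn1 (derivation_dotr _ _ dE1) (frame (map_mx T nu)) Tn2 -/p.
  by rewrite (unit_orth dE1 e11) (unE T) //; ring.
rewrite {1}/a (derivation_dotr _ _ dT) (frame (map_mx E1 nu)) principal -/a.
rewrite (unit_orth dT e11) (unE E1) //.
rewrite (bracket_vec nu br) !dotrDl !dotrZl frame_principal_sym -/a alE E11; ring.
Qed.

End MovingFrame.

(** * The polynomial inequalities *)

Section Functions.
Variable A : comPzRingType.
Implicit Types (n : nat) (a b : A).

(* The subscripts 1, 11, 12 denote partial derivatives in a, in a twice, and in
   a and b; derivatives in b are obtained by exchanging the arguments. *)
Definition speed n a b : A := a ^+ (n + 2) + b ^+ (n + 2).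
Definition speed1 n a : A := (n + 2)%:R * a ^+ (n + 1).
Definition speed11 n a : A := (n + 2)%:R * (n + 1)%:R * a ^+ n.

Definition wnum n a b : A := (a ^+ n + b ^+ n) * (a + b) * (a - b) ^+ 2.
Definition wnum1 n a b : A := n%:R * a ^+ n.-1 * ((a + b) * (a - b) ^+ 2) +
  (a ^+ n + b ^+ n) * ((a - b) ^+ 2 + 2%:R * (a + b) * (a - b)).
Definition wnum11 n a b : A :=
  n%:R * n.-1%:R * a ^+ n.-2 * ((a + b) * (a - b) ^+ 2) +
  2%:R * n%:R * a ^+ n.-1 * ((a - b) ^+ 2 + 2%:R * (a + b) * (a - b)) +
  (a ^+ n + b ^+ n) * (4%:R * (a - b) + 2%:R * (a + b)).
Definition wnum12 n a b : A :=
  n%:R * a ^+ n.-1 * ((a - b) ^+ 2 - 2%:R * (a + b) * (a - b)) +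
  n%:R * b ^+ n.-1 * ((a - b) ^+ 2 + 2%:R * (a + b) * (a - b)) -
  (a ^+ n + b ^+ n) * (2%:R * (a + b)).

(** With w = wnum / (a b), the polynomial slope is (a b)^2 dw/da, and slope11,
    slope12 are (a b)^2 times the second derivatives of w wherever dw = 0. *)
Definition slope n a b : A := a * b * wnum1 n a b - wnum n a b * b.
Definition slope11 n a b : A := a * b * wnum11 n a b.
Definition slope12 n a b : A := a * b * wnum12 n a b - wnum n a b.

End Functions.

Section PolynomialInequalities.
Variable R : realFieldType.
Implicit Types (n : nat) (a b : R).

(** At a critical point of w, (E1 a, E1 b) = s (N2, - N1) for some s, with N1 and N2
    the slopes, and the Codazzi equation gives q in terms of s. All the terms of the
    evolution of w that are quadratic in E1 a, E1 b and q then add up to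
    (s / (a - b))^2 gradient_form n a b (a - b). *)
Definition gradient_form n a b : R :=
  let N1 := slope n a b in let N2 := slope n b a in
  (a - b) * (N1 * (speed11 n a * N2 ^+ 2 + speed11 n b * N1 ^+ 2) -
     speed1 n a * (slope11 n a b * N2 ^+ 2 - 2 * slope12 n a b * N1 * N2 +
                   slope11 n b a * N1 ^+ 2))
  - N1 * N2 * (speed1 n a * N2 - speed1 n b * N1)
  - (N1 * speed1 n b - N2 * speed1 n a) * (N1 * N2 + 2 * N1 ^+ 2).

(** The part without derivatives: the reaction terms of the evolution of a and b,
    and the curvature term from exchanging second derivatives. *)
Definition zero_order n a b : R :=
  let N1 := slope n a b in let N2 := slope n b a in
  speed n a b * (N1 * a ^+ 2 + N2 * b ^+ 2) -
  (N1 * speed1 n b - N2 * speed1 n a) * (a * b) * (a - b).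

(* The forms are homogeneous polynomials. Written in the smaller curvature and in
   the difference d of the two, gradient_form times a - b is divisible by d^4 and
   zero_order by d^2, and all coefficients are nonpositive: the inequalities are
   linear in the monomials, whose signs are supplied here. *)
Ltac monomials M i j :=
  let H := fresh in pose proof (M i j) as H;
  lazymatch i with
  | 0%N => idtac
  | S ?i' => monomials M i' (S j)
  end.

Ltac expand_forms := rewrite /gradient_form /zero_order /slope /slope11 /slope12
  /wnum /wnum1 /wnum11 /wnum12 /speed /speed1 /speed11 /=.

Lemma gradient_form_le0 n a b : n \in [:: 2; 3; 4]%N -> 0 <= a -> 0 <= b ->
  gradient_form n a b * (a - b) <= 0.
Proof.
move=> hn a0 b0; have [ba|/ltW ab] := leP b a.
- have d0 : 0 <= a - b by rewrite subr_ge0.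
  rewrite -{1}(subrK b a) [a - b + b]addrC; move: (a - b) d0 => d d0.
  have M i j : 0 <= b ^+ i * d ^+ j by rewrite mulr_ge0 // exprn_ge0.
  move: hn; rewrite !inE => /or3P[] /eqP ->; expand_forms.
  + by monomials M 18%N 4%N; lra.
  + by monomials M 22%N 4%N; lra.
  + by monomials M 26%N 4%N; lra.
- have d0 : 0 <= b - a by rewrite subr_ge0.
  rewrite -(opprB b a) -{1}(subrK a b) [b - a + a]addrC; move: (b - a) d0 => d d0.
  have M i j : 0 <= a ^+ i * d ^+ j by rewrite mulr_ge0 // exprn_ge0.
  move: hn; rewrite !inE => /or3P[] /eqP ->; expand_forms.
  + by monomials M 18%N 4%N; lra.
  + by monomials M 22%N 4%N; lra.
  + by monomials M 26%N 4%N; lra.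
Qed.

Lemma zero_orderC n a b : zero_order n a b = zero_order n b a.
Proof. rewrite /zero_order /speed /=; ring. Qed.

Lemma zero_order_lt0 n a b : n \in [:: 2; 3; 4]%N -> 0 < a -> 0 < b -> a != b ->
  zero_order n a b < 0.
Proof.
move=> hn; wlog ba : a b / b < a => [W a0 b0 ab|a0 b0 _].
  have := ab; rewrite neq_lt => /orP[ba|]; last by move=> ?; apply: W.
  by rewrite zero_orderC; apply: W => //; rewrite eq_sym.
have d0 : 0 < a - b by rewrite subr_gt0.
rewrite -{1}(subrK b a) [a - b + b]addrC; move: (a - b) d0 => d d0.
have M i j : 0 < b ^+ i * d ^+ j by rewrite mulr_gt0 // exprn_gt0.
move: hn; rewrite !inE => /or3P[] /eqP ->; expand_forms.
- by monomials M 10%N 2%N; lra.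
- by monomials M 12%N 2%N; lra.
- by monomials M 14%N 2%N; lra.
Qed.

(** Euler's relation for w, which is homogeneous of degree n + 1. *)
Lemma slope_euler n a b : n \in [:: 2; 3; 4]%N ->
  a * slope n a b + b * slope n b a = (n + 1)%:R * (a * b * wnum n a b).
Proof.
rewrite !inE => /or3P[] /eqP ->; rewrite /slope /wnum1 /wnum /=; ring.
Qed.

End PolynomialInequalities.

Section PointwiseInequality.
Variable R : realFieldType.
Implicit Types (n : nat) (a b : R).

(** By Euler's relation dw only vanishes where w does, that is at umbilics. *)
Lemma slope_neq0 n a b : n \in [:: 2; 3; 4]%N -> 0 < a -> 0 < b -> a != b ->
  (slope n a b != 0) || (slope n b a != 0).
Proof.
move=> hn a0 b0 ab; rewrite -negb_and; apply/negP => /andP[/eqP s1 /eqP s2].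
have := slope_euler a b hn; rewrite s1 s2 !mulr0 addr0 => /esym/eqP; apply/negP.
have n0 : (0 : R) < a ^+ n + b ^+ n by rewrite addr_gt0 // exprn_gt0.
have s0 : 0 < a + b by rewrite addr_gt0.
have d0 : 0 < (a - b) ^+ 2 by rewrite exprn_even_gt0 //= subr_eq0.
have m0 : (0 : R) < (n + 1)%:R by rewrite ltr0n addn1.
by rewrite gt_eqF // (mulr_gt0 m0 (mulr_gt0 (mulr_gt0 a0 b0) (mulr_gt0 (mulr_gt0 n0 s0) d0))).
Qed.

Lemma orthogonal_line (u v x y : R) : (u != 0) || (v != 0) -> u * x + v * y = 0 ->
  exists s, x = s * v /\ y = - (s * u).
Proof.
move=> uv E; have [v0|v0] := eqVneq v 0.
  have u0 : u != 0 by move: uv; rewrite v0 eqxx orbF.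
  exists (- (y / u)); split; last by rewrite mulNr opprK divfK.
  rewrite v0 mulr0; apply: (mulfI u0); rewrite mulr0 -E v0 mul0r; ring.
exists (x / v); split; first by rewrite divfK.
apply: (mulfI v0); transitivity (- (u * x)); last by field.
by apply/eqP; rewrite -addr_eq0 addrC E.
Qed.

(** The numbers are values at a maximum: x1, x2 (y1, y2) are the derivatives of a
    and b along E1 (along E2), a11, b11 (a22, b22) their second ones, and ta, tb
    their time derivatives. The operator f1 E1 E1 + f2 E2 E2, applied to w, accounts
    for all second derivatives in N1 ta + N2 tb except for a multiple of b11 - a22,
    which Simons' identity evaluates. Gradient and zero order terms remain. *)
Lemma evolution_lt0 n (a b p q x1 x2 y1 y2 a11 b11 a22 b22 ta tb : R) :
  n \in [:: 2; 3; 4]%N -> 0 < a -> 0 < b -> a != b ->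
  let N1 := slope n a b in let N2 := slope n b a in
  let hess x y := slope11 n a b * x ^+ 2 + 2 * slope12 n a b * x * y +
                  slope11 n b a * y ^+ 2 in
  let f1 := speed1 n a in let f2 := speed1 n b in
  let f11 := speed11 n a in let f22 := speed11 n b in
  N1 * x1 + N2 * x2 = 0 -> N1 * y1 + N2 * y2 = 0 ->
  N1 * a11 + N2 * b11 + hess x1 x2 <= 0 ->
  N1 * a22 + N2 * b22 + hess y1 y2 <= 0 ->
  y1 = p * (a - b) -> x2 = q * (a - b) ->
  b11 - a22 = (- (a * b) - p ^+ 2 - q ^+ 2) * (a - b) + q * (x1 - x2) - p * (y1 - y2) ->
  ta = f1 * a11 + f2 * b11 + (f11 * x1 ^+ 2 + f22 * x2 ^+ 2) -
       p * (f1 * y1 + f2 * y2) + speed n a b * a ^+ 2 ->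
  tb = f1 * a22 + f2 * b22 + (f11 * y1 ^+ 2 + f22 * y2 ^+ 2) +
       q * (f1 * x1 + f2 * x2) + speed n a b * b ^+ 2 ->
  N1 * ta + N2 * tb < 0.
Proof.
move=> hn a0 b0 ab N1 N2 hess f1 f2 f11 f22 hx hy hxx hyy yp xq simons -> ->.
have N0 := slope_neq0 hn a0 b0 ab; rewrite -/N1 -/N2 in N0.
have [s [x1E x2E]] := orthogonal_line N0 hx.
have [r [y1E y2E]] := orthogonal_line N0 hy.
have ab0 : a - b != 0 by rewrite subr_eq0.
have f10 : 0 <= f1 by rewrite mulr_ge0 // exprn_ge0 // ltW.
have f20 : 0 <= f2 by rewrite mulr_ge0 // exprn_ge0 // ltW.
have pE : p = r * N2 / (a - b) by rewrite -y1E yp mulfK.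
have qE : q = - (s * N1) / (a - b) by rewrite -x2E xq mulfK.
have G1 := gradient_form_le0 hn (ltW a0) (ltW b0).
have G2 := gradient_form_le0 hn (ltW b0) (ltW a0).
have Z := zero_order_lt0 hn a0 b0 ab.
have -> : N1 * (f1 * a11 + f2 * b11 + (f11 * x1 ^+ 2 + f22 * x2 ^+ 2) -
       p * (f1 * y1 + f2 * y2) + speed n a b * a ^+ 2) +
   N2 * (f1 * a22 + f2 * b22 + (f11 * y1 ^+ 2 + f22 * y2 ^+ 2) +
       q * (f1 * x1 + f2 * x2) + speed n a b * b ^+ 2) =
   f1 * (N1 * a11 + N2 * b11 + hess x1 x2) + f2 * (N1 * a22 + N2 * b22 + hess y1 y2) +
   (s / (a - b)) ^+ 2 * (gradient_form n a b * (a - b)) +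
   (r / (a - b)) ^+ 2 * (gradient_form n b a * (b - a)) + zero_order n a b.
  have -> : a22 = b11 - (b11 - a22) by ring.
  rewrite simons pE qE x1E x2E y1E y2E /hess /gradient_form /zero_order.
  rewrite -/N1 -/N2 -/f1 -/f2 -/f11 -/f22.
  have -> : slope12 n b a = slope12 n a b.
    rewrite /slope12 /wnum12 /wnum; move: (a ^+ n.-1) (b ^+ n.-1) (a ^+ n) (b ^+ n).
    move=> A1 A2 A3 A4; ring.
  move: (slope11 n a b) (slope11 n b a) (slope12 n a b) (speed n a b) => w1 w2 w3 f.
  move: N1 N2 f1 f2 f11 f22 {N0 hx hy hxx hyy x1E x2E y1E y2E f10 f20 pE qE G1 G2 Z simons}.
  move=> N1 N2 f1 f2 f11 f22; field; exact: ab0.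
have s2 : (s / (a - b)) ^+ 2 * (gradient_form n a b * (a - b)) <= 0.
  by rewrite mulr_ge0_le0 // sqr_ge0.
have r2 : (r / (a - b)) ^+ 2 * (gradient_form n b a * (b - a)) <= 0.
  by rewrite mulr_ge0_le0 // sqr_ge0.
have e1 := mulr_ge0_le0 f10 hxx; have e2 := mulr_ge0_le0 f20 hyy.
lra.
Qed.

End PointwiseInequality.

(** * Evolution of the pinching quantity at a spatial maximum *)

Section ChainRules.
Variables (A : comPzRingType) (D : A -> A).
Hypothesis dD : derivation D.
Implicit Types (n : nat) (a b : A).

Lemma derivationB x y : D (x - y) = D x - D y.
Proof. by rewrite dD.1 derivationN. Qed.

Lemma derivationX x n : D (x ^+ n) = n%:R * x ^+ n.-1 * D x.
Proof.
elim: n => [|n IH]; first by rewrite expr0 derivation1 // !mul0r.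
rewrite exprS dD.2 IH /= -[in RHS]natr1; case: n {IH} => [|n] /=.
  by rewrite !expr0; ring.
by rewrite exprS; ring.
Qed.

Lemma derivation_nat n : D n%:R = 0.
Proof.
elim: n => [|n IH]; first exact: derivation0.
by rewrite -natr1 dD.1 IH derivation1 // addr0.
Qed.

Lemma derivation_speed n a b : D (speed n a b) = speed1 n a * D a + speed1 n b * D b.
Proof. by rewrite /speed dD.1 !derivationX /speed1 addn2 addn1. Qed.

Lemma derivation_speed1 n a : D (speed1 n a) = speed11 n a * D a.
Proof.
by rewrite /speed1 /speed11 dD.2 derivation_nat derivationX mul0r add0r !mulrA addn1.
Qed.

Lemma derivation_wnum n a b :
  D (wnum n a b) = wnum1 n a b * D a + wnum1 n b a * D b.
Proof.
rewrite /wnum !(dD.1, dD.2, derivationX, derivationN _ dD) /wnum1 /=.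
move: (a ^+ n.-1) (b ^+ n.-1) (a ^+ n) (b ^+ n) (n%:R) => *; ring.
Qed.

Lemma derivation_wnum1 n a b :
  D (wnum1 n a b) = wnum11 n a b * D a + wnum12 n a b * D b.
Proof.
rewrite /wnum1 !(dD.1, dD.2, derivationX, derivation_nat, derivationN _ dD).
rewrite /wnum11 /wnum12.
move: (a ^+ n.-2) (b ^+ n.-2) (a ^+ n.-1) (b ^+ n.-1) (a ^+ n) (b ^+ n) (n.-1%:R) (n%:R) => *.
rewrite /=; ring.
Qed.

Variables (n : nat) (a b W : A).
Hypothesis WE : W * (a * b) = wnum n a b.

Lemma slope_gradient :
  (a * b) ^+ 2 * D W = slope n a b * D a + slope n b a * D b.
Proof.
have := congr1 D WE; rewrite dD.2 derivation_wnum => E.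
have -> : (a * b) ^+ 2 * D W = a * b * (D W * (a * b)) by ring.
have -> : D W * (a * b) = wnum1 n a b * D a + wnum1 n b a * D b - W * D (a * b).
  by rewrite -E addrK.
have -> : slope n b a = a * b * wnum1 n b a - W * (a * b) * a.
  by rewrite WE /slope /wnum; ring.
rewrite /slope -WE dD.2; ring.
Qed.

(** slope11 and slope12 differ from (a b)^2 times the second derivatives of w by
    multiples of dw, which are collected in the term containing D W. *)
Lemma slope_hessian :
  (a * b) ^+ 2 * D (D W) + 2%:R * (a * b) * D (a * b) * D W =
  slope n a b * D (D a) + slope n b a * D (D b) +
  (slope11 n a b * D a ^+ 2 + 2%:R * slope12 n a b * D a * D b +
   slope11 n b a * D b ^+ 2).
Proof.
have := congr1 D slope_gradient.
rewrite dD.2 expr2 dD.2 => E.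
have -> : (a * b) ^+ 2 * D (D W) + 2%:R * (a * b) * D (a * b) * D W =
   (D (a * b) * (a * b) + a * b * D (a * b)) * D W + a * b * (a * b) * D (D W) by ring.
rewrite E.
have wC : wnum n b a = wnum n a b by rewrite /wnum; ring.
have wC12 : wnum12 n b a = wnum12 n a b.
  rewrite /wnum12; move: (a ^+ n.-1) (b ^+ n.-1) (a ^+ n) (b ^+ n) => *; ring.
rewrite dD.1 [D (slope n a b * _)]dD.2 [D (slope n b a * _)]dD.2.
rewrite /slope !derivationB ![D (_ * wnum1 _ _ _)]dD.2 ![D (wnum _ _ _ * _)]dD.2.
rewrite !derivation_wnum1 !derivation_wnum ![D (a * b)]dD.2 ![D (b * a)]dD.2.
rewrite wC wC12 /slope11 /slope12; ring.
Qed.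

End ChainRules.

(** ev is the evaluation at the maximum. Exchanging the two frame vectors turns
    (a, b, p, q) into (b, a, - q, - p), so that each identity for a gives the
    corresponding one for b. *)
Section EvolutionAtMaximum.
Variables (R : realFieldType) (A : comPzRingType) (ev : A -> R).
Hypotheses (evD : forall x y, ev (x + y) = ev x + ev y)
           (evM : forall x y, ev (x * y) = ev x * ev y) (ev1 : ev 1 = 1).

Let ev0 : ev 0 = 0.
Proof. by apply: (addrI (ev 0)); rewrite -evD !addr0. Qed.

Let evN x : ev (- x) = - ev x.
Proof. by apply: (addrI (ev x)); rewrite -evD !subrr ev0. Qed.

Let evX x n : ev (x ^+ n) = ev x ^+ n.
Proof. by elim: n => [|n IH]; rewrite ?expr0 ?ev1 // !exprS evM IH. Qed.

Let evn n : ev n%:R = n%:R.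
Proof. by elim: n => [|n IH]; rewrite ?ev0 // -!natr1 evD IH ev1. Qed.

Let evE := (evD, evM, evN, evX, evn).

Let ev_slope n a b : ev (slope n a b) = slope n (ev a) (ev b).
Proof. by rewrite /slope /wnum /wnum1 !evE. Qed.
Let ev_slope11 n a b : ev (slope11 n a b) = slope11 n (ev a) (ev b).
Proof. by rewrite /slope11 /wnum11 !evE. Qed.
Let ev_slope12 n a b : ev (slope12 n a b) = slope12 n (ev a) (ev b).
Proof. by rewrite /slope12 /wnum /wnum12 !evE. Qed.

Let ev_speed n a b : ev (speed n a b) = speed n (ev a) (ev b).
Proof. by rewrite /speed !evE. Qed.
Let ev_speed1 n a : ev (speed1 n a) = speed1 n (ev a).
Proof. by rewrite /speed1 !evE. Qed.
Let ev_speed11 n a : ev (speed11 n a) = speed11 n (ev a).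
Proof. by rewrite /speed11 !evE. Qed.
(* the named polynomials come first, so that they are not unfolded *)
Let evF := (ev_slope, ev_slope11, ev_slope12, ev_speed, ev_speed1, ev_speed11, evE).

Variables (E1 E2 T : A -> A).
Hypotheses (dE1 : derivation E1) (dE2 : derivation E2) (dT : derivation T).
Hypothesis two_regular : forall x : A, x + x = 0 -> x = 0.
Variables (X nu : 'rV[A]_3) (n : nat).
Let e1 := map_mx E1 X.
Let e2 := map_mx E2 X.
Hypotheses (e11 : dotr e1 e1 = 1) (e22 : dotr e2 e2 = 1) (nn : dotr nu nu = 1).
Hypotheses (e12 : dotr e1 e2 = 0) (e1n : dotr e1 nu = 0) (e2n : dotr e2 nu = 0).
Hypothesis principal : dotr (map_mx E1 nu) e2 = 0.
Hypothesis bracket12 :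
  exists al be, forall f, E1 (E2 f) - E2 (E1 f) = al * E1 f + be * E2 f.
Hypothesis bracketT1 :
  exists al be, forall f, T (E1 f) - E1 (T f) = al * E1 f + be * E2 f.
Hypothesis bracketT2 :
  exists al be, forall f, T (E2 f) - E2 (T f) = al * E1 f + be * E2 f.
Let a := dotr (map_mx E1 nu) e1.
Let b := dotr (map_mx E2 nu) e2.
Hypothesis flow : map_mx T X = - (speed n a b *: nu).

Let swap D1 D2 : (exists al be, forall f, D1 (D2 f) - D2 (D1 f) = al * E1 f + be * E2 f) ->
  exists al be, forall f, D1 (D2 f) - D2 (D1 f) = al * E2 f + be * E1 f.
Proof. by move=> [al [be br]]; exists be, al => f; rewrite br addrC. Qed.

Let neg D1 D2 : (exists al be, forall f, D1 (D2 f) - D2 (D1 f) = al * E1 f + be * E2 f) ->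
  exists al be, forall f, D2 (D1 f) - D1 (D2 f) = al * E1 f + be * E2 f.
Proof.
by move=> [al [be br]]; exists (- al), (- be) => f; rewrite -opprB br; ring.
Qed.

Lemma pinching_evolution_lt0 (W : A) : n \in [:: 2; 3; 4]%N ->
  W * (a * b) = wnum n a b -> 0 < ev a -> 0 < ev b -> ev a != ev b ->
  ev (E1 W) = 0 -> ev (E2 W) = 0 ->
  ev (E1 (E1 W)) <= 0 -> ev (E2 (E2 W)) <= 0 -> ev (T W) < 0.
Proof.
move=> hn WE a0 b0 ab W1 W2 W11 W22.
pose p := dotr (map_mx E1 e1) e2; pose q := dotr (map_mx E2 e1) e2.
have e21 : dotr e2 e1 = 0 by rewrite dotrC.
have pr21 := frame_principal_sym dE1 dE2 two_regular e11 e22 e12 e1n e2n principal bracket12.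
have br21 := swap (neg bracket12).
have cod2 : E2 a = p * (a - b) := frame_codazzi dE1 dE2 two_regular e11 e22 nn e12 e1n e2n principal bracket12.
have cod1 : E1 b = q * (a - b).
  have := frame_codazzi dE2 dE1 two_regular e22 e11 nn e21 e2n e1n pr21 br21.
  rewrite (frame_connection_sym dE2 e12) -/e1 -/e2 -/a -/b -/q => ->; ring.
have gauss : E1 q - E2 p = - (a * b) - p ^+ 2 - q ^+ 2 :=
  frame_gauss dE1 dE2 two_regular e11 e22 nn e12 e1n e2n principal bracket12.
have ta : T a = E1 (E1 (speed n a b)) - p * E2 (speed n a b) + speed n a b * a ^+ 2 :=
  frame_evolution dE1 dE2 dT two_regular e11 e22 nn e12 e1n e2n principal bracket12 bracketT1 bracketT2 flow.
have tb : T b = E2 (E2 (speed n a b)) + q * E1 (speed n a b) + speed n a b * b ^+ 2.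
  have := frame_evolution dE2 dE1 dT two_regular e22 e11 nn e21 e2n e1n pr21 br21
    (swap bracketT2) (swap bracketT1) flow.
  by rewrite (frame_connection_sym dE2 e12) -/e1 -/e2 -/a -/b -/q mulNr opprK.
(* the derivatives of the two Codazzi equations, combined by the Gauss equation *)
have simons : E1 (E1 b) - E2 (E2 a) =
    (- (a * b) - p ^+ 2 - q ^+ 2) * (a - b) + q * (E1 a - E1 b) - p * (E2 a - E2 b).
  rewrite -gauss {1}cod1 {1}cod2 dE1.2 dE2.2 !dE1.1 !dE2.1 (derivationN _ dE1) (derivationN _ dE2); ring.
have Q0 : 0 < (ev a * ev b) ^+ 2 by rewrite exprn_gt0 // mulr_gt0.
have grad D (dD : derivation D) : (ev a * ev b) ^+ 2 * ev (D W) =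
    slope n (ev a) (ev b) * ev (D a) + slope n (ev b) (ev a) * ev (D b).
  by have := congr1 ev (slope_gradient dD WE); rewrite !evF.
have hess D (dD : derivation D) : ev (D W) = 0 -> ev (D (D W)) <= 0 ->
    slope n (ev a) (ev b) * ev (D (D a)) + slope n (ev b) (ev a) * ev (D (D b)) +
    (slope11 n (ev a) (ev b) * ev (D a) ^+ 2 +
     2 * slope12 n (ev a) (ev b) * ev (D a) * ev (D b) +
     slope11 n (ev b) (ev a) * ev (D b) ^+ 2) <= 0.
  move=> DW DDW; have := congr1 ev (slope_hessian dD WE).
  rewrite !evF DW mulr0 addr0 => <-.
  by rewrite mulr_ge0_le0 // ltW.
have g1 := grad _ dE1; rewrite W1 mulr0 in g1.
have g2 := grad _ dE2; rewrite W2 mulr0 in g2.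
rewrite -(pmulr_rlt0 _ Q0) (grad _ dT).
have second D (dD : derivation D) : ev (D (D (speed n a b))) =
    speed1 n (ev a) * ev (D (D a)) + speed1 n (ev b) * ev (D (D b)) +
    (speed11 n (ev a) * ev (D a) ^+ 2 + speed11 n (ev b) * ev (D b) ^+ 2).
  rewrite (derivation_speed dD) dD.1 [D (speed1 n a * _)]dD.2 [D (speed1 n b * _)]dD.2.
  rewrite !(derivation_speed1 dD) !evF; ring.
apply: (@evolution_lt0 R n (ev a) (ev b) (ev p) (ev q) (ev (E1 a)) (ev (E1 b))
  (ev (E2 a)) (ev (E2 b)) (ev (E1 (E1 a))) (ev (E1 (E1 b))) (ev (E2 (E2 a))) (ev (E2 (E2 b)))) => //.
- exact: hess.
- exact: hess.
- by rewrite cod2 !evF.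
- by rewrite cod1 !evF.
- by have := congr1 ev simons; rewrite !evF.
- by rewrite ta !evF second // (derivation_speed dE2) !evF; ring.
- by rewrite tb !evF second // (derivation_speed dE1) !evF; ring.
Qed.

End EvolutionAtMaximum.

(** * Principal frames from a coordinate basis *)

Section PrincipalFrame.
Variables (A : comPzRingType) (D1 D2 T : A -> A).
Hypotheses (dD1 : derivation D1) (dD2 : derivation D2) (dT : derivation T).
Hypotheses (comm12 : forall f, D1 (D2 f) = D2 (D1 f))
  (commT1 : forall f, T (D1 f) = D1 (T f)) (commT2 : forall f, T (D2 f) = D2 (T f)).
Variables (X nu : 'rV[A]_3).
Implicit Types (c d f : A) (u v w : 'rV[A]_3).

Definition combine c d f : A := c * D1 f + d * D2 f.

Lemma derivation_combine c d : derivation (combine c d).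
Proof.
by split=> x y; rewrite /combine ?dD1.1 ?dD2.1 ?dD1.2 ?dD2.2; ring.
Qed.

Lemma map_combine c d u :
  map_mx (combine c d) u = c *: map_mx D1 u + d *: map_mx D2 u.
Proof. by apply/rowP => i; rewrite !mxE. Qed.

Lemma dotrDr u v w : dotr u (v + w) = dotr u v + dotr u w.
Proof. by rewrite !(dotrC u) dotrDl. Qed.

Lemma dotrZr c u v : dotr u (c *: v) = c * dotr u v.
Proof. by rewrite !(dotrC u) dotrZl. Qed.

Let dotrE := (dotrDl, dotrDr, dotrZl, dotrZr).

Let X1 := map_mx D1 X.
Let X2 := map_mx D2 X.

(** The matrix of coefficients of an orthonormal frame (e1, e2) in the basis
    (X1, X2) has the inverse with entries X_k . e_i, so that D1 and D2 are
    combinations of the frame derivations; hence all brackets are. *)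
Section Brackets.
Variables c11 c12 c21 c22 : A.
Let e1 := c11 *: X1 + c12 *: X2.
Let e2 := c21 *: X1 + c22 *: X2.
Hypotheses (e11 : dotr e1 e1 = 1) (e22 : dotr e2 e2 = 1) (e12 : dotr e1 e2 = 0).

Lemma coordinate_in_frame f :
  D1 f = dotr X1 e1 * combine c11 c12 f + dotr X1 e2 * combine c21 c22 f /\
  D2 f = dotr X2 e1 * combine c11 c12 f + dotr X2 e2 * combine c21 c22 f.
Proof.
pose C : 'M[A]_2 := \matrix_(i, j)
  (if i == 0 then if j == 0 then c11 else c12 else if j == 0 then c21 else c22).
pose B : 'M[A]_2 := \matrix_(i, j)
  (if i == 0 then if j == 0 then dotr X1 e1 else dotr X1 e2
   else if j == 0 then dotr X2 e1 else dotr X2 e2).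
have e21 : dotr e2 e1 = 0 by rewrite dotrC.
have CB : C *m B = 1%:M.
  apply/matrixP => i j; rewrite !mxE big_ord_recr big_ord_recr big_ord0 /= add0r !mxE /=.
  by case: i => [[|[|i]] ?] //; case: j => [[|[|j]] ?] //=;
     rewrite -!dotrZl -dotrDl.
have BC := mulmx1C CB.
have entry i j : \sum_k B i k * C k j = (i == j)%:R.
  by have := congr1 (fun M : 'M[A]_2 => M i j) BC; rewrite !mxE.
have b11 := entry 0 0; have b12 := entry 0 1; have b21 := entry 1 0; have b22 := entry 1 1.
move: b11 b12 b21 b22; rewrite !big_ord_recr !big_ord0 /= !add0r !mxE /= => b11 b12 b21 b22.
split; rewrite /combine.
- transitivity ((dotr X1 e1 * c11 + dotr X1 e2 * c21) * D1 f +
                (dotr X1 e1 * c12 + dotr X1 e2 * c22) * D2 f); last ring.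
  by rewrite b11 b12; ring.
- transitivity ((dotr X2 e1 * c11 + dotr X2 e2 * c21) * D1 f +
                (dotr X2 e1 * c12 + dotr X2 e2 * c22) * D2 f); last ring.
  by rewrite b21 b22; ring.
Qed.

Lemma coordinate_span x y : exists al be, forall f,
  x * D1 f + y * D2 f = al * combine c11 c12 f + be * combine c21 c22 f.
Proof.
exists (x * dotr X1 e1 + y * dotr X2 e1), (x * dotr X1 e2 + y * dotr X2 e2) => f.
have [F1 F2] := coordinate_in_frame f; rewrite [in LHS]F1 [in LHS]F2; ring.
Qed.

Lemma frame_bracket_exists : exists al be, forall f,
  combine c11 c12 (combine c21 c22 f) - combine c21 c22 (combine c11 c12 f) =
  al * combine c11 c12 f + be * combine c21 c22 f.
Proof.
have [al [be E]] := coordinate_span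
  (combine c11 c12 c21 - combine c21 c22 c11) (combine c11 c12 c22 - combine c21 c22 c12).
exists al, be => f; rewrite -E /combine.
rewrite !(dD1.1, dD2.1, dD1.2, dD2.2) comm12; ring.
Qed.

Lemma time_bracket_exists c d : exists al be, forall f,
  T (combine c d f) - combine c d (T f) =
  al * combine c11 c12 f + be * combine c21 c22 f.
Proof.
have [al [be E]] := coordinate_span (T c) (T d).
exists al, be => f; rewrite -E /combine dT.1 !dT.2 commT1 commT2; ring.
Qed.

End Brackets.

Definition g11 := dotr X1 X1.
Definition g12 := dotr X1 X2.
Definition g22 := dotr X2 X2.
Definition h11 := dotr (map_mx D1 nu) X1.
Definition h12 := dotr (map_mx D1 nu) X2.
Definition h22 := dotr (map_mx D2 nu) X2.
Definition gdet := g11 * g22 - g12 ^+ 2.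
Definition hdet := h11 * h22 - h12 ^+ 2.
Definition mixed_det := g22 * h11 - 2%:R * g12 * h12 + g11 * h22.

(** If mu is a principal curvature then h - mu g has rank at most one, and
    (m22, -m12), when nonzero, is in its kernel, hence a principal direction. *)
Definition eigen1 mu := h22 - mu * g22.
Definition eigen2 mu := - (h12 - mu * g12).
Definition eigen_norm mu := g11 * eigen1 mu ^+ 2 +
  2%:R * g12 * eigen1 mu * eigen2 mu + g22 * eigen2 mu ^+ 2.

Hypotheses (nX1 : dotr X1 nu = 0) (nX2 : dotr X2 nu = 0).

Let h21 : dotr (map_mx D2 nu) X1 = h12.
Proof.
have := derivation_dotr X1 nu dD2; rewrite nX1 derivation0 //.
have := derivation_dotr X2 nu dD1; rewrite nX2 derivation0 // => E1 E2.
have S : map_mx D1 X2 = map_mx D2 X1.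
  by apply/rowP => i; rewrite !mxE comm12.
rewrite /h12 dotrC [RHS]dotrC; apply: (addrI (dotr (map_mx D2 X1) nu)).
by rewrite -E2 E1 S.
Qed.

Lemma principal_frame_exists mu il ig :
  mu ^+ 2 * gdet - mu * mixed_det + hdet = 0 ->
  il ^+ 2 * eigen_norm mu = 1 -> ig ^+ 2 * gdet = 1 ->
  exists c11 c12 c21 c22,
    let e1 := map_mx (combine c11 c12) X in let e2 := map_mx (combine c21 c22) X in
    let a := dotr (map_mx (combine c11 c12) nu) e1 in
    let b := dotr (map_mx (combine c21 c22) nu) e2 in
    [/\ dotr e1 e1 = 1, dotr e2 e2 = 1 & dotr e1 e2 = 0] /\
    [/\ dotr (map_mx (combine c11 c12) nu) e2 = 0,
        a + b = ig ^+ 2 * mixed_det & a * b = ig ^+ 2 * hdet].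
Proof.
move=> char il1 ig1.
pose v1 := eigen1 mu; pose v2 := eigen2 mu.
(* (w1, w2) is (v1, v2) turned by a right angle, with the norm multiplied by the
   square root of gdet *)
pose w1 := - (g12 * v1 + g22 * v2); pose w2 := g11 * v1 + g12 * v2.
exists (il * v1), (il * v2), (il * ig * w1), (il * ig * w2).
rewrite /= !map_combine -/X1 -/X2 !dotrE -/g11 -/g12 -/g22 -/h11 -/h12 -/h22 h21.
rewrite (dotrC X2 X1) -/g12.
have K1 : h11 * v1 + h12 * v2 = mu * (g11 * v1 + g12 * v2).
  apply/eqP; rewrite -subr_eq0; apply/eqP; rewrite -[RHS]char.
  by rewrite /v1 /v2 /eigen1 /eigen2 /gdet /hdet /mixed_det; ring.
have K2 : h12 * v1 + h22 * v2 = mu * (g12 * v1 + g22 * v2).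
  by rewrite /v1 /v2 /eigen1 /eigen2; ring.
have N : il ^+ 2 * (g11 * v1 ^+ 2 + 2%:R * g12 * v1 * v2 + g22 * v2 ^+ 2) = 1 by [].
have hvw : (h11 * v1 + h12 * v2) * w1 + (h12 * v1 + h22 * v2) * w2 = 0.
  by rewrite K1 K2 /w1 /w2; ring.
split; split.
- by rewrite -[RHS]N; ring.
- transitivity (il ^+ 2 * (g11 * v1 ^+ 2 + 2%:R * g12 * v1 * v2 + g22 * v2 ^+ 2) *
    (ig ^+ 2 * gdet)); first by rewrite /w1 /w2 /gdet; ring.
  by rewrite N ig1 mulr1.
- rewrite /w1 /w2; ring.
- transitivity (il ^+ 2 * ig * ((h11 * v1 + h12 * v2) * w1 + (h12 * v1 + h22 * v2) * w2)).
    ring.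
  by rewrite hvw mulr0.
- transitivity (il ^+ 2 * (h11 * v1 ^+ 2 + 2%:R * h12 * v1 * v2 + h22 * v2 ^+ 2) * 1 +
    il ^+ 2 * ig ^+ 2 * (h11 * w1 ^+ 2 + 2%:R * h12 * w1 * w2 + h22 * w2 ^+ 2)); first ring.
  rewrite -[X in _ * X + _]ig1; transitivity (ig ^+ 2 * mixed_det *
    (il ^+ 2 * (g11 * v1 ^+ 2 + 2%:R * g12 * v1 * v2 + g22 * v2 ^+ 2))).
    rewrite /w1 /w2 /gdet /mixed_det; ring.
  by rewrite N mulr1.
- transitivity (il ^+ 4 * ig ^+ 2 *
    ((h11 * v1 ^+ 2 + 2%:R * h12 * v1 * v2 + h22 * v2 ^+ 2) *
    (h11 * w1 ^+ 2 + 2%:R * h12 * w1 * w2 + h22 * w2 ^+ 2) -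
    ((h11 * v1 + h12 * v2) * w1 + (h12 * v1 + h22 * v2) * w2) ^+ 2)).
    by rewrite hvw; ring.
  transitivity (ig ^+ 2 * hdet * (il ^+ 2 *
    (g11 * v1 ^+ 2 + 2%:R * g12 * v1 * v2 + g22 * v2 ^+ 2)) ^+ 2).
    rewrite /w1 /w2 /hdet; ring.
  by rewrite N expr1n mulr1.
Qed.

End PrincipalFrame.

(** * Smooth vector fields and the vector product *)

Section SmoothVectors.
Context {R : realType} {V : normedModType R} (O : domain (V := V)).
Local Notation A := (smooth_fun O).

Definition evalv (y : V) (u : 'rV[A]_3) : 'rV[R]_3 := map_mx (fun f : A => f y) u.

Lemma dotr_evalv y (u v : 'rV[A]_3) : O y -> dotr u v y = dot (evalv y u) (evalv y v).
Proof.
move=> Oy; rewrite /dotr /dot !big_ord_recr !big_ord0 !smfD // smf0 !smfM //.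
by rewrite !mxE.
Qed.

Lemma derive_coord (f : V -> 'rV[R]_3) v y i : differentiable f y ->
  ('D_v f y) 0 i = 'D_v (fun y => f y 0 i : R^o) y.
Proof. by move=> df; rewrite derive_mx ?mxE //; exact: diff_derivable. Qed.

Variables (Z : V -> 'rV[R]_3) (sZ : forall k, Ck k (dom_set O) Z).

Definition smooth_row : 'rV[A]_3 :=
  \row_i smf_of _ (fun k => Ck_coord i (dom_open O) (sZ k)).

Lemma evalv_row y : O y -> evalv y smooth_row = Z y.
Proof. by move=> Oy; apply/rowP => i; rewrite !mxE smf_ofE. Qed.

Lemma evalv_partial v y : O y -> evalv y (map_mx (partial v) smooth_row) = 'D_v Z y.
Proof.
move=> Oy; apply/rowP => i; rewrite !mxE partialE // derive_coord; last exact: (sZ 1).1.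
by apply: (derive_eq_on _ (dom_open O) Oy) => x Ox; rewrite smf_ofE.
Qed.

Lemma evalv_partial2 u v y : O y ->
  evalv y (map_mx (partial u) (map_mx (partial v) smooth_row)) = 'D_u ('D_v Z) y.
Proof.
move=> Oy; apply/rowP => i; rewrite !mxE partialE //.
rewrite derive_coord; last exact: ((sZ 2).2 v).1.
apply: (derive_eq_on _ (dom_open O) Oy) => x Ox.
by have := congr1 (fun w : 'rV[R]_3 => w 0 i) (evalv_partial v Ox); rewrite !mxE.
Qed.

End SmoothVectors.

Section VectorProduct.
Variable R : realType.
Implicit Types u v w : 'rV[R]_3.

Lemma dot3E u v : dot u v = u 0 0 * v 0 0 + u 0 1 * v 0 1 + u 0 2%:R * v 0 2%:R.
Proof.
rewrite /dot !big_ord_recr big_ord0 /= add0r.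
by do !congr (_ + _); congr (u 0 _ * v 0 _); apply: val_inj.
Qed.

Definition cross u v : 'rV[R]_3 := \row_i
  nth 0 [:: u 0 1 * v 0 2%:R - u 0 2%:R * v 0 1;
            u 0 2%:R * v 0 0 - u 0 0 * v 0 2%:R;
            u 0 0 * v 0 1 - u 0 1 * v 0 0] i.

Lemma dot_cross u v : dot (cross u v) (cross u v) =
  dot u u * dot v v - dot u v ^+ 2.
Proof. by rewrite !dot3E !mxE /=; ring. Qed.

Lemma dotC u v : dot u v = dot v u.
Proof. by apply: eq_bigr => i _; rewrite mulrC. Qed.

Lemma dotZr c u v : dot u (c *: v) = c * dot u v.
Proof. by rewrite mulr_sumr; apply: eq_bigr => i _; rewrite mxE mulrCA. Qed.

Lemma triple_product u v n (N := cross u v) :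
  dot N N *: n = dot n N *: N + (dot n v *: cross N u - dot n u *: cross N v).
Proof.
apply/rowP => i; rewrite /N; case: i => [[|[|[|i]]] hi] //.
- by rewrite (_ : Ordinal hi = 0); [rewrite !mxE !dot3E !mxE /=; ring|exact: val_inj].
- by rewrite (_ : Ordinal hi = 1); [rewrite !mxE !dot3E !mxE /=; ring|exact: val_inj].
- by rewrite (_ : Ordinal hi = 2%:R); [rewrite !mxE !dot3E !mxE /=; ring|exact: val_inj].
Qed.

Lemma orthogonal_cross u v n : dot n u = 0 -> dot n v = 0 ->
  dot (cross u v) (cross u v) *: n = dot n (cross u v) *: cross u v.
Proof. by move=> nu nv; rewrite triple_product nu nv !scale0r subr0 addr0. Qed.

End VectorProduct.

(** * Maxima along lines *)

Section LineMaximum.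
Context {R : realType} {V : normedModType R} (O : domain (V := V)).
Local Notation A := (smooth_fun O).
Implicit Types f g : A.

Lemma near0_line (P : V -> Prop) (u z : V) : (\forall y \near z, P y) ->
  \forall r \near (0 : R), P (r *: u + z).
Proof.
move=> nP; have : (fun r : R => r *: u + z) @ (0 : R) --> (0 : R) *: u + z.
  by apply: cvgD; [exact: scalel_continuous|exact: cvg_cst].
by rewrite scale0r add0r; apply.
Qed.

Lemma partial_along_line f (u z : V) : O z ->
  \forall r \near (0 : R),
    is_derive (r : R) 1 (fun r : R => f (r *: u + z) : R^o) (partial u f (r *: u + z)).
Proof.
move=> Oz; have nO : \forall y \near z, O y.
  exact: open_nbhs_nbhs (conj (dom_open O) Oz).
apply: filterS (near0_line u nO) => r Or.
rewrite partialE //; apply: is_derive_along_line; exact: smf_derivable.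
Qed.

Lemma partial_at_line_max f (u z : V) : O z ->
  (\forall r \near (0 : R), f (r *: u + z) <= f z) -> partial u f z = 0.
Proof.
move=> Oz fmax; have nd := partial_along_line f u Oz.
have [e /= e0 eP] := (nbhs_ballP _ _).1 (filterI nd fmax).
have e20 : 0 < e / 2 by rewrite divr_gt0.
have in_ball r : r \in `]- (e / 2), (e / 2)[ -> ball (0 : R) e r.
  rewrite in_itv /= => /andP[r1 r2]; rewrite /ball /= sub0r normrN ltr_norml.
  by apply/andP; split; lra.
have z0 : (0 : R) \in `]- (e / 2), (e / 2)[ by rewrite in_itv /=; apply/andP; split; lra.
have d_in r : r \in `]- (e / 2), (e / 2)[ -> derivable (fun r : R => f (r *: u + z) : R^o) r 1.
  by move=> /in_ball hr; have [] := (eP r hr).1.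
have le0 r : r \in `]- (e / 2), (e / 2)[ -> f (r *: u + z) <= f (0 *: u + z).
  by rewrite scale0r add0r => /in_ball hr; exact: (eP r hr).2.
have ee : - (e / 2) <= e / 2 by lra.
have [_ D0] := derive1_at_max ee d_in z0 le0.
have [_ D1] := (eP 0 (in_ball 0 z0)).1.
by move: D1; rewrite D0 scale0r add0r.
Qed.

(** If the second derivative were positive, the first derivative, which vanishes
    at the maximum, would be positive just after it. *)
Lemma partial2_at_line_max f (u z : V) : O z ->
  (\forall r \near (0 : R), f (r *: u + z) <= f z) -> partial u (partial u f) z <= 0.
Proof.
move=> Oz fmax; rewrite leNgt; apply/negP => pos.
have f1 := partial_at_line_max Oz fmax.
have nd := partial_along_line f u Oz.
pose psi (r : R) : R := partial u f (r *: u + z).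
have psi0 : psi 0 = 0 by rewrite /psi scale0r add0r.
have [dpsi Dpsi] : is_derive (0 : R) (1 : R) (psi : R -> R^o) (partial u (partial u f) z).
  have := nbhs_singleton (partial_along_line (partial u f) u Oz).
  by rewrite scale0r add0r.
have cpsi : h^-1 *: (psi (h *: 1 + 0) - psi 0 : R^o) @[h --> (0 : R)^'] --> 'D_1 (psi : R -> R^o) 0.
  exact: dpsi.
have npos : \forall h \near (0 : R)^', 0 < h^-1 * psi h.
  have := cvgr_gt _ cpsi 0 _; rewrite Dpsi => /(_ _ pos).
  by apply: filterS => h; rewrite psi0 addr0 subr0 /GRing.scale /= mulr1.
have [e1 /= e10 P1] := (nbhs_ballP _ _).1 (filterI nd fmax).
have [e2 /= e20 P2] := (nbhs_ballP _ _).1 npos.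
pose h := Num.min e1 e2 / 2.
have m0 : 0 < Num.min e1 e2 by rewrite lt_min e10.
have h0 : 0 < h by rewrite divr_gt0.
have hm : h < Num.min e1 e2 by rewrite /h; lra.
move: hm; rewrite lt_min => /andP[he1 he2].
have d_in r : r \in `]0, h[ -> is_derive r 1 (fun r : R => f (r *: u + z) : R^o) (psi r).
  rewrite in_itv /= => /andP[r0 rh]; apply: (P1 r _).1.
  by rewrite /ball /= sub0r normrN gtr0_norm //; exact: lt_trans he1.
have c_in : {within `[0, h], continuous (fun r : R => f (r *: u + z))}.
  apply: derivable_within_continuous => r; rewrite in_itv /= => /andP[r0 rh].
  have [] := (P1 r (ltac:(by rewrite /ball /= sub0r normrN ger0_norm //; exact: le_lt_trans he1))).1.
  by [].
have [r hr E] := MVT h0 d_in c_in.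
move: hr; rewrite in_itv /= => /andP[r0 rh].
have : 0 < r^-1 * psi r.
  apply: P2; last by rewrite gt_eqF.
  by rewrite /ball /= sub0r normrN gtr0_norm //; exact: lt_trans he2.
rewrite pmulr_rgt0 ?invr_gt0 // => psir.
have : f (h *: u + z) <= f z.
  by apply: (P1 h _).2; rewrite /ball /= sub0r normrN gtr0_norm.
apply/negP; rewrite -ltNge -subr_gt0.
have -> : f (h *: u + z) - f z = psi r * (h - 0) by rewrite -E scale0r add0r.
by rewrite subr0 mulr_gt0.
Qed.

(** Turns the sign of the time derivative into a statement on earlier times, since
    the maximum over space and time may lie on the last time slice. *)
Lemma partial_lt0_before f (u z : V) : O z -> partial u f z < 0 ->
  \forall r \near (0 : R), r < 0 -> f z < f (r *: u + z).
Proof.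
move=> Oz neg; pose psi (r : R) : R := f (r *: u + z).
have psi0 : psi 0 = f z by rewrite /psi scale0r add0r.
have [dpsi Dpsi] : is_derive (0 : R) (1 : R) (psi : R -> R^o) (partial u f z).
  by have := nbhs_singleton (partial_along_line f u Oz); rewrite scale0r add0r.
have cpsi : h^-1 *: (psi (h *: 1 + 0) - psi 0 : R^o) @[h --> (0 : R)^'] -->
    'D_1 (psi : R -> R^o) 0 by exact: dpsi.
have nneg : \forall h \near (0 : R)^', h^-1 * (psi h - psi 0) < 0.
  have := cvgr_lt _ cpsi 0 _; rewrite Dpsi => /(_ _ neg).
  by apply: filterS => h; rewrite addr0 /GRing.scale /= mulr1.
have {}nneg : \forall h \near (0 : R), h != 0 -> h^-1 * (psi h - psi 0) < 0.
  have [e /= e0 eP] := (nbhs_ballP _ _).1 nneg.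
  by apply/nbhs_ballP; exists e => //= h he hn0; apply: eP.
apply: filterS nneg => h hP h0.
by have := hP (ltr0_neq0 h0); rewrite nmulr_rlt0 ?invr_lt0 // subr_gt0 psi0.
Qed.

Lemma partial_combination f (s t : R) (v1 v2 y : V) : O y ->
  partial (s *: v1 + t *: v2) f y = s * partial v1 f y + t * partial v2 f y.
Proof.
move=> Oy; have df := (smf_smooth f 1).1 y Oy.
by rewrite !partialE // !(deriveE _ df) linearD !linearZ.
Qed.

End LineMaximum.

(** * Principal frames on a curved patch *)

Section CurvaturePatch.
Context {R : realType} {V : normedModType R}.
Variable n : nat.
Implicit Types (O : set V) (u v : V) (Z nu : V -> 'rV[R]_3) (l : V -> R).

Definition first_form Z u v (y : V) : R := dot ('D_u Z y) ('D_v Z y).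
Definition second_form Z nu u v (y : V) : R := - dot ('D_u ('D_v Z) y) (nu y).
Definition form_det (q11 q12 q22 : V -> R) y : R := q11 y * q22 y - q12 y ^+ 2.
Definition form_mixed_det (q11 q12 q22 p11 p12 p22 : V -> R) y : R :=
  q22 y * p11 y - 2 * q12 y * p12 y + q11 y * p22 y.

Section Pointwise.
Variables (v1 v2 : V) (Z nu : V -> 'rV[R]_3) (l1 l2 : V -> R) (y : V).
Let g11 := first_form Z v1 v1.
Let g12 := first_form Z v1 v2.
Let g22 := first_form Z v2 v2.
Let h11 := second_form Z nu v1 v1.
Let h12 := second_form Z nu v1 v2.
Let h22 := second_form Z nu v2 v2.

(** The principal curvatures l1, l2 are given by their sum and product only,
    because that is what is smooth where they coincide. *)
Record curvature_at : Prop := CurvatureAt {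
  at_unit : dot (nu y) (nu y) = 1;
  at_normal1 : dot (nu y) ('D_v1 Z y) = 0;
  at_normal2 : dot (nu y) ('D_v2 Z y) = 0;
  at_regular : 0 < form_det g11 g12 g22 y;
  at_pos1 : 0 < l1 y;
  at_pos2 : 0 < l2 y;
  at_sum : (l1 y + l2 y) * form_det g11 g12 g22 y =
    form_mixed_det g11 g12 g22 h11 h12 h22 y;
  at_prod : l1 y * l2 y * form_det g11 g12 g22 y = form_det h11 h12 h22 y }.

End Pointwise.

(** A smooth moving surface Z near a point of the parameter space V, with the two
    spatial directions v1 and v2. *)
Record curvature_patch O (v1 v2 : V) Z nu (l1 l2 : V -> R) : Prop := CurvaturePatch {
  patch_open : open O;
  patch_smooth : forall k, Ck k O Z;
  patch_at : forall y, O y -> curvature_at v1 v2 Z nu l1 l2 y }.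

Definition pinching (l1 l2 : V -> R) (y : V) : R := wnum n (l1 y) (l2 y) / (l1 y * l2 y).

Lemma smooth_inverse_sqrt (O : domain (V := V)) (f : smooth_fun O) :
  (forall y, O y -> 0 < f y) -> exists g : smooth_fun O, g ^+ 2 * f = 1.
Proof.
move=> f0; have [r [rr rE]] := smf_square_root f0.
have r0 y : O y -> r y != 0 by move=> Oy; rewrite rE // gt_eqF // sqrtr_gt0 f0.
have [g [rg gE]] := smf_inverse r0; exists g.
by rewrite -rr; transitivity ((r * g) ^+ 2); [ring|rewrite rg expr1n].
Qed.

Lemma sum_prod_pair (a b c d : R) : a + b = c + d -> a * b = c * d ->
  (a = c /\ b = d) \/ (a = d /\ b = c).
Proof.
move=> S P; have : (a - c) * (a - d) = 0.
  transitivity (a * (a + b) - a * (c + d) + (c * d - a * b)); first ring.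
  by rewrite S P !subrr addr0.
move/eqP; rewrite mulf_eq0 !subr_eq0 => /orP[] /eqP E; [left|right].
  by split=> //; apply: (addrI a); rewrite S E.
by split=> //; apply: (addrI a); rewrite S E addrC.
Qed.

Section Evaluation.
Variables (O : domain (V := V)) (y : V).
Hypothesis Oy : O y.
Implicit Types f g h : smooth_fun O.

Lemma smf_nat k : (k%:R : smooth_fun O) y = k%:R.
Proof.
elim: k => [|k IH]; first by rewrite smf0.
by rewrite -natr1 (smfD _ _ Oy) IH (smf1 Oy) natr1.
Qed.

Let evalE := (fun f g => smfD f g Oy, fun f => smfN f Oy,
  fun f m => smfX f m Oy, fun f g => smfM f g Oy, smf_nat).

Lemma eval_det f g h : (f * g - h ^+ 2) y = f y * g y - h y ^+ 2.
Proof. by rewrite !evalE. Qed.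

Lemma eval_mixed_det f g h f' g' h' : (f * f' - 2%:R * g * g' + h * h') y =
  f y * f' y - 2 * g y * g' y + h y * h' y.
Proof. by rewrite !evalE. Qed.

Lemma eval_sqrM f g : (f ^+ 2 * g) y = f y ^+ 2 * g y.
Proof. by rewrite !evalE. Qed.

Lemma eval_discr f g : (f ^+ 2 - 4%:R * g) y = f y ^+ 2 - 4 * g y.
Proof. by rewrite !evalE. Qed.

Lemma eval_quadratic f g h m : (m ^+ 2 * f - m * g + h) y =
  m y ^+ 2 * f y - m y * g y + h y.
Proof. by rewrite !evalE. Qed.

Lemma eval_quadratic_form f g h (u v : smooth_fun O) :
  (f * u ^+ 2 + 2%:R * g * u * v + h * v ^+ 2) y =
  f y * u y ^+ 2 + 2 * g y * u y * v y + h y * v y ^+ 2.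
Proof. by rewrite !evalE. Qed.

Lemma eval_subM f g m : (f - m * g) y = f y - m y * g y.
Proof. by rewrite !evalE. Qed.

Lemma eval_wnum f g : wnum n f g y = wnum n (f y) (g y).
Proof. by rewrite /wnum !evalE. Qed.

Lemma eval_speed f g : speed n f g y = speed n (f y) (g y).
Proof. by rewrite /speed !evalE. Qed.

Lemma eval_dot2 f g f' g' : (f * f' + g * g') y = f y * f' y + g y * g' y.
Proof. by rewrite !evalE. Qed.

Lemma eval_dot4 f g h (k : smooth_fun O) f' g' h' (k' : smooth_fun O) :
  (f * f' + g * g' + (h * h' + k * k')) y =
  f y * f' y + g y * g' y + (h y * h' y + k y * k' y).
Proof. by rewrite !evalE. Qed.

Lemma eval_add f g : (f + g) y = f y + g y. Proof. by rewrite !evalE. Qed.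
Lemma eval_mul f g : (f * g) y = f y * g y. Proof. by rewrite !evalE. Qed.

End Evaluation.

Lemma quadratic_form_gt0 (a b c u v : R) : 0 < a * c - b ^+ 2 -> 0 <= c -> u != 0 ->
  0 < a * u ^+ 2 + 2 * b * u * v + c * v ^+ 2.
Proof.
move=> abc c0 u0; have up : 0 < u ^+ 2 by rewrite exprn_even_gt0.
have : 0 < c * (a * u ^+ 2 + 2 * b * u * v + c * v ^+ 2).
  have -> : c * (a * u ^+ 2 + 2 * b * u * v + c * v ^+ 2) =
     (a * c - b ^+ 2) * u ^+ 2 + (b * u + c * v) ^+ 2 by ring.
  by apply: ltr_wpDr; [exact: sqr_ge0|exact: mulr_gt0].
move=> pos; rewrite ltNge; apply/negP => le0.
by have := mulr_ge0_le0 c0 le0; rewrite leNgt pos.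
Qed.

Section FramedPatch.
Variables (O : domain (V := V)) (v1 v2 vt : V) (Z nu : V -> 'rV[R]_3) (l1 l2 : V -> R).
Hypothesis patch : curvature_patch O v1 v2 Z nu l1 l2.
Hypothesis snu : forall k, Ck k (dom_set O) nu.
Local Notation A := (smooth_fun O).
Let X : 'rV[A]_3 := smooth_row (patch_smooth patch).
Let N : 'rV[A]_3 := smooth_row snu.
Local Notation D1 := (partial v1 : A -> A).
Local Notation D2 := (partial v2 : A -> A).
Local Notation T := (partial vt : A -> A).

Let partial_derivation v : derivation (partial v : A -> A).
Proof. by split; [exact: partialD|exact: partialM]. Qed.

Let eval_g u v y : O y ->
  dotr (map_mx (partial u) X) (map_mx (partial v) X) y = first_form Z u v y.
Proof. by move=> Oy; rewrite dotr_evalv // !evalv_partial. Qed.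

Let normal v : (forall y, O y -> dot (nu y) ('D_v Z y) = 0) ->
  dotr (map_mx (partial v) X) N = 0.
Proof.
move=> nv; apply: smf_eq => y Oy; rewrite smf0 dotr_evalv // evalv_partial //.
by rewrite evalv_row // dotC nv.
Qed.

Let eval_h u v y : O y -> (forall y, O y -> dot (nu y) ('D_v Z y) = 0) ->
  dotr (map_mx (partial u) N) (map_mx (partial v) X) y = second_form Z nu u v y.
Proof.
move=> Oy nv; have := derivation_dotr (map_mx (partial v) X) N (partial_derivation u).
rewrite normal // derivation0 // => /(congr1 (fun f : A => f y)).
rewrite smf0 smfD // (dotrC (map_mx (partial v) X)) (dotr_evalv _ N) // evalv_partial2 // evalv_row //.
by move/esym/eqP; rewrite addrC addr_eq0 => /eqP ->.
Qed.

Hypothesis distinct : forall y, O y -> l1 y != l2 y.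
Let mu y : R := (l1 y + l2 y + `|l1 y - l2 y|) / 2.
Hypothesis nonsingular : forall y, O y ->
  second_form Z nu v2 v2 y - mu y * first_form Z v2 v2 y != 0.
Hypothesis flow : forall y, O y -> 'D_vt Z y = - (speed n (l1 y) (l2 y) *: nu y).

Let eval_gdet y : O y -> gdet D1 D2 X y =
  form_det (first_form Z v1 v1) (first_form Z v1 v2) (first_form Z v2 v2) y.
Proof.
move=> Oy; rewrite /form_det -(eval_g v1 v1 Oy) -(eval_g v1 v2 Oy) -(eval_g v2 v2 Oy).
exact: eval_det.
Qed.

Let n1 y (Oy : O y) := at_normal1 (patch_at patch Oy).
Let n2 y (Oy : O y) := at_normal2 (patch_at patch Oy).

Let eval_hdet y : O y -> hdet D1 D2 X N y =
  form_det (second_form Z nu v1 v1) (second_form Z nu v1 v2) (second_form Z nu v2 v2) y.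
Proof.
move=> Oy; rewrite /form_det -(eval_h v1 Oy n1) -(eval_h v1 Oy n2) -(eval_h v2 Oy n2).
exact: eval_det.
Qed.

Let eval_mixed y : O y -> mixed_det D1 D2 X N y =
  form_mixed_det (first_form Z v1 v1) (first_form Z v1 v2) (first_form Z v2 v2)
     (second_form Z nu v1 v1) (second_form Z nu v1 v2) (second_form Z nu v2 v2) y.
Proof.
move=> Oy; rewrite /form_mixed_det -(eval_g v1 v1 Oy) -(eval_g v1 v2 Oy)
  -(eval_g v2 v2 Oy) -(eval_h v1 Oy n1) -(eval_h v1 Oy n2) -(eval_h v2 Oy n2).
exact: eval_mixed_det.
Qed.

Let gdet_gt0 y : O y -> 0 < gdet D1 D2 X y.
Proof. by move=> Oy; rewrite (eval_gdet Oy); exact: at_regular (patch_at patch Oy). Qed.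

Let sumE y : O y -> (l1 y + l2 y) * gdet D1 D2 X y = mixed_det D1 D2 X N y.
Proof.
move=> Oy; exact: etrans (congr1 (fun t => (l1 y + l2 y) * t) (eval_gdet Oy))
  (etrans (at_sum (patch_at patch Oy)) (esym (eval_mixed Oy))).
Qed.

Let prodE y : O y -> l1 y * l2 y * gdet D1 D2 X y = hdet D1 D2 X N y.
Proof.
move=> Oy; exact: etrans (congr1 (fun t => l1 y * l2 y * t) (eval_gdet Oy))
  (etrans (at_prod (patch_at patch Oy)) (esym (eval_hdet Oy))).
Qed.

(* H = ig^2 mixed_det and K = ig^2 hdet are the mean and Gauss curvatures *)
Let smooth_mean_gauss : exists ig : A, [/\ ig ^+ 2 * gdet D1 D2 X = 1,
  forall y, O y -> (ig ^+ 2 * mixed_det D1 D2 X N) y = l1 y + l2 y &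
  forall y, O y -> (ig ^+ 2 * hdet D1 D2 X N) y = l1 y * l2 y].
Proof.
move: (gdet D1 D2 X) (mixed_det D1 D2 X N) (hdet D1 D2 X N) gdet_gt0 sumE prodE.
move=> G M K G0 SE PE; have [ig igE] := smooth_inverse_sqrt G0; exists ig.
have igy y : O y -> ig y ^+ 2 * G y = 1.
  by move=> Oy; rewrite -(eval_sqrM Oy) igE (smf1 Oy).
split=> // y Oy; rewrite (eval_sqrM Oy).
  by rewrite -(SE y Oy) mulrCA (igy y Oy) mulr1.
by rewrite -(PE y Oy) mulrCA (igy y Oy) mulr1.
Qed.

Let smooth_mu : exists m : A, forall y, O y -> m y = mu y.
Proof.
have [ig [_]] := smooth_mean_gauss.
move: (ig ^+ 2 * mixed_det D1 D2 X N) (ig ^+ 2 * hdet D1 D2 X N) => H K HE KE.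
have dE y : O y -> (H ^+ 2 - 4%:R * K) y = (l1 y - l2 y) ^+ 2.
  by move=> Oy; rewrite (eval_discr Oy) (HE y Oy) (KE y Oy); ring.
have [y Oy|de [_ deE]] := @smf_square_root _ _ _ (H ^+ 2 - 4%:R * K).
  by rewrite (dE y Oy) exprn_even_gt0 //= subr_eq0 distinct.
exists (smf_cst O (2^-1) * (H + de)) => y Oy.
rewrite (eval_mul Oy) (smf_cstE _ Oy) (eval_add Oy) (HE y Oy) (deE y Oy) (dE y Oy).
by rewrite sqrtr_sqr /mu mulrC.
Qed.

Let muP y : mu y = l1 y \/ mu y = l2 y.
Proof.
rewrite /mu; have [h|/ltW h] := leP (l2 y) (l1 y).
  by left; rewrite ger0_norm ?subr_ge0 //; field.
by right; rewrite ler0_norm ?subr_le0 //; field.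
Qed.

Let char_eq (m : A) : (forall y, O y -> m y = mu y) ->
  m ^+ 2 * gdet D1 D2 X - m * mixed_det D1 D2 X N + hdet D1 D2 X N = 0.
Proof.
move: (gdet D1 D2 X) (mixed_det D1 D2 X N) (hdet D1 D2 X N) sumE prodE.
move=> G M K SE PE mE; apply: smf_eq => y Oy.
rewrite smf0 (eval_quadratic Oy) (mE y Oy) -(SE y Oy) -(PE y Oy).
by case: (muP y) => ->; ring.
Qed.

Let eigen_norm_gt0 (m : A) y : (forall y, O y -> m y = mu y) -> O y ->
  0 < eigen_norm D1 D2 X N m y.
Proof.
move=> mE Oy.
have e1 : eigen1 D2 X N m y != 0.
  suff -> : eigen1 D2 X N m y = second_form Z nu v2 v2 y - mu y * first_form Z v2 v2 y.
    exact: nonsingular.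
  rewrite -(eval_h v2 Oy n2) -(eval_g v2 v2 Oy) -(mE y Oy); exact: eval_subM.
have g0 := gdet_gt0 Oy; rewrite [X in 0 < X](eval_det Oy) in g0.
have c0 : 0 <= g22 D2 X y.
  rewrite [X in 0 <= X](dotr_evalv _ _ Oy); apply: sumr_ge0 => i _; exact: sqr_ge0.
exact: (eq_ind_r (fun t => 0 < t) (quadratic_form_gt0 (eigen2 D1 D2 X N m y) g0 c0 e1)
  (eval_quadratic_form Oy _ _ _ _ _)).
Qed.

(* The curvatures of the frame are l1 and l2 in an order that is allowed to depend
   on the point: only symmetric functions of them are used. *)
Let frame_data : exists c11 c12 c21 c22 : A,
  let E1 := combine D1 D2 c11 c12 in let E2 := combine D1 D2 c21 c22 in
  let a := dotr (map_mx E1 N) (map_mx E1 X) in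
  let b := dotr (map_mx E2 N) (map_mx E2 X) in
  [/\ dotr (map_mx E1 X) (map_mx E1 X) = 1, dotr (map_mx E2 X) (map_mx E2 X) = 1 &
      dotr (map_mx E1 X) (map_mx E2 X) = 0] /\
  dotr (map_mx E1 N) (map_mx E2 X) = 0 /\
  forall y, O y -> (a y = l1 y /\ b y = l2 y) \/ (a y = l2 y /\ b y = l1 y).
Proof.
have [m mE] := smooth_mu; have [ig [igE HE KE]] := smooth_mean_gauss.
have [il ilE] := smooth_inverse_sqrt (fun y Oy => eigen_norm_gt0 mE Oy).
have [c11 [c12 [c21 [c22 [e [prin SE PE]]]]]] :=
  principal_frame_exists (partial_derivation v1) (partial_derivation v2)
  (fun f => partial_comm v1 v2 f) (normal n1) (normal n2) (char_eq mE) ilE igE.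
exists c11, c12, c21, c22; split; first exact: e.
split=> [|y Oy]; first exact: prin.
apply: sum_prod_pair.
  exact: etrans (esym (eval_add Oy _ _)) (etrans (congr1 (fun f : A => f y) SE) (HE y Oy)).
exact: etrans (esym (eval_mul Oy _ _)) (etrans (congr1 (fun f : A => f y) PE) (KE y Oy)).
Qed.

Let partial_combine c d f z : O z ->
  combine D1 D2 c d f z = partial (c z *: v1 + d z *: v2) f z.
Proof.
move=> Oz; rewrite (partial_combination f (c z) (d z) v1 v2 Oz).
exact: eval_dot2.
Qed.

(* at a critical point of f the frame derivatives of second order only see the
   Hessian of f *)
Let combine_hessian (c d f : A) z : O z -> D1 f z = 0 -> D2 f z = 0 ->
  let u := c z *: v1 + d z *: v2 in
  combine D1 D2 c d (combine D1 D2 c d f) z = partial u (partial u f) z.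
Proof.
move=> Oz f1 f2 u; rewrite partial_combine // -/u.
have E : partial u (combine D1 D2 c d f) = partial u c * D1 f + c * partial u (D1 f) +
    (partial u d * D2 f + d * partial u (D2 f)).
  exact: etrans (partialD _ _ _) (congr2 +%R (partialM _ _ _) (partialM _ _ _)).
have -> : partial u (combine D1 D2 c d f) z =
    c z * partial u (D1 f) z + d z * partial u (D2 f) z.
  rewrite E; apply: etrans (eval_dot4 Oz _ _ _ _ _ _ _ _) _.
  by rewrite f1 f2 !mulr0 !add0r.
rewrite (partial_comm u v1) (partial_comm u v2).
exact: esym (partial_combination _ _ _ _ _ Oz).
Qed.

(** Where the principal curvatures differ, the larger one is a smooth function mu
    of the mean and Gauss curvatures; under the nonsingularity hypothesis the
    vector (h22 - mu g22, - (h12 - mu g12)) never vanishes and gives a smooth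
    principal direction. So the whole moving frame lives in the ring of smooth
    functions. *)
Lemma framed_patch_decreases z : O z ->
  (forall s t : R, \forall r \near (0 : R),
     pinching l1 l2 (r *: (s *: v1 + t *: v2) + z) <= pinching l1 l2 z) ->
  n \in [:: 2; 3; 4]%N ->
  exists W : A, (forall y, O y -> W y = pinching l1 l2 y) /\ partial vt W z < 0.
Proof.
move=> Oz wmax hn.
have pos1 y (Oy : O y) := at_pos1 (patch_at patch Oy).
have pos2 y (Oy : O y) := at_pos2 (patch_at patch Oy).
have [c11 [c12 [c21 [c22]]]] := frame_data.
set E1 := combine D1 D2 c11 c12; set E2 := combine D1 D2 c21 c22.
move=> [[e11 e22 e12] [prin]].
set a := dotr (map_mx E1 N) _; set b := dotr (map_mx E2 N) _ => abP.
have ab0 y : O y -> (a * b) y != 0.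
  move=> Oy; rewrite (eval_mul Oy); apply: lt0r_neq0.
  by case: (abP y Oy) => -[-> ->]; rewrite mulr_gt0 ?pos1 ?pos2.
have [inv [invE invy]] := smf_inverse ab0.
pose W := wnum n a b * inv.
have WE : W * (a * b) = wnum n a b by rewrite /W -mulrA (mulrC inv) invE mulr1.
have Wy y : O y -> W y = pinching l1 l2 y.
  move=> Oy; rewrite /W (eval_mul Oy) (invy y Oy) (eval_wnum Oy) (eval_mul Oy) /pinching.
  case: (abP y Oy) => -[-> ->] //; rewrite [l2 y * _]mulrC; congr (_ / _).
  rewrite /wnum; ring.
exists W; split=> //.
have nO : \forall y \near z, O y by exact: open_nbhs_nbhs (conj (dom_open O) Oz).
have Wmax (s t : R) : \forall r \near (0 : R), W (r *: (s *: v1 + t *: v2) + z) <= W z.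
  apply: filterS2 (near0_line (s *: v1 + t *: v2) nO) (wmax s t) => r Or.
  by rewrite (Wy _ Or) (Wy z Oz).
have W0 (s t : R) : partial (s *: v1 + t *: v2) W z = 0.
  exact: partial_at_line_max.
have W00 (s t : R) : partial (s *: v1 + t *: v2) (partial (s *: v1 + t *: v2) W) z <= 0.
  exact: partial2_at_line_max.
have D1W : D1 W z = 0 by have := W0 1 0; rewrite scale1r scale0r addr0.
have D2W : D2 W z = 0 by have := W0 0 1; rewrite scale1r scale0r add0r.
have pd := partial_derivation.
have cm12 (f : A) : D1 (D2 f) = D2 (D1 f) := partial_comm v1 v2 f.
have cT1 (f : A) : T (D1 f) = D1 (T f) := partial_comm vt v1 f.
have cT2 (f : A) : T (D2 f) = D2 (T f) := partial_comm vt v2 f.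
have NN : dotr N N = 1.
  apply: smf_eq => y Oy; rewrite (smf1 Oy) (dotr_evalv _ _ Oy) (evalv_row _ Oy).
  exact: at_unit (patch_at patch Oy).
have En (c d : A) : dotr (map_mx (combine D1 D2 c d) X) N = 0.
  by rewrite map_combine dotrDl !dotrZl (normal n1) (normal n2) !mulr0 addr0.
have br12 := frame_bracket_exists (pd v1) (pd v2) cm12.
have brT := time_bracket_exists (pd vt) cT1 cT2.
have eX (c d : A) : map_mx (combine D1 D2 c d) X = c *: map_mx D1 X + d *: map_mx D2 X.
  exact: map_combine.
have abz : a z != b z.
  by case: (abP z Oz) => -[-> ->]; rewrite ?distinct // eq_sym distinct.
have az : 0 < a z by case: (abP z Oz) => -[-> _]; rewrite ?pos1 ?pos2.
have bz : 0 < b z by case: (abP z Oz) => -[_ ->]; rewrite ?pos1 ?pos2.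
have TX : map_mx T X = - (speed n a b *: N).
  apply/rowP => i; apply: smf_eq => y Oy.
  have := congr1 (fun w : 'rV[R]_3 => w 0 i) (evalv_partial (patch_smooth patch) vt Oy).
  rewrite (flow Oy) !mxE => ->.
  rewrite (smfN _ Oy) (eval_mul Oy) (eval_speed Oy) (smf_ofE _ Oy).
  by case: (abP y Oy) => -[-> ->] //; rewrite /speed [in LHS]addrC.
have e11' := e11; have e22' := e22; have e12' := e12.
rewrite eX in e11'; rewrite eX in e22'; rewrite !eX in e12'.
have b12 := br12 _ _ _ _ _ e11' e22' e12'.
have bT := brT _ _ _ _ _ e11' e22' e12'.
apply: (@pinching_evolution_lt0 R A (fun f => f z) (fun f g => eval_add Oz f g)
  (fun f g => eval_mul Oz f g) (smf1 Oz) E1 E2 T (derivation_combine (pd v1) (pd v2) _ _)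
  (derivation_combine (pd v1) (pd v2) _ _) (pd vt) (@smf_half_regular _ _ O) X N n
  e11 e22 NN e12 (En _ _) (En _ _) prin b12
  (bT c11 c12) (bT c21 c22) TX W hn WE az bz abz).
- by rewrite [LHS]partial_combine.
- by rewrite [LHS]partial_combine.
- by rewrite [X in X <= 0]combine_hessian.
- by rewrite [X in X <= 0]combine_hessian.
Qed.

End FramedPatch.

End CurvaturePatch.

(** * Smoothness of the unit normal *)

Section NormalVector.
Context {R : realType} {V : normedModType R}.
Variables (v1 v2 : V) (Z : V -> 'rV[R]_3).
Implicit Types (O : set V).

(* the forms of Z, and their invariants for the normal field D_v1 Z x D_v2 Z, which
   is not normalised but depends on Z only *)
Definition normal_field (y : V) := cross ('D_v1 Z y) ('D_v2 Z y).
Definition metric_det : V -> R :=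
  form_det (first_form Z v1 v1) (first_form Z v1 v2) (first_form Z v2 v2).
Definition normal_mixed_det : V -> R :=
  form_mixed_det (first_form Z v1 v1) (first_form Z v1 v2) (first_form Z v2 v2)
    (second_form Z normal_field v1 v1) (second_form Z normal_field v1 v2)
    (second_form Z normal_field v2 v2).
Definition normal_det : V -> R :=
  form_det (second_form Z normal_field v1 v1) (second_form Z normal_field v1 v2)
    (second_form Z normal_field v2 v2).

Lemma normal_field_sqr y : dot (normal_field y) (normal_field y) = metric_det y.
Proof. exact: dot_cross. Qed.

Lemma form_det_scale (p q r p' q' r' : V -> R) c y :
  p y = c * p' y -> q y = c * q' y -> r y = c * r' y ->
  form_det p q r y = c ^+ 2 * form_det p' q' r' y.
Proof. by rewrite /form_det => -> -> ->; ring. Qed.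

Lemma form_mixed_det_scale (f g h p q r p' q' r' : V -> R) c y :
  p y = c * p' y -> q y = c * q' y -> r y = c * r' y ->
  form_mixed_det f g h p q r y = c * form_mixed_det f g h p' q' r' y.
Proof. by rewrite /form_mixed_det => -> -> ->; ring. Qed.

(** A unit normal is determined up to sign, and the sign is determined by the
    positivity of the mean curvature. *)
Lemma unit_normalE nu (l1 l2 : V -> R) y : curvature_at v1 v2 Z nu l1 l2 y ->
  exists c : R, [/\ nu y = c *: normal_field y, c ^+ 2 * metric_det y = 1,
    (l1 y + l2 y) * metric_det y = c * normal_mixed_det y,
    l1 y * l2 y * metric_det y = c ^+ 2 * normal_det y & 0 < c * normal_mixed_det y].
Proof.
move=> [u1 n1 n2 G0 p1 p2 S P]; have G0' : metric_det y != 0 by rewrite gt_eqF.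
pose c := dot (nu y) (normal_field y) / metric_det y; exists c.
have nuE : nu y = c *: normal_field y.
  have := orthogonal_cross n1 n2; rewrite -/(normal_field y) normal_field_sqr => E.
  by rewrite /c mulrC -scalerA -E scalerA mulVf // scale1r.
have cc : c ^+ 2 * metric_det y = 1.
  rewrite -normal_field_sqr -{1}u1 nuE.
  by rewrite dotZr (dotC (_ *: _)) dotZr; ring.
have hE u v : second_form Z nu u v y = c * second_form Z normal_field u v y.
  by rewrite /second_form nuE dotZr mulrN.
have SE : (l1 y + l2 y) * metric_det y = c * normal_mixed_det y.
  exact: etrans S (form_mixed_det_scale _ _ _ (hE _ _) (hE _ _) (hE _ _)).
split=> //; first exact: etrans P (form_det_scale (hE _ _) (hE _ _) (hE _ _)).
by rewrite -SE mulr_gt0 // addr_gt0.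
Qed.

Section Smoothness.
Variables (O : set V).
Hypotheses (oO : open O) (sZ : forall k, Ck k O Z).

Lemma Ck_dot k (f g : V -> 'rV[R]_3) : Ck k O f -> Ck k O g ->
  Ck k O (fun y => dot (f y) (g y) : R^o).
Proof. by move=> Cf Cg; apply: Ck_sum => // i; apply: CkM => //; exact: Ck_coord. Qed.

Lemma Ck_cross k (f g : V -> 'rV[R]_3) : Ck k O f -> Ck k O g ->
  Ck k O (fun y => cross (f y) (g y)).
Proof.
move=> Cf Cg; apply: Ck_row => // i; rewrite /cross.
have cf j := Ck_coord j oO Cf; have cg j := Ck_coord j oO Cg.
have sub (p q r s : V -> R^o) : Ck k O p -> Ck k O q -> Ck k O r -> Ck k O s ->
    Ck k O (fun y => p y * q y - r y * s y : R^o).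
  by move=> *; apply: CkD => //; [apply: CkM|apply: CkN => //; apply: CkM].
under eq_fun do rewrite mxE.
by case: i => [[|[|[|i]]] ?] //=; apply: sub.
Qed.

Lemma Ck_first_form k u v : Ck k O (first_form Z u v : V -> R^o).
Proof. by apply: Ck_dot; exact: (sZ k.+1).2. Qed.

Lemma Ck_normal_field k : Ck k O normal_field.
Proof. by apply: Ck_cross; exact: (sZ k.+1).2. Qed.

Lemma Ck_second_form k u v : Ck k O (second_form Z normal_field u v : V -> R^o).
Proof.
apply: CkN => //; apply: Ck_dot; last exact: Ck_normal_field.
exact: ((sZ k.+2).2 v).2.
Qed.

Lemma Ck_form_det k (p q r : V -> R^o) : Ck k O p -> Ck k O q -> Ck k O r ->
  Ck k O (form_det p q r : V -> R^o).
Proof.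
move=> Cp Cq Cr; apply: CkD => //; first exact: CkM.
apply: CkN => //; under eq_fun do rewrite expr2; exact: CkM.
Qed.

Lemma Ck_metric_det k : Ck k O (metric_det : V -> R^o).
Proof. by apply: Ck_form_det; exact: Ck_first_form. Qed.

Lemma Ck_normal_det k : Ck k O (normal_det : V -> R^o).
Proof. by apply: Ck_form_det; exact: Ck_second_form. Qed.

Lemma Ck_normal_mixed_det k : Ck k O (normal_mixed_det : V -> R^o).
Proof.
have f1 := Ck_first_form k; have f2 := Ck_second_form k.
apply: CkD => //; last by apply: CkM; [exact: oO|exact: f1|exact: f2].
apply: CkD => //; first by apply: CkM; [exact: oO|exact: f1|exact: f2].
apply: CkN => //; apply: CkM; [exact: oO| |exact: f2].
by apply: CkM; [exact: oO|exact: Ck_cst|exact: f1].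
Qed.

End Smoothness.

Lemma sign_sqrt (c g m : R) : 0 < g -> c ^+ 2 * g = 1 -> 0 < c * m ->
  c = Num.sg m / Num.sqrt g /\ c * m = `|m| / Num.sqrt g.
Proof.
move=> g0 cg cm; have s0 : 0 < Num.sqrt g by rewrite sqrtr_gt0.
have [d [cE d2]] : exists d, c = d / Num.sqrt g /\ d ^+ 2 = 1.
  exists (c * Num.sqrt g); rewrite mulfK ?gt_eqF //; split=> //.
  by rewrite exprMn sqr_sqrtr // ltW.
have {cm} : 0 < d * m by move: cm; rewrite cE mulrAC pmulr_lgt0 // invr_gt0.
move/eqP: d2; rewrite cE sqrf_eq1 mulrAC => /orP[] /eqP -> m0.
  by move: m0; rewrite mul1r => m0; rewrite gtr0_sg // gtr0_norm.
by move: m0; rewrite mulN1r oppr_gt0 => m0; rewrite ltr0_sg // ltr0_norm.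
Qed.

End NormalVector.

Section PatchDecrease.
Context {R : realType} {V : normedModType R}.
Variable n : nat.

Lemma smooth_derive_comm (O : set V) (Z : V -> 'rV[R]_3) (u v y : V) : open O ->
  (forall k, Ck k O Z) -> O y -> 'D_u ('D_v Z) y = 'D_v ('D_u Z) y.
Proof.
move=> oO sZ Oy; pose X := smooth_row (O := Domain oO) sZ.
have E : map_mx (partial u) (map_mx (partial v) X) = map_mx (partial v) (map_mx (partial u) X).
  by apply/rowP => i; rewrite !mxE partial_comm.
exact: etrans (esym (evalv_partial2 (O := Domain oO) sZ u v Oy))
  (etrans (congr1 (evalv y) E) (evalv_partial2 (O := Domain oO) sZ v u Oy)).
Qed.

Lemma form_det_swap (p q q' r : V -> R) y : q' y = q y ->
  form_det r q' p y = form_det p q r y.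
Proof. by rewrite /form_det => ->; rewrite mulrC. Qed.

Lemma form_mixed_det_swap (f g g' h p q q' r : V -> R) y : g' y = g y -> q' y = q y ->
  form_mixed_det h g' f r q' p y = form_mixed_det f g h p q r y.
Proof. by rewrite /form_mixed_det => -> ->; ring. Qed.

Lemma curvature_at_swap (O : set V) (v1 v2 : V) (Z nu : V -> 'rV[R]_3) (l1 l2 : V -> R) y :
  open O -> (forall k, Ck k O Z) -> O y ->
  curvature_at v1 v2 Z nu l1 l2 y -> curvature_at v2 v1 Z nu l1 l2 y.
Proof.
move=> oO sZ Oy [u1 n1 n2 G0 p1 p2 S P].
have gC : first_form Z v2 v1 y = first_form Z v1 v2 y by exact: dotC.
have hC : second_form Z nu v2 v1 y = second_form Z nu v1 v2 y.
  by rewrite /second_form (smooth_derive_comm v2 v1 oO sZ Oy).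
have GE := form_det_swap (first_form Z v1 v1) (first_form Z v2 v2) gC.
refine (CurvatureAt u1 n2 n1 _ p1 p2 _ _).
- exact: (eq_ind_r (fun t : R => is_true (0 < t)) G0 GE).
- exact: etrans (congr1 (fun t => (l1 y + l2 y) * t) GE) (etrans S (esym (form_mixed_det_swap _ _ _ _ gC hC))).
- exact: etrans (congr1 (fun t => l1 y * l2 y * t) GE) (etrans P (esym (form_det_swap _ _ hC))).
Qed.

(** If both diagonal entries of h - mu g vanish then so does the rest of this
    singular matrix, and both principal curvatures are mu. *)
Lemma not_both_singular (g11 g12 g22 h11 h12 h22 l1 l2 m : R) :
  0 < g11 * g22 - g12 ^+ 2 -> l1 != l2 -> (m = l1 \/ m = l2) ->
  (l1 + l2) * (g11 * g22 - g12 ^+ 2) = g22 * h11 - 2 * g12 * h12 + g11 * h22 ->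
  l1 * l2 * (g11 * g22 - g12 ^+ 2) = h11 * h22 - h12 ^+ 2 ->
  (h22 - m * g22 != 0) || (h11 - m * g11 != 0).
Proof.
move=> G0 ll ml S P; rewrite -negb_and; apply/negP => /andP[/eqP e2 /eqP e1].
have h22E : h22 = m * g22 by apply/eqP; rewrite -subr_eq0 e2.
have h11E : h11 = m * g11 by apply/eqP; rewrite -subr_eq0 e1.
have ch : m ^+ 2 - (l1 + l2) * m + l1 * l2 = 0 by case: ml => ->; ring.
have : (h12 - m * g12) ^+ 2 = 0.
  transitivity (- (m ^+ 2 - (l1 + l2) * m + l1 * l2) * (g11 * g22 - g12 ^+ 2)).
    transitivity (- (m ^+ 2 * (g11 * g22 - g12 ^+ 2) -
      m * ((l1 + l2) * (g11 * g22 - g12 ^+ 2)) + l1 * l2 * (g11 * g22 - g12 ^+ 2))); last ring.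
    by rewrite S P h11E h22E; ring.
  by rewrite ch oppr0 mul0r.
move/eqP; rewrite sqrf_eq0 subr_eq0 => /eqP h12E.
have : (l1 + l2 - 2 * m) * (g11 * g22 - g12 ^+ 2) = 0.
  by rewrite mulrBl S h11E h22E h12E; ring.
move/eqP; rewrite mulf_eq0 (gt_eqF G0) orbF => /eqP sm.
by move/eqP: ll; apply; case: ml sm => ->; lra.
Qed.

Lemma sgr_eq_of_mul_gt0 (a b : R) : 0 < Num.sg a * b -> Num.sg b = Num.sg a.
Proof.
case: (sgrP a) => _; first by rewrite mul0r ltxx.
  by rewrite mul1r => /gtr0_sg.
by rewrite mulN1r oppr_gt0 => /ltr0_sg.
Qed.

Variables (O : set V) (v1 v2 vt : V) (Z nu : V -> 'rV[R]_3) (l1 l2 : V -> R).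
Hypothesis patch : curvature_patch O v1 v2 Z nu l1 l2.
Let oO := patch_open patch.
Let sZ := patch_smooth patch.
Let G := metric_det v1 v2 Z.
Let m := normal_mixed_det v1 v2 Z.
Let k := normal_det v1 v2 Z.

Let normalE y : O y -> [/\ nu y = (Num.sg (m y) / Num.sqrt (G y)) *: normal_field v1 v2 Z y,
  (l1 y + l2 y) * G y = Num.sg (m y) / Num.sqrt (G y) * m y &
  (l1 y - l2 y) ^+ 2 = (m y ^+ 2 - 4 * k y * G y) / G y ^+ 3].
Proof.
move=> Oy; have at_y := patch_at patch Oy; have G0 := at_regular at_y.
have [c [nuE cG SE PE cm]] := unit_normalE at_y.
have [cE _] := sign_sqrt G0 cG cm; split; rewrite -?cE //.
move: cG SE PE G0; rewrite -/(metric_det v1 v2 Z y) -/G -/(m y) -/(k y).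
move: (G y) (m y) (k y) (l1 y) (l2 y) => g M K a b cg SE PE g0.
have g0' : g != 0 by rewrite gt_eqF.
apply: (mulIf (expf_neq0 3 g0')); rewrite divfK ?expf_neq0 //.
transitivity (g * (((a + b) * g) ^+ 2 - 4 * (a * b * g) * g)); first ring.
rewrite SE PE; transitivity ((c ^+ 2 * g) * M ^+ 2 - 4 * (c ^+ 2 * g) * K * g); first ring.
by rewrite cg; ring.
Qed.

Hypothesis flow : forall y, O y -> 'D_vt Z y = - (speed n (l1 y) (l2 y) *: nu y).

(** The normal is only given point by point, but equals the smooth normal field
    divided by its length, with the sign of the mean curvature, hence is smooth.
    Exchanging v1 and v2 if necessary makes the smooth eigenvector nonzero. *)
Lemma patch_decreases z : O z -> l1 z != l2 z ->
  (forall s t : R, \forall r \near (0 : R),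
     pinching n l1 l2 (r *: (s *: v1 + t *: v2) + z) <= pinching n l1 l2 z) ->
  n \in [:: 2; 3; 4]%N ->
  exists (O' : domain (V := V)) (W : smooth_fun O'),
    [/\ O' z, (forall y, O' y -> W y = pinching n l1 l2 y) & partial vt W z < 0].
Proof.
move=> Oz lz wmax hn.
have Gp y : O y -> 0 < G y by move=> Oy; exact: at_regular (patch_at patch Oy).
have CG := Ck_metric_det v1 v2 oO sZ; have Cm := Ck_normal_mixed_det v1 v2 oO sZ.
have Ck' := Ck_normal_det v1 v2 oO sZ; have CN := Ck_normal_field v1 v2 oO sZ.
rewrite -/G -/m -/k in CG Cm Ck'.
have NE := normalE; clear normalE; clearbody G m k.
pose dis y : R := m y ^+ 2 - 4 * k y * G y.
have Cdis j : Ck j O (dis : V -> R^o).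
  apply: CkD => //; first by under eq_fun do rewrite expr2; exact: CkM.
  by apply: CkN => //; do 2?apply: CkM => //; exact: Ck_cst.
have dis0 y : O y -> (dis y != 0) = (l1 y != l2 y).
  move=> Oy; have [_ _ E] := NE _ Oy.
  rewrite -(subr_eq0 (l1 y)) -(sqrf_eq0 (l1 y - l2 y)) E mulf_eq0 invr_eq0 expf_eq0 /=.
  by rewrite (gt_eqF (Gp y Oy)) orbF.
pose sg := Num.sg (m z).
have sqG y : O y -> 0 < Num.sqrt (G y) by move=> Oy; rewrite sqrtr_gt0 Gp.
have pos y : O y -> 0 < (l1 y + l2 y) * G y.
  move=> Oy; have at_y := patch_at patch Oy.
  by rewrite mulr_gt0 ?Gp // addr_gt0 // ?(at_pos1 at_y) ?(at_pos2 at_y).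
have mz : m z != 0.
  apply: contraTneq (pos z Oz) => mz; have [_ -> _] := NE z Oz.
  by rewrite mz mulr0 ltxx.
pose O2 : set V := (O `&` (fun y => sg * m y) @^-1` [set x | 0 < x]) `&`
                   dis @^-1` [set x | x != 0].
have CM j : Ck j O (fun y => sg * m y : R^o) by apply: CkM => //; exact: Ck_cst.
have oO1 : open (O `&` (fun y => sg * m y) @^-1` [set x | 0 < x]).
  exact: (@Ck0_preimage_open R V R^o O _ _ oO (@open_gt R 0) (CM 0%N)).
have oO2 : open O2.
  apply: (@Ck0_preimage_open R V R^o _ _ dis oO1 (@open_neq R 0)) => x [Ox _].
  exact: (Cdis 0%N).
have O2z : O2 z.
  split; last by rewrite /= dis0.
  by split=> //=; rewrite /sg -normrEsg normr_gt0.
have sO2 : O2 `<=` O by move=> y [[]].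
have sgE y : O2 y -> Num.sg (m y) = sg.
  by move=> [[Oy /= h] _]; exact: sgr_eq_of_mul_gt0.
pose c y : R := sg / Num.sqrt (G y).
have nuE y : O2 y -> nu y = c y *: normal_field v1 v2 Z y.
  by move=> O2y; have [E _ _] := NE _ (sO2 y O2y); rewrite E sgE.
have Cc j : Ck j O2 (c : V -> R^o).
  apply: CkM => //; first exact: Ck_cst.
  apply: CkV => // [y /sO2 Oy|]; first by rewrite gt_eqF ?sqG.
  by apply: Ck_sqrt => // [y /sO2 /Gp //|]; exact: Ck_subset (CG j).
have snu j : Ck j O2 nu.
  apply: (Ck_eq_on (f := fun y => c y *: normal_field v1 v2 Z y)) => //.
    by move=> y /nuE.
  apply: Ck_row => // i.
  apply: (Ck_eq_on (f := fun y => c y * (normal_field v1 v2 Z y) 0 i : R^o)) => //.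
    by move=> y _; rewrite !mxE.
  by apply: CkM => //; apply: Ck_coord => //; exact: Ck_subset (CN j).
pose mu y : R := (l1 y + l2 y + `|l1 y - l2 y|) / 2.
pose mu' y : R := (c y * m y / G y + Num.sqrt (dis y / G y ^+ 3)) / 2.
have muE y : O2 y -> mu y = mu' y.
  move=> O2y; have Oy := sO2 y O2y; have [_ S D] := NE _ Oy.
  rewrite /mu /mu' /c -(sgE y O2y) -S mulfK ?gt_eqF ?Gp // /dis -D.
  by rewrite sqrtr_sqr.
have Cmu j : Ck j O2 (mu' : V -> R^o).
  have G3 y : O2 y -> G y ^+ 3 != 0 by move=> /sO2 /Gp Gy; rewrite expf_neq0 // gt_eqF.
  have CG2 i := Ck_subset sO2 (CG i).
  apply: CkM => //; last exact: Ck_cst.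
  apply: CkD => //.
    apply: CkM => //; first by apply: CkM => //; exact: Ck_subset (Cm j).
    by apply: CkV => // y /sO2 /Gp Gy; rewrite gt_eqF.
  apply: Ck_sqrt => // [y O2y|].
    have [_ _ D] := NE _ (sO2 y O2y); rewrite /dis -D exprn_even_gt0 //= subr_eq0.
    by rewrite -dis0; [case: O2y|exact: sO2].
  apply: CkM => //; first exact: Ck_subset (Cdis j).
  apply: CkV => //; under eq_fun do rewrite exprSr expr2.
  by do 2?apply: CkM.
pose e v y : R := second_form Z nu v v y - mu' y * first_form Z v v y.
have Ce v j : Ck j O2 (e v : V -> R^o).
  apply: CkD => //.
    apply: CkN => //; apply: (Ck_dot oO2); last exact: snu.
    exact: Ck_subset (((sZ j.+2).2 v).2 v).
  apply: CkN => //; apply: CkM => //; exact: Ck_subset (Ck_first_form oO sZ j v v).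
have conclude w1 w2 : e w2 z != 0 ->
    (forall y, O y -> curvature_at w1 w2 Z nu l1 l2 y) ->
    (forall s t : R, \forall r \near (0 : R),
      pinching n l1 l2 (r *: (s *: w1 + t *: w2) + z) <= pinching n l1 l2 z) ->
    exists (O' : domain (V := V)) (W : smooth_fun O'),
    [/\ O' z, (forall y, O' y -> W y = pinching n l1 l2 y) & partial vt W z < 0].
  move=> ez at_ wm; pose O3 := O2 `&` e w2 @^-1` [set x | x != 0].
  have oO3 : open O3.
    exact: (@Ck0_preimage_open R V R^o _ _ (e w2) oO2 (@open_neq R 0) (Ce w2 0%N)).
  have s32 : O3 `<=` O2 by move=> y [].
  have patch3 : curvature_patch (Domain oO3) w1 w2 Z nu l1 l2.
    by split=> [//|j|y /s32/sO2/at_ //]; apply: Ck_subset (sZ j) => y /s32/sO2.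
  have snu3 j : Ck j O3 nu by exact: Ck_subset (snu j).
  have ll y : Domain oO3 y -> l1 y != l2 y.
    by move=> /s32 O2y; rewrite -dis0; [case: O2y|exact: sO2].
  have ns y : Domain oO3 y -> second_form Z nu w2 w2 y -
      (l1 y + l2 y + `|l1 y - l2 y|) / 2 * first_form Z w2 w2 y != 0.
    by move=> O3y; rewrite -/(mu y) muE; [case: O3y|exact: s32].
  have fl y : Domain oO3 y -> 'D_vt Z y = - (speed n (l1 y) (l2 y) *: nu y).
    by move=> /s32/sO2; exact: flow.
  have [W [WE Wt]] := framed_patch_decreases patch3 snu3 ll ns fl (conj O2z ez) wm hn.
  by exists (Domain oO3), W.
have at_z := patch_at patch Oz.
have mul : mu z = l1 z \/ mu z = l2 z.
  rewrite /mu; have [h|/ltW h] := leP (l2 z) (l1 z).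
    by left; rewrite ger0_norm ?subr_ge0 //; field.
  by right; rewrite ler0_norm ?subr_le0 //; field.
have := not_both_singular (at_regular at_z) lz mul (at_sum at_z) (at_prod at_z).
case/orP => ez.
  apply: (conclude v1 v2) => // [|y Oy]; first by rewrite /e -muE.
  exact: patch_at patch y Oy.
apply: (conclude v2 v1); first by rewrite /e -muE.
  by move=> y Oy; apply: (curvature_at_swap oO sZ Oy); exact: (patch_at patch Oy).
by move=> s t; rewrite addrC; exact: wmax.
Qed.

End PatchDecrease.

(** * Continuity of the pinching quantity *)

Section PinchingContinuity.
Context {R : realType} {V : normedModType R}.
Variables (n : nat) (v1 v2 : V) (Z : V -> 'rV[R]_3).

(** Newton's recursion for power sums of two variables. *)
Fixpoint power_sum (k : nat) (s p : R) : R :=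
  if k is k1.+1 then
    if k1 is k2.+1 then s * power_sum k1 s p - p * power_sum k2 s p else s
  else 2.

Lemma power_sumE k (a b : R) : power_sum k (a + b) (a * b) = a ^+ k + b ^+ k.
Proof.
suff : power_sum k (a + b) (a * b) = a ^+ k + b ^+ k /\
       power_sum k.+1 (a + b) (a * b) = a ^+ k.+1 + b ^+ k.+1 by case.
elim: k => [|k [IH0 IH1]]; first by rewrite /= !expr0 !expr1.
by split=> //; rewrite [LHS]/= -/(power_sum k.+1 _ _) IH1 IH0 !exprS; ring.
Qed.

Let G := metric_det v1 v2 Z.
Let m := normal_mixed_det v1 v2 Z.
Let k := normal_det v1 v2 Z.

Definition mean_curvature (y : V) : R := `|m y| / Num.sqrt (G y) / G y.
Definition gauss_curvature (y : V) : R := k y / G y / G y.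
(** The pinching quantity in terms of the mean and Gauss curvatures, which, unlike
    the principal curvatures, are continuous functions of the derivatives of Z
    across umbilics. *)
Definition pinching_of_forms (y : V) : R :=
  power_sum n (mean_curvature y) (gauss_curvature y) * mean_curvature y *
  (mean_curvature y ^+ 2 - 4 * gauss_curvature y) / gauss_curvature y.

Lemma curvatures_of_forms (nu : V -> 'rV[R]_3) (l1 l2 : V -> R) y :
  curvature_at v1 v2 Z nu l1 l2 y ->
  l1 y + l2 y = mean_curvature y /\ l1 y * l2 y = gauss_curvature y.
Proof.
move=> at_y; have G0 := at_regular at_y.
have [c [_ cG SE PE cm]] := unit_normalE at_y; have [_ cmE] := sign_sqrt G0 cG cm.
have G0' : metric_det v1 v2 Z y != 0 by rewrite gt_eqF.
rewrite /mean_curvature /gauss_curvature -cmE -SE mulfK //; split=> //.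
have c2 : c ^+ 2 = (metric_det v1 v2 Z y)^-1.
  by apply: (mulIf G0'); rewrite cG mulVf.
have -> : k y / G y = c ^+ 2 * normal_det v1 v2 Z y by rewrite c2 mulrC.
by rewrite -PE mulfK.
Qed.

Lemma pinching_formsE (nu : V -> 'rV[R]_3) (l1 l2 : V -> R) y :
  curvature_at v1 v2 Z nu l1 l2 y -> pinching n l1 l2 y = pinching_of_forms y.
Proof.
move=> /curvatures_of_forms[S P].
rewrite /pinching /pinching_of_forms -S -P power_sumE /wnum; congr (_ / _); ring.
Qed.

Lemma continuous_power_sum j (f g : V -> R) z : {for z, continuous f} ->
  {for z, continuous g} -> {for z, continuous (fun y => power_sum j (f y) (g y))}.
Proof.
move=> cf cg; suff [] : {for z, continuous (fun y => power_sum j (f y) (g y))} /\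
  {for z, continuous (fun y => power_sum j.+1 (f y) (g y))} by [].
elim: j => [|j [IH0 IH1]]; first by split=> //; exact: cvg_cst.
split=> //=; apply: (@continuousB R R^o V); exact: (@continuousM R V).
Qed.

Lemma continuous_pinching_of_forms (O : set V) z : open O -> (forall j, Ck j O Z) ->
  O z -> 0 < G z -> k z != 0 -> {for z, continuous pinching_of_forms}.
Proof.
move=> oO sZ Oz G0 k0.
have cG : {for z, continuous G} := Ck_metric_det v1 v2 oO sZ 0%N z Oz.
have cm : {for z, continuous m} := Ck_normal_mixed_det v1 v2 oO sZ 0%N z Oz.
have ck : {for z, continuous k} := Ck_normal_det v1 v2 oO sZ 0%N z Oz.
have G0' : G z != 0 by rewrite gt_eqF.
have cI (f g : V -> R) : {for z, continuous f} -> {for z, continuous g} ->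
    g z != 0 -> {for z, continuous (fun y => f y / g y)}.
  by move=> cf cg g0; apply: (@continuousM R V) => //; exact: (@continuousV R V).
have cH : {for z, continuous mean_curvature}.
  apply: (cI) => //; apply: (cI); last by rewrite gt_eqF // sqrtr_gt0.
    by apply: (@continuous_comp V R R m (fun x => `|x|)) => //; exact: norm_continuous.
  apply: (@continuous_comp V R R G Num.sqrt) => //; exact: sqrt_continuous.
have cK : {for z, continuous gauss_curvature} by apply: (cI) => //; exact: cI.
apply: cI => //; last by rewrite /gauss_curvature !mulf_neq0 // invr_neq0.
apply: (@continuousM R V); first apply: (@continuousM R V) => //.
  exact: continuous_power_sum.
apply: (@continuousB R R^o V) => /=; last first.
  by apply: (@continuousM R V) => //; exact: cvg_cst.
have -> : (fun y => mean_curvature y ^+ 2) = (fun y => mean_curvature y * mean_curvature y).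
  by apply/funext => y; rewrite expr2.
exact: (@continuousM R V).
Qed.

End PinchingContinuity.

(** * Parametrizations of embedded surfaces *)

Section SmoothMaps.
Context {R : realType}.

Lemma smooth_on_near (V W : normedModType R) (A : set V) (f : V -> W) (N : set W) x :
  smooth_on A f -> A x -> open N -> N (f x) ->
  \forall y \near x, A y -> N (f y).
Proof.
move=> sf Ax oN Nfx; have [U [F [oU Ux CF fF]]] := sf x Ax.
have cF : {for x, continuous F} := CF 0%N x Ux.
have nF : \forall y \near x, N (F y).
  by apply: cF; rewrite -fF //; exact: open_nbhs_nbhs.
have nU : \forall y \near x, U y := open_nbhs_nbhs (conj oU Ux).
by apply: filterS2 nF nU => y NFy Uy Ay; rewrite fF.
Qed.

Lemma Ck_pair (V W1 W2 : normedModType R) k (O : set V) (f : V -> W1) (g : V -> W2) :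
  open O -> Ck k O f -> Ck k O g -> Ck k O (fun x => (f x, g x)).
Proof.
move=> oO Cf Cg.
have l1 : linear ((fun x => (x, 0)) : W1 -> (W1 * W2)%type).
  by move=> c u v; congr pair; rewrite /= scaler0 addr0.
have l2 : linear ((fun x => (0, x)) : W2 -> (W1 * W2)%type).
  by move=> c u v; congr pair; rewrite /= scaler0 addr0.
pose L1 : {linear W1 -> (W1 * W2)%type} := HB.pack ((fun x => (x, 0)) : W1 -> (W1 * W2)%type)
  (GRing.isLinear.Build _ _ _ _ _ l1).
pose L2 : {linear W2 -> (W1 * W2)%type} := HB.pack ((fun x => (0, x)) : W2 -> (W1 * W2)%type)
  (GRing.isLinear.Build _ _ _ _ _ l2).
have c1 : continuous L1 by move=> x; apply: cvg_pair; [exact: cvg_id|exact: cvg_cst].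
have c2 : continuous L2 by move=> x; apply: cvg_pair; [exact: cvg_cst|exact: cvg_id].
apply: (Ck_eq_on (f := fun x => (L1 \o f) x + (L2 \o g) x)) => //.
  by move=> x _; congr pair; rewrite /= ?addr0 ?add0r.
by apply: CkD => //; exact: Ck_linear_comp.
Qed.

Lemma embedded_parametrization (S U : set _) (phi : 'rV[R]_2 -> 'rV[R]_3)
    (f : 'rV[R]_3 -> 'rV[R]_3) :
  embedding S f -> local_parametrization S U phi ->
  local_parametrization (f @` S) U (f \o phi).
Proof.
move=> [_ sf [g [sg gf]]] [oU [N [oN [[phiU phi_inj phi_surj] sphi [psi [spsi psiK]]]]]].
have phiS a : U a -> S (phi a) by move=> Ua; have [] := phiU a Ua.
(* f maps S `&` N onto a relatively open part of the image of S *)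
split=> //; pose N' := interior [set y | (f @` S) y -> N (g y)].
have imN' x : S x -> N x -> N' (f x).
  move=> Sx Nx; have Mf : (f @` S) (f x) by exists x.
  have Ng : N (g (f x)) by rewrite gf.
  exact: smooth_on_near sg Mf oN Ng.
exists N'; split; first exact: open_interior.
split.
- split.
  + move=> a Ua; have [Sa Na] := phiU a Ua; split; first by exists (phi a).
    exact: imN'.
  + move=> a b Ua Ub /= E; apply: phi_inj => //.
    move: Ua Ub; rewrite !inE => Ua Ub.
    by rewrite -(gf (phi a)) ?E ?gf //; exact: phiS.
  + move=> y [[x Sx <-] /interior_subset N'y].
    have Nx : N x by rewrite -(gf x Sx); apply: N'y; exists x.
    by have [a Ua <-] := phi_surj x (conj Sx Nx); exists a.
- apply: (smooth_on_comp (B := S)) => //; exact: has_coords_rV.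
- exists (psi \o g); split=> [|a Ua /=]; last by rewrite gf ?psiK //; exact: phiS.
  apply: (smooth_on_comp (B := S `&` N)) => //; try exact: has_coords_rV.
    move=> y [[x Sx <-] /interior_subset N'y]; rewrite gf //; split=> //.
    by rewrite -(gf x Sx); apply: N'y; exists x.
  by apply: smooth_on_subset sg => y [].
Qed.

(** The smooth inverse extends to a neighbourhood in space, and the differential of
    this extension is a left inverse of the differential of phi. *)
Lemma parametrization_regular (M : set 'rV[R]_3) U phi a : local_parametrization M U phi ->
  U a -> differentiable phi a /\ forall v, 'D_v phi a = 0 -> v = 0.
Proof.
move=> [oU [N [oN [[phiU _ _] sphi [psi [spsi psiK]]]]]] Ua.
have dphi : differentiable phi a := (smooth_on_open 1 oU sphi).1 a Ua.
split=> // v Dv.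
have [N1 [F [oN1 N1a CF psiF]]] := spsi _ (phiU a Ua).
have dF : differentiable F (phi a) := (CF 1%N).1 _ N1a.
have near_id : \forall b \near a, (F \o phi) b = b.
  have nU : \forall b \near a, U b := open_nbhs_nbhs (conj oU Ua).
  have nN1 : \forall b \near a, N1 (phi b).
    by apply: (differentiable_continuous dphi); exact: open_nbhs_nbhs.
  apply: filterS2 nU nN1 => b Ub N1b /=; rewrite -psiF ?psiK //; exact: phiU.
have := near_eq_derive v near_id.
rewrite (deriveE _ (differentiable_comp dphi dF)) (diff_comp dphi dF) /=.
by rewrite -(deriveE _ dphi) Dv linear0 derive_id.
Qed.

Lemma dot_eq0 (w : 'rV[R]_3) : dot w w = 0 -> w = 0.
Proof.
move=> /eqP; rewrite dot3E.
have sq (x : R) : 0 <= x * x by rewrite -expr2 sqr_ge0.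
rewrite !paddr_eq0 ?addr_ge0 // !mulf_eq0 !orbb => /andP[/andP[/eqP w0 /eqP w1] /eqP w2].
apply/rowP => i; rewrite mxE; case: i => [[|[|[|i]]] hi] //.
- by rewrite (_ : Ordinal hi = 0) //; exact: val_inj.
- by rewrite (_ : Ordinal hi = 1) //; exact: val_inj.
- by rewrite (_ : Ordinal hi = 2%:R) //; exact: val_inj.
Qed.

Lemma gram_dependent (u v : 'rV[R]_3) : dot u u * dot v v - dot u v ^+ 2 = 0 ->
  dot v v *: u + - dot u v *: v = 0.
Proof.
move=> G0; apply: dot_eq0.
transitivity (dot v v * (dot u u * dot v v - dot u v ^+ 2)); last by rewrite G0 mulr0.
by rewrite !dot3E !mxE; ring.
Qed.

Lemma metric_det_gt0 (M : set 'rV[R]_3) U phi a (e1 e2 : 'rV[R]_2) :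
  local_parametrization M U phi -> U a ->
  (forall s t : R, s *: e1 + t *: e2 = 0 -> s = 0 /\ t = 0) ->
  0 < dot ('D_e1 phi a) ('D_e1 phi a) * dot ('D_e2 phi a) ('D_e2 phi a) -
      dot ('D_e1 phi a) ('D_e2 phi a) ^+ 2.
Proof.
move=> lp Ua ind; have [dphi reg] := parametrization_regular lp Ua.
rewrite -dot_cross lt0r; apply/andP; split; last first.
  by apply: sumr_ge0 => i _; rewrite -expr2 sqr_ge0.
rewrite dot_cross; apply/negP => /eqP G0.
set w1 := 'D_e1 phi a in G0; set w2 := 'D_e2 phi a in G0.
have comb s t : 'D_(s *: e1 + t *: e2) phi a = s *: w1 + t *: w2.
  by rewrite /w1 /w2 !(deriveE _ dphi) linearD !linearZ.
have E := gram_dependent G0.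
have [w20 _] := ind _ _ (reg _ (etrans (comb _ _) E)).
have W2 : w2 = 0 by exact: dot_eq0.
have := ind 0 1; rewrite scale0r scale1r add0r => h.
have [_ /eqP] := h (reg _ W2); by rewrite oner_eq0.
Qed.

End SmoothMaps.

Section TwoByTwo.
Variable R : fieldType.

(** h = B g for the matrix B of the characteristic polynomial, whose coefficients
    are the trace and the determinant of B. *)
Lemma eigenvalues_sum_prod (h g : 'M[R]_2) (l1 l2 : R) :
  g 0 0 * g 1 1 - g 0 1 * g 1 0 != 0 ->
  char_poly (h *m invmx g) = ('X - l1%:P) * ('X - l2%:P) ->
  (l1 + l2) * (g 0 0 * g 1 1 - g 0 1 * g 1 0) =
    g 1 1 * h 0 0 - g 1 0 * h 0 1 - g 0 1 * h 1 0 + g 0 0 * h 1 1 /\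
  l1 * l2 * (g 0 0 * g 1 1 - g 0 1 * g 1 0) = h 0 0 * h 1 1 - h 0 1 * h 1 0.
Proof.
have det2 (A : 'M[R]_2) : \det A = A 0 0 * A 1 1 - A 0 1 * A 1 0.
  rewrite (expand_det_row A 0) !big_ord_recr big_ord0 /= add0r /cofactor !det_mx11 !mxE /=.
  rewrite expr0 expr1 mul1r mulN1r mulrN.
  by congr (A _ _ * A _ _ - A _ _ * A _ _); apply: val_inj.
move=> g0 charE; have gu : g \in unitmx by rewrite unitmxE unitfE det2.
set B := h *m invmx g in charE.
have hE : h = B *m g by rewrite /B mulmxKV.
have hij i j : h i j = B i 0 * g 0 j + B i 1 * g 1 j.
  rewrite hE mxE !big_ord_recr big_ord0 /= add0r.
  by congr (B _ _ * g _ _ + B _ _ * g _ _); apply: val_inj.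
have pE : ('X - l1%:P) * ('X - l2%:P) = 'X^2 - (l1 + l2)%:P * 'X + (l1 * l2)%:P.
  by rewrite polyCD polyCM; ring.
rewrite pE in charE.
have trB : l1 + l2 = B 0 0 + B 1 1.
  have := char_poly_trace B (isT : (0 < 2)%N); rewrite charE /mxtrace.
  rewrite !(coefD, coefN, coefXn, coefCM, coefX, coefC) /= mulr1 add0r addr0.
  move/oppr_inj => ->; rewrite !big_ord_recr big_ord0 /= add0r.
  by congr (B _ _ + B _ _); apply: val_inj.
have detB : l1 * l2 = B 0 0 * B 1 1 - B 0 1 * B 1 0.
  have := char_poly_det B; rewrite charE det2 sqrrN expr1n mul1r => <-.
  by rewrite !(coefD, coefN, coefXn, coefCM, coefX, coefC) /= mulr0 subr0 add0r.
by rewrite trB detB !hij; split; ring.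
Qed.

End TwoByTwo.

(** * Charts of the flow *)

Section Slices.
Context {R : realType}.
Local Notation V := ('rV[R]_2 * R^o)%type.

Lemma derive_space_slice (Z : V -> 'rV[R]_3) (v a : 'rV[R]_2) (t : R) :
  'D_((v, 0) : V) Z (a, t) = 'D_v (fun b => Z (b, t)) a.
Proof.
rewrite /derive; suff -> : (fun h : R => h^-1 *: ((Z \o shift ((a, t) : V)) (h *: ((v, 0) : V)) - Z (a, t))) =
  (fun h : R => h^-1 *: (((fun b => Z (b, t)) \o shift a) (h *: v) - Z (a, t))) by [].
apply/funext => h /=; congr (_ *: (Z _ - _)).
by congr pair; rewrite /= scaler0 add0r.
Qed.

Lemma derive_time_slice (Z : V -> 'rV[R]_3) (a : 'rV[R]_2) (t : R) :
  'D_((0, 1) : V) Z (a, t) = lim ((fun h : R => h^-1 *: (Z (a, t + h) - Z (a, t))) @ (0 : R)^').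
Proof.
rewrite /derive; suff -> : (fun h : R => h^-1 *: ((Z \o shift ((a, t) : V)) (h *: ((0, 1) : V)) - Z (a, t))) =
  (fun h : R => h^-1 *: (Z (a, t + h) - Z (a, t))) by [].
apply/funext => h /=; congr (_ *: (Z _ - _)).
congr pair; first by rewrite /= scaler0 add0r.
by rewrite /= /GRing.scale /= mulr1 addrC.
Qed.

Lemma open_space_slice (O : set V) t : open O -> open [set b | O (b, t)].
Proof.
move=> oO; have -> : [set b | O (b, t)] = (fun b : 'rV[R]_2 => (b, t : R^o)) @^-1` O by [].
apply: open_comp => // b _.
have c1 : continuous_at b (fun b : 'rV[R]_2 => b) by exact: cvg_id.
have c2 : continuous_at b (fun _ : 'rV[R]_2 => t : R^o) by exact: cst_continuous.
exact: cvg_pair c1 c2.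
Qed.

End Slices.

Section FlowCharts.
Variables (R : realType) (T : \bar R) (S : set 'rV[R]_3) (X : R -> 'rV[R]_3 -> 'rV[R]_3).
Hypothesis surface : closed_surface S.
Hypothesis smooth_flow : @smooth_on R ('rV[R]_3 * R^o)%type 'rV[R]_3
                (S `*` time_interval T) (fun z => X z.2 z.1).
Hypothesis embedded : forall t, time_interval T t -> embedding S (X t).
Local Notation I := (time_interval T).
Local Notation V := ('rV[R]_2 * R^o)%type.

(** Z extends the flow, read in a parametrization phi of S near x0, to an open set
    of the parameter space; the last field says that the chart covers a
    neighbourhood of (x0, t0) in S x I. *)
Record flow_chart (x0 : 'rV[R]_3) (t0 : R) (a0 : 'rV[R]_2) (U : set 'rV[R]_2)
    (phi : 'rV[R]_2 -> 'rV[R]_3) (O : set V) (Z : V -> 'rV[R]_3) : Prop := FlowChart {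
  chart_open : open O;
  chart_smooth : forall k, Ck k O Z;
  chart_center : O (a0, t0);
  chart_point : phi a0 = x0;
  chart_param : local_parametrization S U phi;
  chart_domain : forall a t, O (a, t) -> U a;
  chart_flow : forall a t, O (a, t) -> I t -> Z (a, t) = X t (phi a);
  chart_cover : forall O' : set V, nbhs (a0, t0) O' ->
    \forall z \near (x0, t0), S z.1 -> exists a, O' (a, z.2) /\ phi a = z.1 }.

Lemma flow_chart_exists x0 t0 : S x0 -> I t0 ->
  exists a0 U phi O Z, flow_chart x0 t0 a0 U phi O Z.
Proof.
move=> Sx0 It0; have [_ _ _ param] := surface.
have [U [phi [lp [a0 Ua0 phia0]]]] := param x0 Sx0.
have [oU [N [oN [[phiU phi_inj phi_surj] sphi [psi [spsi psiK]]]]]] := lp.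
pose P (z : V) : ('rV[R]_3 * R^o)%type := (phi z.1, z.2).
have oU1 : open (fst @^-1` U : set V) by apply: open_comp => // ? _; exact: fst_continuous.
have CP k : Ck k (fst @^-1` U : set V) P.
  apply: Ck_pair => //; last exact: (@Ck_linear _ _ _ k _ (snd : {linear V -> R^o}) (@snd_continuous _ _ _)).
  exact: (@Ck_comp_linear _ _ _ _ k U phi (fst : {linear V -> 'rV[R]_2}) oU
    (@fst_continuous _ _ _) (smooth_on_open k oU sphi)).
have sP : smooth_on (U `*` I : set V) P.
  by move=> z [Uz Iz]; exists (fst @^-1` U), P; split.
have sY : smooth_on (U `*` I : set V) ((fun z => X z.2 z.1) \o P).
  apply: smooth_on_comp sP smooth_flow => [||z [Uz Iz]].
  - by apply: has_coords_prod; [exact: has_coords_rV|exact: has_coords_scalar].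
  - exact: has_coords_rV.
  - by split=> //=; have [] := phiU _ Uz.
have [N1 [Z [oN1 N1z CZ YZ]]] := sY (a0, t0) (conj Ua0 It0).
exists a0, U, phi, (N1 `&` fst @^-1` U), Z; split=> //.
- exact: openI.
- by move=> k; apply: Ck_subset (CZ k) => z [].
- by move=> a t [].
- by move=> a t [N1a Ua] It; rewrite -YZ.
- move=> O' /nbhs_ballP [r /= r0 rO'].
  have xN : (S `&` N) x0 by rewrite -phia0; exact: phiU.
  have psi0 : psi x0 = a0 by rewrite -phia0 psiK.
  have nb : \forall x \near x0, (S `&` N) x -> ball a0 r (psi x).
    have [N2 [oN2 N2a] N2r] : exists2 N2, open N2 /\ N2 a0 & N2 `<=` ball a0 r.
      by move: (nbhsx_ballx a0 r r0); rewrite nbhsE => -[N2 [? ?] ?]; exists N2.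
    have N2psi : N2 (psi x0) by rewrite psi0.
    by apply: filterS (smooth_on_near spsi xN oN2 N2psi) => x h /h /N2r.
  have nx : \forall x \near x0, N x by apply: open_nbhs_nbhs; case: xN.
  have key : \forall x \near x0 & t \near (t0 : R^o), S x ->
      exists a, O' (a, t) /\ phi a = x.
    have nt : \forall t \near (t0 : R^o), ball (t0 : R^o) r t by exact: nbhsx_ballx.
    near=> x t => Sx.
    have Nx : N x by near: x.
    have bx : ball a0 r (psi x).
      have h : (S `&` N) x -> ball a0 r (psi x) by near: x.
      exact: h.
    exists (psi x); split.
      by apply: rO'; split=> //=; near: t.
    have [a Ua ax] := phi_surj x (conj Sx Nx).
    by rewrite -ax psiK.
  by apply: filterS key => -[x t].
Unshelve. all: by end_near.
Qed.

Section CurvatureInChart.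
Variables (nu : R -> 'rV[R]_3 -> 'rV[R]_3) (lambda1 lambda2 : R -> 'rV[R]_3 -> R).
Hypothesis normal : forall t p, I t -> (X t @` S) p ->
  outer_unit_normal (X t @` S) p (nu t p).
Hypothesis curvatures : forall t p, I t -> (X t @` S) p ->
  principal_curvatures (X t @` S) p (nu t p) (lambda1 t p) (lambda2 t p).
Hypothesis convex : forall t p, I t -> (X t @` S) p ->
  0 < lambda1 t p /\ 0 < lambda2 t p.

Definition space1 : V := (delta_mx 0 0, 0).
Definition space2 : V := (delta_mx 0 1, 0).
Definition time_direction : V := (0, 1).
Definition in_chart (W : Type) (f : R -> 'rV[R]_3 -> W) (phi : 'rV[R]_2 -> 'rV[R]_3)
  (y : V) : W := f y.2 (X y.2 (phi y.1)).

Variables (x0 : 'rV[R]_3) (t0 : R) (a0 : 'rV[R]_2) (U : set 'rV[R]_2)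
  (phi : 'rV[R]_2 -> 'rV[R]_3) (O : set V) (Z : V -> 'rV[R]_3).
Hypothesis chart : flow_chart x0 t0 a0 U phi O Z.

Lemma chart_in_surface a : U a -> S (phi a).
Proof.
by move=> Ua; have [_ [N [_ [[h _ _] _ _]]]] := chart_param chart; have [] := h a Ua.
Qed.

Lemma chart_derive v a t : O (a, t) -> I t ->
  'D_((v, 0) : V) Z (a, t) = 'D_v (X t \o phi) a.
Proof.
move=> Oa It; rewrite derive_space_slice.
have Oa' : [set b | O (b, t)] a := Oa.
have E b : [set b | O (b, t)] b -> Z (b, t) = X t (phi b).
  by move=> Ob; exact: (chart_flow chart Ob It).
exact: (derive_eq_on v (@open_space_slice R O t (chart_open chart)) Oa' E).
Qed.

Lemma chart_derive2 u v a t : O (a, t) -> I t ->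
  'D_((u, 0) : V) ('D_((v, 0) : V) Z) (a, t) = 'D_u (fun b => 'D_v (X t \o phi) b) a.
Proof.
move=> Oa It; rewrite derive_space_slice.
have Oa' : [set b | O (b, t)] a := Oa.
have E b : [set b | O (b, t)] b -> 'D_((v, 0) : V) Z (b, t) = 'D_v (X t \o phi) b.
  by move=> Ob; exact: chart_derive.
exact: (derive_eq_on u (@open_space_slice R O t (chart_open chart)) Oa' E).
Qed.

(** At the initial time Z is an arbitrary extension to negative times, but spatial
    derivatives do not see it. *)
Lemma chart_curvature_at a t : O (a, t) -> I t ->
  curvature_at space1 space2 Z (in_chart nu phi)
    (in_chart lambda1 phi) (in_chart lambda2 phi) (a, t).
Proof.
move=> Oa It; have Ua := chart_domain chart Oa.
pose M := X t @` S; pose p := X t (phi a).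
have Mp : M p by exists (phi a) => //; exact: chart_in_surface.
have lp : local_parametrization M U (X t \o phi).
  exact: embedded_parametrization (embedded It) (chart_param chart).
have [n1 nT _] := normal It Mp; have [p1 p2] := convex It Mp.
have nD v : dot (nu t p) ('D_v (X t \o phi) a) = 0.
  by apply: nT; exists U, (X t \o phi), a, v.
have ind (s r : R) : s *: delta_mx 0 0 + r *: delta_mx 0 1 = 0 :> 'rV[R]_2 -> s = 0 /\ r = 0.
  move=> E; have := congr1 (fun w : 'rV[R]_2 => w 0 0) E.
  have := congr1 (fun w : 'rV[R]_2 => w 0 1) E.
  by rewrite !mxE /= !mulr0 !mulr1 add0r addr0.
have G0 := metric_det_gt0 lp Ua ind.
have := curvatures It Mp lp Ua erefl.
set h := second_fundamental_form _ _ _; set g := metric _ _ => charE.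
have gE i j : g i j = dot ('D_(delta_mx 0 i) (X t \o phi) a) ('D_(delta_mx 0 j) (X t \o phi) a).
  by rewrite mxE.
have hE i j : h i j = - dot ('D_(delta_mx 0 i) (fun b => 'D_(delta_mx 0 j) (X t \o phi) b) a) (nu t p).
  by rewrite mxE.
have gC : g 1 0 = g 0 1 by exact: etrans (gE 1 0) (etrans (dotC _ _) (esym (gE 0 1))).
have hC : h 1 0 = h 0 1.
  have [oU [N [_ [_ sm _]]]] := lp; have sk k := smooth_on_open k oU sm.
  exact: etrans (hE 1 0) (etrans (congr1 (fun w : 'rV[R]_3 => - dot w (nu t p))
    (smooth_derive_comm _ _ oU sk Ua)) (esym (hE 0 1))).
have fE i j : first_form Z ((delta_mx 0 i, 0) : V) ((delta_mx 0 j, 0) : V) (a, t) = g i j.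
  exact: etrans (congr2 (@dot R 3) (chart_derive (delta_mx 0 i) Oa It)
    (chart_derive (delta_mx 0 j) Oa It)) (esym (gE i j)).
have sE i j : second_form Z (in_chart nu phi) ((delta_mx 0 i, 0) : V)
    ((delta_mx 0 j, 0) : V) (a, t) = h i j.
  exact: etrans (congr1 (fun w : 'rV[R]_3 => - dot w (nu t p))
    (chart_derive2 (delta_mx 0 i) (delta_mx 0 j) Oa It)) (esym (hE i j)).
have f11 : first_form Z space1 space1 (a, t) = g 0 0 := fE 0 0.
have f12 : first_form Z space1 space2 (a, t) = g 0 1 := fE 0 1.
have f22 : first_form Z space2 space2 (a, t) = g 1 1 := fE 1 1.
have s11 : second_form Z (in_chart nu phi) space1 space1 (a, t) = h 0 0 := sE 0 0.
have s12 : second_form Z (in_chart nu phi) space1 space2 (a, t) = h 0 1 := sE 0 1.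
have s22 : second_form Z (in_chart nu phi) space2 space2 (a, t) = h 1 1 := sE 1 1.
have {}G0 : 0 < g 0 0 * g 1 1 - g 0 1 ^+ 2.
  have key (p11 p22 p12 q11 q22 q12 : R) : q11 = p11 -> q22 = p22 -> q12 = p12 ->
      0 < p11 * p22 - p12 ^+ 2 -> 0 < q11 * q22 - q12 ^+ 2 by move=> -> -> ->.
  exact: key (gE 0 0) (gE 1 1) (gE 0 1) G0.
have D1 : 'D_space1 Z (a, t) = 'D_(delta_mx 0 0) (X t \o phi) a by exact: chart_derive.
have D2 : 'D_space2 Z (a, t) = 'D_(delta_mx 0 1) (X t \o phi) a by exact: chart_derive.
have nD1 : dot (nu t p) ('D_space1 Z (a, t)) = 0.
  exact: etrans (congr1 (dot (nu t p)) D1) (nD (delta_mx 0 0)).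
have nD2 : dot (nu t p) ('D_space2 Z (a, t)) = 0.
  exact: etrans (congr1 (dot (nu t p)) D2) (nD (delta_mx 0 1)).
clearbody h g; clear gE hE fE sE nD D1 D2.
have G0' : g 0 0 * g 1 1 - g 0 1 * g 1 0 != 0 by rewrite gC -expr2 gt_eqF.
have [Sum Prod] := eigenvalues_sum_prod G0' charE.
refine (CurvatureAt n1 nD1 nD2 _ p1 p2 _ _).
- by rewrite /form_det f11 f12 f22.
- rewrite /form_det /form_mixed_det f11 f12 f22 s11 s12 s22.
  by move: Sum; rewrite gC hC -expr2 => Sum; rewrite [LHS]Sum; ring.
- rewrite /form_det f11 f12 f22 s11 s12 s22.
  by move: Prod; rewrite gC hC -!expr2.
Qed.

End CurvatureInChart.

End FlowCharts.

(** * The maximum principle *)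

Section TimeInterval.
Variables (R : realType) (T : \bar R).

Definition interior_times : set R := [set t | 0 < t /\ (t%:E < T)%E].

Lemma interior_times_sub t : interior_times t -> time_interval T t.
Proof. by move=> [/ltW t0 tT]. Qed.

Lemma open_interior_times : open interior_times.
Proof.
rewrite openE => t [t0 tT].
have n0 : \forall s \near t, 0 < s by exact: (open_nbhs_nbhs (conj (@open_gt R 0) t0)).
have nT : \forall s \near t, (s%:E < T)%E.
  case: T tT => [r||] //=.
    rewrite lte_fin => tr; have := open_nbhs_nbhs (conj (@open_lt R r) tr).
    by apply: filterS => s; rewrite lte_fin.
  by move=> _; near=> s; exact: ltry.
by apply: filterS2 n0 nT => s; split.
Unshelve. all: by end_near. Qed.

Lemma interior_times_between t1 t t2 : time_interval T t1 -> time_interval T t2 ->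
  t1 < t -> t <= t2 -> interior_times t.
Proof.
move=> [t10 _] [_ t2T] t1t tt2; split; first exact: le_lt_trans t1t.
by apply: le_lt_trans t2T; rewrite lee_fin.
Qed.

Lemma time_interval_between t1 t t2 : time_interval T t1 -> time_interval T t2 ->
  t1 <= t -> t <= t2 -> time_interval T t.
Proof.
move=> [t10 _] [_ t2T] t1t tt2; split; first exact: le_trans t1t.
by apply: le_lt_trans t2T; rewrite lee_fin.
Qed.

(** g is a coordinate expression of f that is only known near t, on P. *)
Lemma derivative_within_lim (f g : R -> 'rV[R]_3) t v (P : set R) :
  has_derivative_within (time_interval T) f t v -> interior_times t ->
  nbhs t P -> (forall s, P s -> time_interval T s -> g s = f s) ->
  lim ((fun h : R => h^-1 *: (g (t + h) - g t)) @ (0 : R)^') = v.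
Proof.
move=> der It nP gf.
have ct : (fun h : R => t + h) @ (0 : R) --> t.
  by rewrite -{2}(addr0 t); apply: cvgD; [exact: cvg_cst|exact: cvg_id].
have nI : \forall h \near (0 : R), P (t + h) /\ time_interval T (t + h).
  have nI : \forall s \near t, P s /\ time_interval T s.
    apply: filterI => //; apply: filterS (open_nbhs_nbhs (conj open_interior_times It)).
    exact: interior_times_sub.
  exact: (ct _ nI).
have [Pt IIt] : P t /\ time_interval T t.
  by have := nbhs_singleton nI; rewrite addr0.
apply: cvg_lim => //; move=> A /der nA.
have {}nA : \forall h \near (0 : R)^', time_interval T (t + h) ->
    A (h^-1 *: (f (t + h) - f t)) by exact: nA.
have nI' : \forall h \near (0 : R)^', P (t + h) /\ time_interval T (t + h).
  by apply: cvg_within; exact: nI.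
apply: filterS2 nA nI' => h hA [Ph Ih].
by change (A (h^-1 *: (g (t + h) - g t))); rewrite (gf _ Ph Ih) (gf _ Pt IIt); exact: hA.
Qed.

End TimeInterval.

Section MaximumPrinciple.
Variables (R : realType) (n : nat) (T : \bar R) (S : set 'rV[R]_3).
Variable X : R -> 'rV[R]_3 -> 'rV[R]_3.
Variables (nu : R -> 'rV[R]_3 -> 'rV[R]_3) (lambda1 lambda2 : R -> 'rV[R]_3 -> R).
Hypothesis hn : n \in [:: 2; 3; 4]%N.
Hypothesis surface : closed_surface S.
Hypothesis smooth_flow : @smooth_on R ('rV[R]_3 * R^o)%type 'rV[R]_3
                (S `*` time_interval T) (fun z => X z.2 z.1).
Hypothesis embedded : forall t, time_interval T t -> embedding S (X t).
Hypothesis normal : forall t p, time_interval T t -> (X t @` S) p ->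
  outer_unit_normal (X t @` S) p (nu t p).
Hypothesis curvatures : forall t p, time_interval T t -> (X t @` S) p ->
  principal_curvatures (X t @` S) p (nu t p) (lambda1 t p) (lambda2 t p).
Hypothesis convex : forall t p, time_interval T t -> (X t @` S) p ->
  0 < lambda1 t p /\ 0 < lambda2 t p.
Hypothesis flow : forall t x, time_interval T t -> S x ->
  has_derivative_within (time_interval T) (fun s => X s x) t
    (- (speed n (lambda1 t (X t x)) (lambda2 t (X t x)) *: nu t (X t x))).
Local Notation I := (time_interval T).
Local Notation V := ('rV[R]_2 * R^o)%type.
Local Notation M := ('rV[R]_3 * R^o)%type.

Definition flow_pinching (z : M) : R :=
  wnum n (lambda1 z.2 (X z.2 z.1)) (lambda2 z.2 (X z.2 z.1)) /
  (lambda1 z.2 (X z.2 z.1) * lambda2 z.2 (X z.2 z.1)).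

Lemma flow_pinching_ge0 x t : S x -> I t -> 0 <= flow_pinching (x, t).
Proof.
move=> Sx It; have [|p1 p2] := convex (p := X t x) It; first by exists x.
have p1' := ltW p1; have p2' := ltW p2; rewrite /flow_pinching /=.
apply: divr_ge0; last exact: mulr_ge0.
apply: mulr_ge0; last exact: sqr_ge0.
by apply: mulr_ge0; apply: addr_ge0 => //; exact: exprn_ge0.
Qed.

Lemma flow_pinching_continuous (A : set M) : A `<=` S `*` I ->
  {within A, continuous flow_pinching}.
Proof.
move=> sA; apply/subspace_continuousP => -[x0 t0] /sA[/= Sx0 It0].
have [a0 [U [phi [D [Z ch]]]]] := flow_chart_exists surface smooth_flow Sx0 It0.
have at_chart := chart_curvature_at embedded normal curvatures convex ch.
have wE a t : D (a, t) -> I t ->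
    flow_pinching (phi a, t) = pinching_of_forms n (space1 R) (space2 R) Z (a, t).
  by move=> Oa It; exact: pinching_formsE (at_chart a t Oa It).
have Oz := chart_center ch; have at0 := at_chart a0 t0 Oz It0.
have k0 : normal_det (space1 R) (space2 R) Z (a0, t0) != 0.
  have [_ P] := curvatures_of_forms at0.
  have := mulr_gt0 (at_pos1 at0) (at_pos2 at0); rewrite P /gauss_curvature.
  by apply: contraTneq => ->; rewrite !mul0r ltxx.
have c0 := continuous_pinching_of_forms (n := n) (chart_open ch) (chart_smooth ch) Oz
  (at_regular at0) k0.
move=> B nB.
have nB' : nbhs (a0, t0) (D `&` pinching_of_forms n (space1 R) (space2 R) Z @^-1` B).
  apply: filterI; first exact: open_nbhs_nbhs (conj (chart_open ch) Oz).
  by apply: c0; rewrite -wE // (chart_point ch).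
apply: filterS (chart_cover ch nB') => -[x t] cov Axt.
have [/= Sx It] := sA _ Axt.
have [a [[Oa Ba] /= ax]] := cov Sx; rewrite -ax.
by change (B (flow_pinching (phi a, t))); rewrite wE.
Qed.

(** At an interior maximum of the pinching quantity over S, where it is positive,
    it strictly decreases: it cannot have been smaller by eps per unit of time. *)
Lemma no_growth_at_maximum x0 t0 t1 eps : S x0 -> interior_times T t0 -> t1 < t0 ->
  0 < eps -> 0 < flow_pinching (x0, t0) ->
  (forall x, S x -> flow_pinching (x, t0) <= flow_pinching (x0, t0)) ->
  (forall t, t1 < t -> t <= t0 ->
     flow_pinching (x0, t) <= flow_pinching (x0, t0) + eps * (t - t0)) -> False.
Proof.
move=> Sx0 It0 t10 eps0 w0 xmax tmax; have IIt0 := interior_times_sub It0.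
have [a0 [U [phi [D [Z ch]]]]] := flow_chart_exists surface smooth_flow Sx0 IIt0.
have at_chart := chart_curvature_at embedded normal curvatures convex ch.
pose l1 := in_chart X lambda1 phi; pose l2 := in_chart X lambda2 phi.
have phi0 := chart_point ch; have Dz := chart_center ch; have oD := chart_open ch.
have wE a t : flow_pinching (phi a, t) = pinching n l1 l2 (a, t) by [].
pose D' : set V := D `&` snd @^-1` (interior_times T : set R^o).
have oD' : open D'.
  apply: openI => //; apply: open_comp; last exact: open_interior_times.
  by move=> ? _; exact: snd_continuous.
have patch : curvature_patch D' (space1 R) (space2 R) Z (in_chart X nu phi) l1 l2.
  split=> [//|k|[a t] [Da /interior_times_sub It]]; last exact: at_chart.
  by apply: Ck_subset (chart_smooth ch k) => y [].
have flowD y : D' y -> 'D_(time_direction R) Z y =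
    - (speed n (l1 y) (l2 y) *: in_chart X nu phi y).
  case: y => a t [Da It]; have Ua := chart_domain ch Da.
  have Sa := chart_in_surface ch Ua.
  have nt : nbhs t (fun s => D (a, s)).
    have c : (fun s : R^o => (a, s)) @ t --> (a, t).
      have c1 : (fun _ : R^o => a) @ t --> a by exact: cvg_cst.
      have c2 : (fun s : R^o => s) @ t --> t by exact: cvg_id.
      exact: cvg_pair c1 c2.
    by apply: c; exact: open_nbhs_nbhs.
  rewrite [LHS]derive_time_slice.
  have Zx s : D (a, s) -> I s -> Z (a, s) = X s (phi a) by exact: (chart_flow ch).
  exact: (derivative_within_lim (g := fun s => Z (a, s)) (flow (interior_times_sub It) Sa)
    It nt Zx).
have D'z : D' (a0, t0) by [].
have lz : l1 (a0, t0) != l2 (a0, t0).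
  apply: contraTneq w0 => ll; rewrite -phi0 wE /pinching ll /wnum subrr.
  by rewrite expr2 !mulr0 mul0r ltxx.
have smax (s t : R) : \forall r \near (0 : R), pinching n l1 l2
    (r *: (s *: space1 R + t *: space2 R) + (a0, t0)) <= pinching n l1 l2 (a0, t0).
  have nD : \forall y \near ((a0, t0) : V), D y by exact: open_nbhs_nbhs.
  have eqz (r : R) : r *: (s *: space1 R + t *: space2 R) + ((a0, t0) : V) =
      (r *: (s *: delta_mx 0 0 + t *: delta_mx 0 1) + a0, t0).
    by congr pair; rewrite /= !scaler0 addr0 scaler0 add0r.
  apply: filterS (near0_line (s *: space1 R + t *: space2 R) nD) => r.
  rewrite eqz => Dr; rewrite -!wE phi0; apply: xmax.
  have Ua := chart_domain ch Dr.
  exact: (chart_in_surface ch Ua).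
have [D'' [W [Dz'' WE dW]]] := patch_decreases patch flowD D'z lz smax hn.
have before := partial_lt0_before Dz'' dW.
have nD'' : \forall y \near ((a0, t0) : V), D'' y.
  exact: open_nbhs_nbhs (conj (dom_open D'') Dz'').
have line := near0_line (time_direction R) nD''.
have nt1 : \forall r \near (0 : R), t1 - t0 < r.
  by apply: (open_nbhs_nbhs (conj (@open_gt R (t1 - t0)) _)); rewrite /= subr_lt0.
have [e /= e0 eP] := (nbhs_ballP _ _).1 (filterI before (filterI line nt1)).
pose r := - (e / 2); have r0 : r < 0 by rewrite oppr_lt0 divr_gt0.
have rball : ball (0 : R) e r.
  by rewrite /ball /= sub0r opprK gtr0_norm ?divr_gt0 //; lra.
have [wr [Dr tr]] := eP r rball.
have zr : r *: time_direction R + ((a0, t0) : V) = (a0, t0 + r).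
  by congr pair; rewrite /= ?scaler0 ?add0r // /GRing.scale /= mulr1 addrC.
have := wr r0; rewrite (WE _ Dz''); rewrite zr in Dr *; rewrite (WE _ Dr) -!wE phi0.
apply/negP; rewrite -leNgt.
have t1r : t1 < t0 + r by rewrite addrC -ltrBlDr.
have rt0 : t0 + r <= t0 by rewrite gerDl ltW.
apply: le_trans (tmax _ t1r rt0) _.
by rewrite addrAC subrr add0r gerDl pmulr_rle0 // ltW.
Qed.

Lemma pinching_maximum_exists t : I t -> exists2 x, S x &
  forall y, S y -> flow_pinching (y, t) <= flow_pinching (x, t).
Proof.
move=> It; have [[x1 Sx1] cS _ _] := surface.
pose A : set M := S `*` [set t : R^o].
have cA : compact A by apply: compact_setX => //; exact: compact_set1.
have sA : A `<=` S `*` I by move=> [x s] [/= Sx ->].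
have A0 : A !=set0 by exists (x1, t).
have [[x s] xA max] := compact_EVT_max A0 cA (flow_pinching_continuous sA).
move: xA; rewrite inE => -[/= Sx st]; rewrite st in max; exists x => // y Sy.
by apply: max; rewrite inE.
Qed.

(** The maximum over S x [t1, t2] of the pinching quantity minus eps (t - t1) is
    attained at the initial time. *)
Lemma pinching_growth_bound t1 t2 eps : I t1 -> I t2 -> t1 <= t2 -> 0 < eps ->
  forall x, S x -> exists2 y, S y &
    flow_pinching (x, t2) <= flow_pinching (y, t1) + eps * (t2 - t1).
Proof.
move=> It1 It2 t12 eps0 x Sx.
pose A : set M := S `*` (`[t1, t2]%classic : set R^o).
have [_ cS _ _] := surface.
have cA : compact A by apply: compact_setX => //; exact: segment_compact.
have sA : A `<=` S `*` I.
  move=> [y s] [/= Sy]; rewrite in_itv /= => /andP[s1 s2]; split=> //=.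
  exact: time_interval_between s1 s2.
pose g (z : M) : R := flow_pinching z - eps * (z.2 - t1).
have cg : {within A, continuous g}.
  apply/subspace_continuousP => z Az.
  have c1 := (subspace_continuousP _ _).1 (flow_pinching_continuous sA) z Az.
  have c2 : {for z, continuous (fun z : M => eps * (z.2 - t1))}.
    apply: (@continuousM R M); first exact: cst_continuous.
    apply: (@continuousB R R^o M); last exact: cst_continuous.
    exact: snd_continuous.
  apply: (@cvgB R R^o) => //; apply: cvg_trans c2; apply: cvg_app; exact: cvg_within.
have A0 : A !=set0 by exists (x, t1); split=> //=; rewrite in_itv /= lexx.
have [[x0 t0] x0A max] := compact_EVT_max A0 cA cg.
move: x0A; rewrite inE => -[/= Sx0]; rewrite in_itv /= => /andP[t10 t02].
have gmax y s : S y -> t1 <= s -> s <= t2 -> g (y, s) <= g (x0, t0).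
  by move=> Sy s1 s2; apply: max; rewrite inE; split=> //=; rewrite in_itv /= s1.
have [t0E|t01] := eqVneq t0 t1.
  exists x0 => //; have := gmax x t2 Sx t12 (lexx _).
  by rewrite /g /= t0E subrr mulr0 subr0 lerBlDr.
have {}t01 : t1 < t0 by rewrite lt_neqAle eq_sym t01.
have It0 := interior_times_between It1 It2 t01 t02.
exfalso; apply: (no_growth_at_maximum Sx0 It0 t01 eps0).
- have := gmax x0 t1 Sx0 (lexx _) t12; rewrite /g /= subrr mulr0 subr0 => w1.
  apply: lt_le_trans (_ : eps * (t0 - t1) <= _); first by rewrite mulr_gt0 // subr_gt0.
  have := le_trans (flow_pinching_ge0 Sx0 It1) w1; by rewrite subr_ge0.
- move=> y Sy; have := gmax y t0 Sy t10 t02; by rewrite /g /= lerD2r.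
- move=> t t1t tt0.
  have := gmax x0 t Sx0 (ltW t1t) (le_trans tt0 t02); rewrite /g /=.
  move: (flow_pinching _) (flow_pinching _) => a b; lra.
Qed.

Theorem pinching_maximum_nonincreasing :
  exists maxw : R -> R,
    (forall t, I t -> (exists2 x, S x & maxw t = flow_pinching (x, t)) /\
       forall x, S x -> flow_pinching (x, t) <= maxw t) /\
    (forall t1 t2, I t1 -> I t2 -> t1 <= t2 -> maxw t2 <= maxw t1).
Proof.
have H t : exists m, I t -> (exists2 x, S x & m = flow_pinching (x, t)) /\
    forall x, S x -> flow_pinching (x, t) <= m.
  have [It|nI] := pselect (I t); last by exists 0.
  have [x Sx max] := pinching_maximum_exists It.
  by exists (flow_pinching (x, t)) => _; split=> //; exists x.
have [maxw maxP] := choice H; exists maxw; split=> // t1 t2 It1 It2 t12.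
have [[x Sx ->] _] := maxP t2 It2; have [_ le1] := maxP t1 It1.
apply/ler_addgt0Pr => e e0.
have c0 : 0 < t2 - t1 + 1 by rewrite ltr_wpDl // subr_ge0.
have [y Sy bound] := pinching_growth_bound It1 It2 t12 (divr_gt0 e0 c0) Sx.
apply: le_trans bound _; apply: lerD; first exact: le1.
by rewrite mulrAC ler_pdivrMr // ler_pM2l // lerDl.
Qed.

End MaximumPrinciple.

Unset Implicit Arguments.
Set Strict Implicit.

Theorem theorem10p2 (R : realType) (alpha : nat)
  (halpha : alpha \in [:: 2%N; 3%N; 4%N])
  (T : \bar R) (hT : (0 < T)%E)
  (S : set 'rV[R]_3) (hS : closed_surface S)
  (X : R -> 'rV[R]_3 -> 'rV[R]_3)
  (hXsmooth : @smooth_on R ('rV[R]_3 * R^o)%type 'rV[R]_3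
                (S `*` time_interval T) (fun z => X z.2 z.1))
  (hXemb : forall t, time_interval T t -> embedding S (X t))
  (nu : R -> 'rV[R]_3 -> 'rV[R]_3)
  (hnu : forall t p, time_interval T t -> (X t @` S) p ->
     outer_unit_normal (X t @` S) p (nu t p))
  (lambda1 lambda2 : R -> 'rV[R]_3 -> R)
  (hlambda : forall t p, time_interval T t -> (X t @` S) p ->
     principal_curvatures (X t @` S) p (nu t p) (lambda1 t p) (lambda2 t p))
  (hconvex : forall t p, time_interval T t -> (X t @` S) p ->
     0 < lambda1 t p /\ 0 < lambda2 t p)
  (hflow : forall t x, time_interval T t -> S x ->
     has_derivative_within (time_interval T) (fun s => X s x) t
       (- ((lambda1 t (X t x) ^+ (alpha + 2) +
            lambda2 t (X t x) ^+ (alpha + 2)) *: nu t (X t x)))) :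
  let w (t : R) (p : 'rV[R]_3) : R :=
    (lambda1 t p ^+ alpha + lambda2 t p ^+ alpha) *
    (lambda1 t p + lambda2 t p) * (lambda1 t p - lambda2 t p) ^+ 2 /
    (lambda1 t p * lambda2 t p) in
  exists maxw : R -> R,
    (forall t, time_interval T t -> is_maximum (w t @` (X t @` S)) (maxw t)) /\
    (forall t1 t2, time_interval T t1 -> time_interval T t2 ->
       t1 <= t2 -> maxw t2 <= maxw t1).
Proof.
move=> w.
have [maxw [attained mono]] := pinching_maximum_nonincreasing
  halpha hS hXsmooth hXemb hnu hlambda hconvex hflow.
exists maxw; split=> // t It; have [[x Sx E] ub] := attained t It.
split; first by exists (X t x); [exists x | rewrite E].
by move=> _ [_ [y Sy <-] <-]; exact: ub.
Qed.
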